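(* Let $1<p_1,p_2<\infty$ be real numbers and let $p=\frac{p_1p_2}{p_1+p_2}$. Then there is a constant $C=C(p_1,p_2)<\infty$ such that $$\|S^2(f,g)\|_{L^p(\mathbb{R})}\le C\,\|f\|_{L^{p_1}(\mathbb{R})}\|g\|_{L^{p_2}(\mathbb{R})}$$ for all Schwartz functions $f,g$ on $\mathbb{R}$ if and only if $p_1>2$ and $p_2>2$. In this case $S^2$ admits a unique bounded extension from $L^{p_1}(\mathbb{R})\times L^{p_2}(\mathbb{R})$ to $L^p(\mathbb{R})$. Moreover, in the end cases $p_1=2$ and $p_2=2$ the operator $S^2$ fails to be of weak type. More precisely: (i) for every $1\le p_2\le\infty$, with $\frac1p=\frac12+\frac1{p_2}$, $S^2$ does not boundedly map $L^2(\mathbb{R})\times L^{p_2}(\mathbb{R})\to L^{p,\infty}(\mathbb{R})$; (ii) for every $1\le p_1\le\infty$, with $\frac1p=\frac1{p_1}+\frac12$, $S^2$ does not boundedly map $L^{p_1}(\mathbb{R})\times L^2(\mathbb{R})\to L^{p,\infty}(\mathbb{R})$.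
   Context: For Schwartz functions $f,g$ on $\mathbb{R}$, the bilinear spherical maximal function in dimension one is $$S^2(f,g)(x)=\sup_{t>0}\left|\int_{\mathbb{S}^1} f(x-ty_1)\,g(x-ty_2)\,d\sigma(y_1,y_2)\right|,\qquad x\in\mathbb{R},$$ where $\mathbb{S}^1\subset\mathbb{R}^2$ is the unit circle and $\sigma$ is its normalized arclength measure. The exponent $p$ may be smaller than $1$, in which case $\|\cdot\|_{L^p}$ is the usual quasi-norm. For $0<p<\infty$, $\|h\|_{L^{p,\infty}(\mathbb{R})}=\sup_{\lambda>0}\lambda\,|\{x\in\mathbb{R}:|h(x)|>\lambda\}|^{1/p}$, where $|\cdot|$ of a set denotes Lebesgue measure. Convention: $1/\infty=0$. ''$S^2$ boundedly maps $L^{p_1}\times L^{p_2}\to L^{p,\infty}$'' means that there is a finite constant $C$ with $\|S^2(f,g)\|_{L^{p,\infty}}\le C\|f\|_{L^{p_1}}\|g\|_{L^{p_2}}$ for all Schwartz functions $f,g$. A ''bounded extension'' of $S^2$ is a continuous map $T:L^{p_1}(\mathbb{R})\times L^{p_2}(\mathbb{R})\to L^p(\mathbb{R})$ that agrees with $S^2$ on pairs of Schwartz functions and satisfies $\|T(f,g)\|_{L^p}\le C\|f\|_{L^{p_1}}\|g\|_{L^{p_2}}$ for all $f,g$, for some finite $C$. *)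

(* Defs.v *)
From HB Require Import structures.
From mathcomp Require Import all_boot all_order all_algebra.
From mathcomp Require Import generic_quotient.
From mathcomp Require Import complex.
From mathcomp Require Import all_classical all_reals all_analysis measurable_realfun.

Set Implicit Arguments.
Unset Strict Implicit.
Unset Printing Implicit Defensive.

Import Order.TTheory GRing.Theory Num.Theory.
Import numFieldNormedType.Exports.

Local Open Scope classical_set_scope.
Local Open Scope ring_scope.
Local Open Scope quotient_scope.

Local Notation Re := (@complex.Re _).
Local Notation Im := (@complex.Im _).
Local Notation normc := Normc.normc.

(* Test functions and the elements of the L^p spaces are complex valued; [R[i]]
   carries no normed-module structure over [R], so derivatives, integrals and
   measurability are taken on real and imaginary parts. *)

Section schwartz.
Context {R : realType}.
Implicit Types f : R -> R[i].

Definition cderive1n (n : nat) f (x : R) : R[i] :=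
  Complex (derive1n n (Re \o f) x) (derive1n n (Im \o f) x).

Definition schwartz f : Prop :=
  (forall (n : nat) (x : R),
     derivable (derive1n n (Re \o f)) x 1 /\
     derivable (derive1n n (Im \o f)) x 1) /\
  (forall m n : nat, exists M : R, forall x : R,
     `|x| ^+ m * normc (cderive1n n f x) <= M).

End schwartz.

Section circle.
Context {R : realType}.

Definition circle_map (theta : measurableTypeR R) : R * R := (cos theta, sin theta).

Lemma measurable_circle_map : measurable_fun setT circle_map.
Proof.
apply: measurable_fun_pair.
- by apply: continuous_measurable_fun; exact: continuous_cos.
- by apply: continuous_measurable_fun; exact: continuous_sin.
Qed.

HB.instance Definition _ :=
  isMeasurableFun.Build _ _ _ _ circle_map measurable_circle_map.

Lemma two_pi_gt0 : 0 < 2 * pi :> R.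
Proof. by rewrite mulr_gt0// pi_gt0. Qed.

Definition unit_circle : set (R * R) := [set y | y.1 ^+ 2 + y.2 ^+ 2 = 1].

(* Normalized arclength: the arclength parametrization of the circle pushes the
   uniform probability on [0, 2 pi] forward to it. *)
Definition arclength := distribution (uniform_prob two_pi_gt0) circle_map.

End circle.

Section spherical_maximal_function.
Context {R : realType}.
Implicit Types f g : R -> R[i].

Definition Cintegral d (T : measurableType d) (nu : {measure set T -> \bar R})
    (D : set T) (h : T -> R[i]) : R[i] :=
  Complex (\int[nu]_(y in D) Re (h y)) (\int[nu]_(y in D) Im (h y)).

Definition circle_avg f g (t x : R) : R[i] :=
  Cintegral arclength unit_circle
    (fun y : R * R => f (x - t * y.1) * g (x - t * y.2)).

Definition S2 f g (x : R) : \bar R :=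
  ereal_sup [set (normc (circle_avg f g t x))%:E | t in [set t : R | 0 < t]].

End spherical_maximal_function.

Section norms.
Context {R : realType}.
Local Notation mu := (@lebesgue_measure R).
Local Open Scope ereal_scope.

Definition CLnorm (p : \bar R) (f : R -> R[i]) : \bar R :=
  'N[mu]_p[(fun x => (normc (f x))%:E)].

Definition weak_Lnorm (p : R) (h : R -> \bar R) : \bar R :=
  ereal_sup [set l%:E * mu [set x | l%:E < `|h x|] `^ p^-1 |
             l in [set l : R | (0 < l)%R]].

End norms.

Section Lp_space.
Context {R : realType}.
Local Notation mu := (@lebesgue_measure R).

(* The library's [LspaceType] covers only real-valued functions and p >= 1. *)
Record CLfun (p : \bar R) := MkCLfun {
  CLfun_val :> R -> R[i];
  CLfun_Re : measurable_fun [set: R] (Re \o CLfun_val);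
  CLfun_Im : measurable_fun [set: R] (Im \o CLfun_val);
  CLfun_finite : (CLnorm p CLfun_val < +oo)%E }.

HB.instance Definition _ p := gen_eqMixin (CLfun p).
HB.instance Definition _ p := gen_choiceMixin (CLfun p).

Section quotient.
Variable p : \bar R.

Definition CLfun_eq (f g : CLfun p) : bool :=
  `[< {ae mu, forall x, f x = g x} >].

Lemma CLfun_eq_refl : reflexive CLfun_eq.
Proof. by move=> f; apply/asboolP; apply: aeW. Qed.

Lemma CLfun_eq_sym : symmetric CLfun_eq.
Proof.
by move=> f g; apply/idP/idP => /asboolP h; apply/asboolP;
  apply: (@filterS _ _ (ae_filter_ringOfSetsType mu) _ _ _ h) => x /= ->.
Qed.

Lemma CLfun_eq_trans : transitive CLfun_eq.
Proof.
move=> g f h /asboolP fg /asboolP gh; apply/asboolP.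
by apply: (@filterS2 _ _ (ae_filter_ringOfSetsType mu) _ _ _ _ fg gh) =>
  x /= -> ->.
Qed.

Canonical CLfun_eq_canonical :=
  EquivRel CLfun_eq CLfun_eq_refl CLfun_eq_sym CLfun_eq_trans.

Definition CLspace : Type := {eq_quot CLfun_eq}.

Definition CLclass (f : CLfun p) : CLspace := \pi_{eq_quot CLfun_eq} f.

Definition CLrepr (u : CLspace) : CLfun p := repr (u : {eq_quot CLfun_eq}).

Definition CLspace_norm (u : CLspace) : \bar R := CLnorm p (CLrepr u).

Definition CLspace_dist (u v : CLspace) : \bar R :=
  CLnorm p (fun x => CLrepr u x - CLrepr v x).

End quotient.
End Lp_space.

Section boundedness.
Context {R : realType}.
Local Open Scope ereal_scope.

Definition S2_strong_bounded (p1 p2 p : R) : Prop :=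
  exists C : R, forall f g : R -> R[i], schwartz f -> schwartz g ->
    'N[@lebesgue_measure R]_p%:E[S2 f g]
      <= C%:E * (CLnorm p1%:E f * CLnorm p2%:E g).

Definition S2_weak_bounded (p1 p2 : \bar R) (p : R) : Prop :=
  exists C : R, forall f g : R -> R[i], schwartz f -> schwartz g ->
    weak_Lnorm p (S2 f g) <= C%:E * (CLnorm p1 f * CLnorm p2 g).

(* Continuity is for the (quasi-)norm topologies. *)
Definition CLspace_continuous (p1 p2 p : \bar R)
    (T : CLspace p1 * CLspace p2 -> CLspace p) : Prop :=
  forall (u : CLspace p1) (v : CLspace p2) (e : R), (0 < e)%R ->
    exists2 d : R, (0 < d)%R &
      forall (u' : CLspace p1) (v' : CLspace p2),
        CLspace_dist u' u < d%:E -> CLspace_dist v' v < d%:E ->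
        CLspace_dist (T (u', v')) (T (u, v)) < e%:E.

(* Schwartz functions are measurable with finite norm, hence all arise as the
   underlying function of an element of [CLfun p1] and of [CLfun p2]. *)
Definition S2_bounded_extension (p1 p2 p : \bar R)
    (T : CLspace p1 * CLspace p2 -> CLspace p) : Prop :=
  [/\ CLspace_continuous T,
      (forall (f : CLfun p1) (g : CLfun p2), schwartz f -> schwartz g ->
         {ae @lebesgue_measure R, forall x,
            Im (CLrepr (T (CLclass f, CLclass g)) x) = 0%R /\
            (Re (CLrepr (T (CLclass f, CLclass g)) x))%:E = S2 f g x}) &
      exists C : R, forall (u : CLspace p1) (v : CLspace p2),
        CLspace_norm (T (u, v)) <= C%:E * (CLspace_norm u * CLspace_norm v)].

End boundedness.

(* Main.v *)
(* Positive direction. On an arc where [y_1] is close to its extreme value, [s -> cos s] is only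
   expanding by a factor [s], so [f] must pay for it: a dyadic decomposition in [s] and Hoelder's
   inequality with exponents [a > 2 > b], [1/a + 1/b = 1], bound the average at [x], for every
   radius, by [M(|f|^a)^(1/a) M(|g|^b)^(1/b)], where [M] is the Hardy-Littlewood maximal
   operator; the four extremal directions give this bound and the one with [a] and [b]
   exchanged. When [p1, p2 > 2] one can choose [2 < a < min (p1, p2)], and the strong type of [M]
   together with Hoelder's inequality conclude. The same bound applied to differences makes the
   operator Lipschitz on bounded sets, hence it extends continuously; the extension is unique
   because Schwartz functions are dense.

   Negative direction. For [f = \sum_(k < N) 2^k exp (- 16^k y^2)], a smooth truncation of
   [|y|^(-1/2)], and a fixed Gaussian [g], each term of the sum contributes a fixed amount to the
   average at [x] of radius [t = x], so [S2 f g] is at least [c N] on [1, 2], whereas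
   [||f||_p1^p1] is at most [K N] for all [1 <= p1 <= 2]. *)

(* With [a = b = 2] the bound on a dyadic arc would carry no power of [s], and infinitely many arcs
   would contribute equally. The exponents are therefore split: the expansion of [cos] costs
   [s^(-1/a)], while the other coordinate moves over a length comparable to [s] and gains [s^(1/b)].
   As each function meets both exponents, both [p1] and [p2] must exceed [a]. The counterexample
   realises the divergence. A bump of height [2^k] and width [4^-k] has an [L^2] norm comparable to
   [4^(k/2) * 4^(-k/2) = 1], and [1 - cos s <= s^2 / 2] turns the width [4^-k] into an arc of length
   [2^-k], over which the height integrates to a constant. So [N] bumps produce [N] in the maximal
   function but only [N^(1/p1)] in the norm. Since [p1, p2 > 2] forces [p >= 1], Minkowski's
   inequality is available for the positive part. The operator is not bilinear, so no linear
   extension principle applies: the extension is written down directly as a supremum over rational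
   radii, and its continuity rests on the fact that suprema of two families differ by at most the
   largest difference of their members. *)
From HB Require Import structures.
Require Import Defs.
From mathcomp Require Import all_boot all_order all_algebra.
From mathcomp Require Import generic_quotient complex ring lra.
From mathcomp Require Import all_classical all_reals all_analysis measurable_realfun.

Import Order.TTheory GRing.Theory Num.Theory.
Import numFieldNormedType.Exports.

Local Open Scope classical_set_scope.
Local Open Scope ring_scope.

Set Implicit Arguments.
Unset Strict Implicit.
Unset Printing Implicit Defensive.

(** * Change of variables, as an inequality, for expanding maps *)

Section expanding_substitution.
Context {R : realType}.
Notation mu := (@lebesgue_measure R).
Local Open Scope ereal_scope.

(** Lebesgue measure of [A] is an infimum over countable covers by half-open intervals, so a bound
    on such intervals passes by countable subadditivity to every measurable set. *)
Lemma measure_le_lebesgue (nu : {measure set (measurableTypeR R) -> \bar R})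
    (K : R) : (0 < K)%R ->
  (forall a b, (a <= b)%R -> nu `]a, b]%classic <= (K * (b - a))%:E) ->
  forall A, measurable A -> nu A <= K%:E * mu A.
Proof.
move=> K0 nuK A mA.
rewrite -lee_pdivrMl//; apply: le_ereal_inf_tmp => _ [F [mF AF] <-].
rewrite lee_pdivrMl// -nneseriesZl ?lee_fin//.
have Fitv i : exists a b : R, (a <= b)%R /\ F i = `]a, b]%classic.
  have /ocitvP[->|[[a b] /= ab ->]] : ocitv (F i) by exact: mF.
    by exists 0%R, 0%R; rewrite set_itvoc0.
  by exists a, b; rewrite ltW.
have mF' i : measurable (F i : set (measurableTypeR R)).
  by have [a [b [_ ->]]] := Fitv i; exact: measurable_itv.
apply: (@le_trans _ _ (\sum_(k <oo) nu (F k))).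
  by apply: measure_sigma_subadditive.
apply: lee_nneseries => // i _.
have [a [b [ab ->]]] := Fitv i.
change (nu `]a, b]%classic <= K%:E * @wlength R idfun `]a, b]%classic).
by rewrite wlength_itv_bnd//= -EFinM nuK.
Qed.

(** The push-forward of Lebesgue measure on [D] gives an interval of length [l] mass at most
    [l / m], because the points of [D] sent into it are at mutual distance at most [l / m]. No
    derivative of [phi] enters, so the same statement serves [cos], [sin], reflections and
    dilations. *)
Lemma le_integral_expanding (D E : set R) (phi : R -> R) (m : R)
    (H : R -> \bar R) : (0 < m)%R ->
  measurable D -> measurable E -> measurable_fun setT phi ->
  (forall s s', D s -> D s' -> m * `|s - s'| <= `|phi s - phi s'|)%R ->
  (forall s, D s -> E (phi s)) ->
  measurable_fun setT H -> (forall x, 0 <= H x) ->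
  \int[mu]_(s in D) H (phi s) <= (m^-1)%:E * \int[mu]_(y in E) H y.
Proof.
move=> m0 mD mE mphi phiD DE mH H0.
pose nu := pushforward (mrestr mu mD) (phi : R -> measurableTypeR R).
have nuE A : nu A = mu (phi @^-1` A `&` D) by [].
have mV : (0 <= m^-1)%R by rewrite invr_ge0 ltW.
have nule A : measurable A -> nu A <= mscale (NngNum mV) mu A.
  apply: measure_le_lebesgue; first by rewrite invr_gt0.
  move=> a b ab; change (mu (phi @^-1` `]a, b]%classic `&` D) <= (m^-1 * (b - a))%:E).
  have [[s0 [/= s0ab Ds0]]|] := pselect (phi @^-1` `]a, b]%classic `&` D !=set0);
    last first.
    move=> /set0P/negP/negbNE/eqP ->.
    by rewrite measure0 lee_fin mulr_ge0// subr_ge0.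
  set S := phi @^-1` `]a, b]%classic `&` D.
  have dS s s' : S s -> S s' -> (`|s - s'| <= m^-1 * (b - a))%R.
    move=> [/= sab Ds] [/= s'ab Ds']; rewrite ler_pdivlMl//.
    apply: le_trans (phiD _ _ Ds Ds') _.
    by move: sab s'ab; rewrite !in_itv/= ler_norml => /andP[? ?] /andP[? ?]; lra.
  have iS : has_inf S.
    split; first by exists s0.
    exists (s0 - m^-1 * (b - a))%R => s Ss.
    by have := dS _ _ Ss (conj s0ab Ds0); rewrite ler_norml; lra.
  (* A set of diameter at most [m^-1 * (b - a)] sits in the closed interval of that length that
     starts at its infimum. *)
  have SI : S `<=` `[inf S, (inf S + m^-1 * (b - a))%R]%classic.
    move=> s Ss /=; rewrite in_itv/=; apply/andP; split.
      by apply: ge_inf => //; case: iS.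
    rewrite -lerBlDr; apply: lb_le_inf; first by exists s0.
    move=> s' Ss'.
    by have := dS _ _ Ss Ss'; rewrite ler_norml; lra.
  apply: (@le_trans _ _ (mu `[inf S, (inf S + m^-1 * (b - a))%R]%classic)).
    apply: le_measure => //; rewrite ?inE//.
    by apply: measurableI => //; rewrite -[X in measurable X]setTI; exact: mphi.
  rewrite lebesgue_measure_itv/= lte_fin; case: ifPn => // _.
    by rewrite -EFinB addrAC subrr add0r.
  by rewrite lee_fin mulr_ge0// subr_ge0.
rewrite (_ : _ * _ = \int[mscale (NngNum mV) mu]_(y in E) H y); last first.
  by rewrite ge0_integral_mscale//; exact: measurable_funTS.
apply: le_trans (ge0_le_measure_integral nule mE H0 mH).
rewrite ge0_integral_pushforward//; last exact: measurable_funTS.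
have mHphi : measurable_fun setT (H \o phi) by exact: measurableT_comp.
have mphiE : measurable (phi @^-1` E) by rewrite -[X in measurable X]setTI; exact: mphi.
have -> : \int[mu]_(s in D) H (phi s) = \int[mrestr mu mD]_(s in D) (H \o phi) s.
  apply: eq_measure_integral => A mA AD.
  by change (mu A = mu (A `&` D)); rewrite setIidl.
apply: (@ge0_subset_integral _ _ _ (mrestr mu mD)) => //.
- exact: measurable_funTS.
- by move=> s _; exact: H0.
Qed.

End expanding_substitution.

(** * Comparison of integrals and powers of extended-valued functions *)

Section extended_power.
Context {R : realType}.
Local Open Scope ereal_scope.

(** Read off the definition of the integral as a supremum over simple functions: one that lies below
    [f] on [D] lies below [g]. Comparisons of integrands then carry no measurability side
    conditions. *)
Lemma le_ge0_integral d (T : measurableType d) (mu : {measure set T -> \bar R})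
    (D : set T) (f g : T -> \bar R) :
  (forall x, D x -> 0 <= f x) -> (forall x, D x -> f x <= g x) ->
  \int[mu]_(x in D) f x <= \int[mu]_(x in D) g x.
Proof.
move=> f0 fg; rewrite !ge0_integralE//; last first.
  by move=> x Dx; exact: le_trans (f0 _ Dx) (fg _ Dx).
apply: ge_ereal_sup => _ [h/= hf <-]; apply: ereal_sup_ubound; exists h => //= x.
apply: le_trans (hf x) _; rewrite !patchE; case: ifPn => // /[!inE].
exact: fg.
Qed.

Lemma le_poweR (r : R) (x y : \bar R) : (0 <= r)%R -> 0 <= x -> x <= y ->
  x `^ r <= y `^ r.
Proof.
move=> r0 x0 xy; apply: gt0_ler_poweR => //; rewrite in_itv/= ?x0 ?leey//.
by rewrite (le_trans x0 xy).
Qed.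

Lemma measurable_poweR_fun d (T : measurableType d) (D : set T) (r : R)
    (f : T -> \bar R) :
  measurable_fun D f -> measurable_fun D (fun x => f x `^ r).
Proof. by move=> mf; exact: (measurableT_comp (measurable_poweR r)). Qed.

Lemma measurable_EFin_fun d (T : measurableType d) (D : set T) (f : T -> R) :
  measurable_fun D f -> measurable_fun D (fun x => (f x)%:E).
Proof. by move=> mf; apply/measurable_EFinP. Qed.

End extended_power.

(** * The weak-type bound for a truncated function *)

Section maximal_strong_type.
Context {R : realType}.
Notation mu := (@lebesgue_measure R).
Local Open Scope ereal_scope.
Implicit Types f : R -> R.

(** Pointwise [|f| <= 1 + |f|^q], and both terms have finite integral over a compact set. *)
Lemma Lp_locally_integrable f (q : R) : (1 <= q)%R -> measurable_fun setT f ->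
  \int[mu]_x (`|f x| `^ q)%:E < +oo -> locally_integrable setT f.
Proof.
move=> q1 mf fq; split => //; first exact: openT.
move=> K _ cK.
have mK : measurable K by exact: compact_measurable.
have mfq : measurable_fun setT (fun x => (`|f x| `^ q)%:E).
  apply/measurable_EFinP; apply: (measurableT_comp (measurable_powR q)).
  exact: measurableT_comp.
apply: (@le_lt_trans _ _ (\int[mu]_(x in K) (1 + (`|f x| `^ q)%:E))).
  apply: le_ge0_integral => // x _; rewrite -EFinD lee_fin.
  have [f1|f1] := leP `|f x|%R 1%R; first by rewrite (le_trans f1)// lerDl powR_ge0.
  by rewrite (@le_trans _ _ (`|f x| `^ q)%R) ?lerDr//; apply: le1r_powR => //; exact: ltW.
rewrite ge0_integralD//; last first.
  exact: measurable_funTS.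
rewrite integral_cst// mul1e lte_add_pinfty//; first exact: compact_finite_measure.
by apply: le_lt_trans fq; apply: ge0_subset_integral.
Qed.

(* Cutting [f] at height [l / 2] lowers its maximal function by at most [l / 2]. *)
Lemma HL_maximal_truncation f (l : R) : (0 < l)%R -> locally_integrable setT f ->
  mu [set x | l%:E < HL_maximal f x] <=
  (6 / l)%:E * \int[mu]_x (`|f x| * (l < 2 * `|f x|)%R%:R)%:E.
Proof.
move=> l0 lf; have [mf _ _] := lf.
pose f1 x := (`|f x| * (l < 2 * `|f x|)%R%:R)%R.
have mf1 : measurable_fun setT f1.
  apply: measurable_funM; first exact: measurableT_comp.
  apply: (@measurableT_comp _ _ _ _ _ _ (fun b : bool => b%:R : R)) => //.
  apply: measurable_fun_ltr => //; apply: measurable_funM => //.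
  exact: measurableT_comp.
have f10 x : (0 <= f1 x)%R by rewrite mulr_ge0.
(* If the truncation is not integrable, the right-hand side is infinite; otherwise the weak-type
   inequality applies to it. *)
have [If1|] := ltP (\int[mu]_x (f1 x)%:E) +oo; last first.
  by rewrite leye_eq => /eqP ->; rewrite gt0_muley ?leey// lte_fin divr_gt0.
have lf1 : locally_integrable setT f1.
  apply: open_integrable_locally; first exact: openT.
  apply/integrableP; split; first exact/measurable_EFinP.
  by under eq_integral do rewrite /= ger0_norm//.
have step x : l%:E < HL_maximal f x -> (l / 2)%:E < HL_maximal f1 x.
  move=> /ereal_sup_gt[_ [r /= r0 <-] lr].
  have {}r0 : (0 < r)%R by move: r0; rewrite in_itv/= andbT.
  apply: (@lt_le_trans _ _ (iavg f1 (ball x r))); last first.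
    by apply: ereal_sup_ubound => /=; exists r => //; rewrite in_itv/= r0.
  have mB : measurable (ball x r) by exact: measurable_ball.
  have leI : \int[mu]_(y in ball x r) `|(f y)%:E| <=
     (l / 2)%:E * mu (ball x r) + \int[mu]_(y in ball x r) `|(f1 y)%:E|.
    rewrite -integral_cst// -ge0_integralD//; last first.
    - by apply: measurable_funTS; do 2 apply: measurableT_comp => //.
    - by move=> y _; rewrite lee_fin divr_ge0// ltW.
    apply: le_ge0_integral => // y _; rewrite -EFinD lee_fin (ger0_norm (f10 y)).
    by rewrite /f1; case: ltP => ?; rewrite ?mulr1 ?mulr0; lra.
  have muB : mu (ball x r) = (r *+ 2)%:E by rewrite lebesgue_measure_ball// ltW.
  rewrite muB in leI; move: lr; rewrite /iavg muB.
  have r20 : (r *+ 2 != 0)%R by rewrite mulrn_eq0/= gt_eqF.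
  have r2p : (0 < r *+ 2)%R by rewrite pmulrn_lgt0.
  rewrite inver (negbTE r20) => lr.
  rewrite lte_pdivlMl//; move: lr; rewrite lte_pdivlMl// => lr.
  have := lt_le_trans lr leI.
  have -> : (r *+ 2)%:E * l%:E = (l / 2)%:E * (r *+ 2)%:E + (r *+ 2)%:E * (l / 2)%:E.
    by rewrite -!EFinM -EFinD; congr EFin; lra.
  by rewrite lteD2lE.
apply: (@le_trans _ _ (mu [set x | (l / 2)%:E < HL_maximal f1 x])).
  apply: le_measure; rewrite ?inE//=.
  - rewrite -[X in measurable X]setTI; apply: emeasurable_fun_o_infty => //.
    exact: measurable_HL_maximal.
  - rewrite -[X in measurable X]setTI; apply: emeasurable_fun_o_infty => //.
    exact: measurable_HL_maximal.
apply: le_trans (maximal_inequality lf1 _) _; first by rewrite divr_gt0.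
(* [3] is the constant of the weak-type inequality, used at level [l / 2]. *)
rewrite (_ : (3 / (l / 2) = 6 / l)%R); last by field; rewrite gt_eqF.
by under eq_integral do rewrite /= ger0_norm//.
Qed.

End maximal_strong_type.

(** * Dyadic sums replacing the layer-cake integral *)

Section dyadic_sums.
Context {R : realType}.

(** The sum is geometric and stops at the last [k] with [2^k * e < z], so it is comparable to its
    last term, which is at most [z^s]. *)
Lemma dyadic_power_sum (s e z : R) (N : nat) : 0 < s -> 0 < e -> 0 <= z ->
  \sum_(k < N) (2 ^+ k * e) `^ s * (2 ^+ k * e < z)%R%:R <=
  2 `^ s / (2 `^ s - 1) * z `^ s.
Proof.
move=> s0 e0 z0.
have B0 : 0 < 2 `^ s - 1 :> R.
  by rewrite subr_gt0 -{1}(congr1 (@^~ s) (powR1 R)) gt0_ltr_powR ?nnegrE// ltr1n.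
have full n : \sum_(k < n) (2 ^+ k * e) `^ s <= (2 `^ s - 1)^-1 * (2 ^+ n * e) `^ s.
  elim: n => [|n IH]; first by rewrite big_ord0 mulr_ge0 ?powR_ge0// invr_ge0 ltW.
  rewrite big_ord_recr/=; apply: le_trans (lerD IH (lexx _)) _.
  rewrite exprS -mulrA (powRM _ (x := 2)) ?mulr_ge0 ?exprn_ge0 ?(ltW e0)//.
  set y := (2 ^+ n * e) `^ s; rewrite le_eqVlt; apply/orP; left; apply/eqP.
  by field; rewrite gt_eqF.
elim: N => [|N IH].
  by rewrite big_ord0 mulr_ge0 ?powR_ge0// divr_ge0 ?powR_ge0 ?ltW.
(* If the last indicator is 1, all of them are replaced by 1 and the whole geometric sum is
   controlled by [z]; if it is 0, the term vanishes and induction applies. *)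
rewrite big_ord_recr/=; have [lz|lz] := ltP (2 ^+ N * e) z; last by rewrite mulr0 addr0.
rewrite mulr1; apply: (@le_trans _ _ (\sum_(k < N.+1) (2 ^+ k * e) `^ s)).
  rewrite big_ord_recr/= lerD2r; apply: ler_sum => k _.
  by rewrite ler_piMr ?powR_ge0// lern1 leq_b1.
apply: le_trans (full _) _.
rewrite exprS -mulrA (powRM _ (x := 2)) ?mulr_ge0 ?exprn_ge0 ?(ltW e0)// mulrA.
rewrite (mulrC _ (2 `^ s)) ler_wpM2l ?divr_ge0 ?powR_ge0 ?(ltW B0)//.
by apply: ge0_ler_powR; rewrite ?nnegrE ?mulr_ge0 ?exprn_ge0 ?(ltW e0) ?(ltW s0) ?(ltW lz).
Qed.

(** Discrete layer cake: if [k] is the last active level, the truncated value is at most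
    [2^(k+1) * e], so that single term already dominates. *)
Lemma truncated_power_le (q e : R) (y : \bar R) (N : nat) : 0 < q -> 0 < e ->
  ((e%:E < y)%E%:R%:E * mine y (2 ^+ N.+1 * e)%:E `^ q <=
   (\sum_(k < N.+1) (2 ^+ k.+1 * e) `^ q * ((2 ^+ k * e)%:E < y)%E%:R)%:E)%E.
Proof.
move=> q0 e0.
have [ey|_] := ltP e%:E y; last first.
  by rewrite mul0e lee_fin; apply: sumr_ge0 => k _; rewrite mulr_ge0 ?powR_ge0.
rewrite mul1e.
have y0 : (0 <= y)%E by apply: le_trans (ltW ey); rewrite lee_fin ltW.
have minle n : (mine y (2 ^+ n * e)%:E `^ q <= ((2 ^+ n * e) `^ q)%:E)%E.
  rewrite -poweR_EFin; apply: le_poweR; rewrite ?(ltW q0)//.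
    by rewrite le_min y0 lee_fin mulr_ge0 ?exprn_ge0// ltW.
  by rewrite ge_min lexx orbT.
elim: N => [|N IH]; rewrite big_ord_recr/= EFinD.
  by rewrite big_ord0 add0e [(2 ^+ 0)%R]expr0 [(1 * e)%R]mul1r ey mulr1 minle.
have S0 : (0 <= (\sum_(k < N.+1) (2 ^+ k.+1 * e) `^ q * ((2 ^+ k * e)%:E < y)%E%:R)%:E)%E.
  by rewrite lee_fin; apply: sumr_ge0 => k _; rewrite mulr_ge0 ?powR_ge0.
have minN := minle N.+2.
case: (ltP (2 ^+ N.+1 * e)%:E y) => [ly|yl].
  by rewrite mulr1; apply: le_trans minN _; rewrite leeDr.
rewrite mulr0 adde0; apply: le_trans IH.
rewrite (min_idPl yl) (min_idPl _)//; apply: le_trans yl _.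
by rewrite lee_fin ler_wpM2r ?(ltW e0)// [leRHS]exprS ler_peMl ?exprn_ge0// ler1n.
Qed.

End dyadic_sums.

(** * Strong type of the Hardy-Littlewood maximal operator *)

Section maximal_strong_type_theorem.
Context {R : realType}.
Notation mu := (@lebesgue_measure R).
Local Open Scope ereal_scope.
Implicit Types f : R -> R.

(* Replacing [HL_maximal f ^ q] by these truncations reduces the layer-cake formula to the
   finite dyadic sums of [truncated_power_le]. *)
Lemma cvg_truncated_power (q : R) (y : \bar R) : (0 < q)%R -> 0 <= y ->
  ((2^-1 ^+ n)%:E < y)%E%:R%:E *
    mine y (2 ^+ (n + n).+1 * 2^-1 ^+ n)%:E `^ q @[n --> \oo] --> y `^ q.
Proof.
move=> q0 y0.
(* This explains the count [(n + n).+1]: the lower threshold [2^-n] tends to 0 while the cap, equal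
   to [2^(n+1)], tends to infinity. *)
have E n : (2 ^+ (n + n).+1 * 2^-1 ^+ n = 2 ^+ n.+1 :> R)%R.
  by rewrite exprS exprD -!mulrA -exprMn divff ?expr1n ?mulr1 ?exprS.
have lim2 (A : R) : \forall n \near \oo, (A <= 2 ^+ n.+1)%R.
  near=> n; apply: (@le_trans _ _ n%:R).
    by near: n; exact: nbhs_infty_ger.
  by rewrite -natrX ler_nat; apply: ltnW; apply: ltn_trans (ltn_expl _ _).
have limV (A : R) : (0 < A)%R -> \forall n \near \oo, (2^-1 ^+ n < A)%R.
  move=> A0; have : (@geometric R 1 2^-1 @ \oo --> (0 : R))%R.
    by apply: cvg_geometric; rewrite ger0_norm ?invr_ge0// invf_lt1// ltr1n.
  move=> /cvgr0_norm_lt/(_ A A0); apply: filterS => n.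
  by rewrite /geometric/= mul1r ger0_norm// exprn_ge0// invr_ge0.
case: y y0 => [y|_|//].
- rewrite lee_fin le_eqVlt => /predU1P[<-|y0].
    apply: cvg_near_cst; near=> n; rewrite ltNge lee_fin exprn_ge0 ?invr_ge0//=.
    by rewrite mul0e powR0// gt_eqF.
  apply: cvg_near_cst; near=> n; rewrite lte_fin (_ : (_ < y)%R) ?mul1e; last first.
    by near: n; exact: limV.
  rewrite E (min_idPl _)// lee_fin; near: n; exact: lim2.
- rewrite poweRyr ?gt_eqF//; apply/cvgeyPge => A.
  near=> n; rewrite ltry mul1e E (_ : mine _ _ = (2 ^+ n.+1)%:E); last first.
    by apply/min_idPr; rewrite leey.
  rewrite poweR_EFin lee_fin.
  have : (Num.max A 1 `^ q^-1 <= 2 ^+ n.+1)%R by near: n; exact: lim2.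
  move=> /(ge0_ler_powR (ltW q0)); rewrite !nnegrE powR_ge0 exprn_ge0// => /(_ isT isT).
  rewrite -powRrM mulVf ?gt_eqF// powRr1; last by rewrite le_max ler01 orbT.
  by apply: le_trans; rewrite le_max lexx.
Unshelve. all: by end_near. Qed.

(** [6] comes from [HL_maximal_truncation], [2^q] from counting level [l] as [(2 l)^q], and the last
    factor from [dyadic_power_sum] with exponent [q - 1] at the point [2 |f|]. *)
Definition HL_strong_cst (q : R) : R :=
  6 * 2 `^ q * (2 `^ (q - 1) / (2 `^ (q - 1) - 1) * 2 `^ (q - 1)).

Lemma HL_strong_cst_ge0 q : (1 < q)%R -> (0 <= HL_strong_cst q)%R.
Proof.
move=> q1; rewrite /HL_strong_cst !mulr_ge0 ?powR_ge0// invr_ge0 subr_ge0.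
by rewrite -[leLHS](powRr0 2) ler_powR ?ler1n// subr_ge0 ltW.
Qed.

(** Weighting the truncated weak-type bounds by [(2 l)^q] leaves the integral of [|f|] times the sum
    of [l^(q-1)] over the levels [l < 2 |f|]; because [q > 1], that sum is at most a multiple of
    [|f|^(q-1)]. *)
Lemma HL_maximal_strong f (q : R) : (1 < q)%R -> measurable_fun setT f ->
  \int[mu]_x (`|f x| `^ q)%:E < +oo ->
  \int[mu]_x (HL_maximal f x `^ q) <=
  (HL_strong_cst q)%:E * \int[mu]_x (`|f x| `^ q)%:E.
Proof.
move=> q1 mf fq.
have q0 : (0 < q)%R by exact: lt_trans q1.
have lf := Lp_locally_integrable (ltW q1) mf fq.
have mHL := measurable_HL_maximal lf.
have HL0 := HL_maximalT_ge0 lf.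
have mnf : measurable_fun setT (fun x => `|f x|%R) by exact: measurableT_comp.
have mbool (g : R -> bool) : measurable_fun setT g ->
    measurable_fun setT (fun x => (g x)%:R : R).
  by move=> mg; apply: (@measurableT_comp _ _ _ _ _ _ (fun b : bool => b%:R : R)).
pose T (n : nat) (y : \bar R) : \bar R := ((2^-1 ^+ n)%:E < y)%E%:R%:E *
    mine y (2 ^+ (n + n).+1 * 2^-1 ^+ n)%:E `^ q.
have mT n : measurable_fun setT (fun x => T n (HL_maximal f x)).
  apply: emeasurable_funM.
    apply/measurable_EFinP; apply: mbool.
    exact: measurable_fun_lte.
  by apply: measurable_poweR_fun; apply: measurable_mine.
(* A bound on the truncations that is uniform in [n], to be passed to the limit by Fatou's lemma. *)
have bound n : \int[mu]_x T n (HL_maximal f x) <=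
    (HL_strong_cst q)%:E * \int[mu]_x (`|f x| `^ q)%:E.
  pose e : R := (2^-1 ^+ n)%R.
  have e0 : (0 < e)%R by rewrite exprn_gt0// invr_gt0.
  pose l (k : nat) : R := (2 ^+ k * e)%R.
  have l0 k : (0 < l k)%R by rewrite mulr_gt0// exprn_gt0.
  have lS k : (2 ^+ k.+1 * e = 2 * l k)%R by rewrite /l exprS mulrA.
  pose c k : R := ((2 * l k) `^ q)%R.
  have c0 k : (0 <= c k)%R by exact: powR_ge0.
  apply: (@le_trans _ _ (\int[mu]_x (\sum_(k < (n + n).+1)
      ((c k)%:E * ((l k)%:E < HL_maximal f x)%E%:R%:E)))).
    apply: le_ge0_integral => x _.
      by rewrite mule_ge0// ?lee_fin// poweR_ge0.
    apply: le_trans (truncated_power_le _ _ q0 e0) _.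
    by rewrite sumEFin lee_fin; apply: ler_sum => k _; rewrite lS.
  rewrite ge0_integral_sum//; last 2 first.
  - move=> k; apply: measurable_funeM; apply/measurable_EFinP; apply: mbool.
    exact: measurable_fun_lte.
  - by move=> k x _; rewrite mule_ge0 ?lee_fin.
  pose h k x : R := (`|f x| * (l k < 2 * `|f x|)%R%:R)%R.
  have mh k : measurable_fun setT (h k).
    apply: measurable_funM => //; apply: mbool.
    by apply: measurable_fun_ltr => //; apply: measurable_funM.
  have mhE k : measurable_fun setT (fun x => (h k x)%:E) by apply/measurable_EFinP.
  have h0 k x : (0 <= h k x)%R by rewrite mulr_ge0.
  apply: (@le_trans _ _ (\sum_(k < (n + n).+1)
      \int[mu]_x (c k * (6 / l k) * h k x)%:E)).
    apply: lee_sum => k _.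
    have mS : measurable [set x | (l k)%:E < HL_maximal f x].
      rewrite -[X in measurable X]setTI; exact: emeasurable_fun_o_infty.
    have -> : \int[mu]_x ((c k)%:E * ((l k)%:E < HL_maximal f x)%E%:R%:E) =
        (c k)%:E * mu [set x | (l k)%:E < HL_maximal f x].
      rewrite -(setIT [set x | _]) -integral_indic// -ge0_integralZl//.
      - apply: eq_integral => x _; congr (_ * _%:R%:E); congr (nat_of_bool _).
        by apply/idP/idP => [|/[!inE]//]; rewrite inE.
      - exact/measurable_EFinP/measurable_indic.
      - by rewrite lee_fin.
    have -> : \int[mu]_x (c k * (6 / l k) * h k x)%:E =
        (c k)%:E * ((6 / l k)%:E * \int[mu]_x (h k x)%:E).
      under eq_integral do rewrite EFinM.
      rewrite ge0_integralZl//; last 3 first.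
      - exact: mhE.
      - by move=> x _; rewrite lee_fin.
      - by rewrite lee_fin mulr_ge0// divr_ge0// ltW.
      by rewrite EFinM muleA.
    by apply: lee_wpmul2l; rewrite ?lee_fin//; exact: HL_maximal_truncation.
  rewrite -ge0_integral_sum//; last 2 first.
  - move=> k; apply: measurable_EFin_fun; apply: measurable_funM; first exact: measurable_cst.
    exact: mh.
  - by move=> k x _; rewrite lee_fin mulr_ge0// mulr_ge0// divr_ge0// ltW.
  rewrite -ge0_integralZl//; last 2 first.
  - apply: measurable_EFin_fun; apply: (measurableT_comp (measurable_powR q)).
    exact: mnf.
  - by rewrite lee_fin HL_strong_cst_ge0.
  apply: le_ge0_integral => x _.
    by apply: sume_ge0 => k _; rewrite lee_fin mulr_ge0// mulr_ge0// divr_ge0// ltW.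
  rewrite sumEFin -EFinM lee_fin.
  have q10 : (0 < q - 1)%R by rewrite subr_gt0.
  have := @dyadic_power_sum R (q - 1) e (2 * `|f x|) (n + n).+1 q10 e0 (mulr_ge0 _ (normr_ge0 _)).
  move=> /(_ (ler0n _ _)) /(ler_wpM2l (_ : (0 <= 6 * 2 `^ q * `|f x|)%R)).
  move=> /(_ (mulr_ge0 (mulr_ge0 (ler0n _ _) (powR_ge0 _ _)) (normr_ge0 _))) le6.
  apply: le_trans (le_trans le6 _); last first.
    rewrite /HL_strong_cst powRM// -(@mulr_powRB1 _ `|f x| q)//.
    rewrite le_eqVlt; apply/orP; left; apply/eqP; ring.
  rewrite mulr_sumr; apply: ler_sum => k _.
  rewrite /h /c powRM ?(ltW (l0 k))// -(@mulr_powRB1 _ (l k) q) ?(ltW (l0 k))//.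
  rewrite /l le_eqVlt; apply/orP; left; apply/eqP; field.
  by rewrite !gt_eqF ?exprn_gt0.
have Tlim x : HL_maximal f x `^ q = limn (fun n => T n (HL_maximal f x)).
  by apply/esym/cvg_lim => //; exact: cvg_truncated_power.
under eq_integral do rewrite Tlim.
have -> : (fun x => limn (fun n => T n (HL_maximal f x))) =
    (fun x => limn_einf (fun n => T n (HL_maximal f x))).
  apply/funext => x; apply/esym/is_cvg_limn_einfE; apply/cvg_ex.
  by eexists; exact: cvg_truncated_power.
apply: le_trans (fatou _ _ _ _) _ => //.
  by move=> n x _; rewrite mule_ge0 ?lee_fin ?poweR_ge0.
rewrite limn_einf_lim; apply: lime_le; first exact: is_cvg_einfs.
by apply: nearW => n; apply: le_trans (bound n); apply: ereal_inf_lbound; exists n => /=.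
Qed.

End maximal_strong_type_theorem.

(** * Hoelder's inequality for nonnegative functions on a set *)

Section hoelder_on_a_set.
Context d (T : measurableType d) (R : realType) (mu : {measure set T -> \bar R}).
Local Open Scope ereal_scope.

Lemma hoelder_ge0 (D : set T) (f g : T -> R) (p q : R) :
  measurable D -> measurable_fun setT f -> measurable_fun setT g ->
  (forall x, 0 <= f x)%R -> (forall x, 0 <= g x)%R ->
  (0 < p)%R -> (0 < q)%R -> (p^-1 + q^-1 = 1)%R ->
  \int[mu]_(x in D) (f x * g x)%:E <=
  (\int[mu]_(x in D) (f x `^ p)%:E) `^ p^-1 *
  (\int[mu]_(x in D) (g x `^ q)%:E) `^ q^-1.
Proof.
move=> mD mf mg f0 g0 p0 q0 pq.
have mr (h : T -> R) : measurable_fun setT h -> measurable_fun setT (h \_ D).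
  by move=> mh; apply/(measurable_restrictT _ _).1 => //; exact: measurable_funTS.
have N (h : T -> R) (s : R) : (0 < s)%R -> (forall x, 0 <= h x)%R ->
    'N[mu]_s%:E[EFin \o (h \_ D)] = (\int[mu]_(x in D) (h x `^ s)%:E) `^ s^-1.
  move=> s0 h0; rewrite unlock; congr (_ `^ _); rewrite [RHS]integral_mkcond.
  apply: eq_integral => x _ /=; rewrite !patchE; case: ifPn => _.
    by rewrite ger0_norm.
  by rewrite normr0 powR0// gt_eqF.
have := hoelder mu (mr _ mf) (mr _ mg) p0 q0 pq.
rewrite (N f p)// (N g q)//; apply: le_trans.
rewrite Lnorm1 integral_mkcond; apply: le_ge0_integral => x _.
  by rewrite patchE; case: ifPn => // _; rewrite lee_fin mulr_ge0.
rewrite /= !patchE; case: ifPn => _; last by rewrite lee_fin.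
by rewrite lee_fin ler_norm.
Qed.

End hoelder_on_a_set.

(** * Lower bounds for the expansion of sine and cosine *)

Section trigonometric_expansion.
Context {R : realType}.

(** If [cos s] were below [1/2], then [cos (2 s) = 2 cos^2 s - 1] would be negative, although [2 s]
    is at most [pi / 2]. *)
Lemma cos_ge_half (s : R) : 0 <= s <= pi / 4 -> 2^-1 <= cos s.
Proof.
move=> /andP[s0 s4]; have pi0 : 0 < pi :> R := pi_gt0 R.
have c0 (y : R) : 0 <= y <= pi / 4 -> 0 <= cos y.
  by move=> /andP[? ?]; apply: cos_ge0_pihalf; apply/andP; split; lra.
rewrite leNgt; apply/negP => cs.
have : cos (s *+ 2) < 0.
  rewrite cos_mulr2n; have := c0 s; rewrite s0 s4 => /(_ isT) ?; nra.
apply/negP; rewrite -leNgt; apply: cos_ge0_pihalf; rewrite (mulr2n s); apply/andP; split; lra.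
Qed.

Lemma sin_mvt (x y : R) : x <= y ->
  exists2 c, x <= c <= y & sin y - sin x = cos c * (y - x).
Proof.
move=> xy; have [c cxy ->] := @MVT_segment R sin cos x y xy
  (fun z _ => is_derive_sin z) (continuous_subspaceT (@continuous_sin R)).
by exists c => //; move: cxy; rewrite in_itv.
Qed.

Lemma cos_mvt (x y : R) : x <= y ->
  exists2 c, x <= c <= y & cos y - cos x = - sin c * (y - x).
Proof.
move=> xy; have [c cxy ->] := @MVT_segment R cos (fun z => - sin z) x y xy
  (fun z _ => is_derive_cos z) (continuous_subspaceT (@continuous_cos R)).
by exists c => //; move: cxy; rewrite in_itv.
Qed.

Lemma sin_le_id (s : R) : 0 <= s -> `|sin s| <= s.
Proof.
move=> s0; have [c _] := sin_mvt s0; rewrite sin0 !subr0 => ->.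
by rewrite normrM (ger0_norm s0) ler_piMl// cos_max.
Qed.

Lemma sin_ge_half (s : R) : 0 <= s <= pi / 4 -> s / 2 <= sin s.
Proof.
move=> /andP[s0 s4]; have [c /andP[c0 cs]] := sin_mvt s0.
rewrite sin0 !subr0 => ->; rewrite mulrC ler_wpM2r//.
by apply: cos_ge_half; rewrite c0 (le_trans cs).
Qed.

Lemma sin_expanding (s s' : R) : 0 <= s <= pi / 4 -> 0 <= s' <= pi / 4 ->
  2^-1 * `|s - s'| <= `|sin s - sin s'|.
Proof.
wlog ss' : s s' / s' <= s.
  move=> H sI s'I; have [h|/ltW] := leP s' s; first exact: H.
  by rewrite distrC (distrC (sin s)) => ?; exact: H.
move=> /andP[s0 s4] /andP[s'0 s'4]; have [c /andP[c0 c1] ->] := sin_mvt ss'.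
rewrite normrM ler_wpM2r//; apply: le_trans (ler_norm _).
by apply: cos_ge_half; apply/andP; split; lra.
Qed.

(** The derivative has size [sin c >= c / 2 >= r / 2]. It degenerates at 0, which is why the factor
    is tied to the distance [r] of the arc from the pole. *)
Lemma cos_expanding (r s s' : R) : 0 <= r -> r <= s <= pi / 4 -> r <= s' <= pi / 4 ->
  r / 2 * `|s - s'| <= `|cos s - cos s'|.
Proof.
move=> r0.
wlog ss' : s s' / s' <= s.
  move=> H sI s'I; have [h|/ltW] := leP s' s; first exact: H.
  by rewrite distrC (distrC (cos s)) => ?; exact: H.
move=> /andP[s0 s4] /andP[s'0 s'4]; have [c /andP[c0 c1] ->] := cos_mvt ss'.
rewrite normrM ler_wpM2r// normrN; apply: le_trans (ler_norm _).
apply: le_trans (sin_ge_half _); first by rewrite ler_wpM2r// (le_trans _ c0).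
by apply/andP; split; lra.
Qed.

End trigonometric_expansion.

(** * The estimate on dyadic arcs and on an arc of length [pi / 4] *)

Section key_estimate.
Context {R : realType}.
Notation mu := (@lebesgue_measure R).
Local Open Scope ereal_scope.

Lemma integral_ball_le_HL (h : R -> R) (x r : R) : (0 < r)%R -> (forall y, 0 <= h y)%R ->
  \int[mu]_(y in ball x r) (h y)%:E <= (2 * r)%:E * HL_maximal h x.
Proof.
move=> r0 h0; rewrite mulr_natl.
have r20 : (0 < r *+ 2)%R by rewrite pmulrn_lgt0.
rewrite -lee_pdivrMl//; apply: ereal_sup_ubound => /=; exists r.
  by rewrite in_itv/= r0.
rewrite /iavg lebesgue_measure_ball ?ltW// inver gt_eqF//; congr (_ * _).
by apply: eq_integral => y _; rewrite /= ger0_norm.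
Qed.

(* On this arc [cos] is expanding with a factor comparable to [s0] while [1 - cos] is at most
   comparable to [s0 ^ 2], so that Hoelder's inequality gains a positive power of [s0] as soon
   as [b < a]; the dyadic arcs then sum up. *)
Lemma shell_estimate (a b : R) (F G : R -> R) (x r t u s0 : R) :
  (0 < a)%R -> (0 < b)%R -> (a^-1 + b^-1 = 1)%R ->
  measurable_fun setT F -> measurable_fun setT G ->
  (forall y, 0 <= F y)%R -> (forall y, 0 <= G y)%R ->
  (0 < r)%R -> `|t|%R = r -> `|u|%R = r -> (0 < s0)%R -> (2 * s0 <= pi / 4)%R ->
  \int[mu]_(s in `]s0, (2 * s0)%R]) (F (x + t * cos s) * G (x + u * sin s))%:E <=
  (16 * s0 `^ (b^-1 - a^-1))%:E *
  (HL_maximal (fun y => F y `^ a)%R x `^ a^-1 *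
   HL_maximal (fun y => G y `^ b)%R x `^ b^-1).
Proof.
move=> a0 b0 ab mF mG F0 G0 r0 tr ur s00 s04.
set D := `]s0, (2 * s0)%R]%classic.
have mD : measurable D by exact: measurable_itv.
have DE s : D s -> (s0 < s /\ s <= 2 * s0)%R.
  by rewrite /D/= in_itv/= => /andP[].
have mcos : measurable_fun setT (fun s : R => x + t * cos s)%R.
  apply: measurable_funD; first exact: measurable_cst.
  apply: measurable_funM; first exact: measurable_cst.
  by apply: continuous_measurable_fun; exact: continuous_cos.
have msin : measurable_fun setT (fun s : R => x + u * sin s)%R.
  apply: measurable_funD; first exact: measurable_cst.
  apply: measurable_funM; first exact: measurable_cst.
  by apply: continuous_measurable_fun; exact: continuous_sin.
have mpow (h : R -> R) (p : R) : measurable_fun setT h ->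
    measurable_fun setT (fun y => (h y `^ p)%:E).
  move=> mh; apply: measurable_EFin_fun; apply: (measurableT_comp (measurable_powR p)).
  exact: mh.
have HL0 (h : R -> R) (p : R) : 0 <= HL_maximal (fun y => h y `^ p)%R x.
  apply: le_trans (ereal_sup_ubound _); last first.
    by exists 1%R; [rewrite /= in_itv/= ltr01|reflexivity].
  exact: iavg_ge0.
set A := HL_maximal (fun y => F y `^ a)%R x.
set B := HL_maximal (fun y => G y `^ b)%R x.
have A0 : 0 <= A := HL0 F a.
have B0 : 0 <= B := HL0 G b.
have ballA c : (0 < c)%R -> \int[mu]_(y in ball x c) (F y `^ a)%:E <= (2 * c)%:E * A.
  by move=> c0; apply: integral_ball_le_HL => // y; rewrite powR_ge0.
have ballB c : (0 < c)%R -> \int[mu]_(y in ball x c) (G y `^ b)%:E <= (2 * c)%:E * B.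
  by move=> c0; apply: integral_ball_le_HL => // y; rewrite powR_ge0.
clearbody A B.
(* The image lies in the ball of radius [2 * r] about [x]; its length [4 * r] divided by the
   expansion factor [r * (s0 / 2)] is [8 / s0]. *)
have IF : \int[mu]_(s in D) (F (x + t * cos s) `^ a)%:E <= (8 / s0)%:E * A.
  have rs : (0 < r * (s0 / 2))%R by rewrite !mulr_gt0// invr_gt0.
  have := @le_integral_expanding R D (ball x (2 * r)) (fun s => x + t * cos s)%R
    (r * (s0 / 2)) (fun y => (F y `^ a)%:E) rs mD (measurable_ball _ _) mcos.
  move=> /(_ _ _ (mpow _ _ mF)) H; apply: le_trans (H _ _ _) _ => {H}.
  - move=> s s' /DE[s1 s2] /DE[s1' s2'].
    have -> : (x + t * cos s - (x + t * cos s') = t * (cos s - cos s'))%R by ring.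
    rewrite normrM tr -mulrA.
    rewrite ler_wpM2l ?(ltW r0)//; apply: cos_expanding; first exact: ltW.
      by apply/andP; split; lra.
    by apply/andP; split; lra.
  - move=> s _; rewrite /ball/= opprD addNKr normrN normrM tr.
    by have := cos_max s; nra.
  - by move=> y; rewrite lee_fin powR_ge0.
  apply: (@le_trans _ _ ((r * (s0 / 2))^-1%:E * ((2 * (2 * r))%:E * A))).
    apply: lee_wpmul2l; first by rewrite lee_fin invr_ge0 ltW.
    by apply: ballA; rewrite mulr_gt0.
  have -> : (8 / s0 = (r * (s0 / 2))^-1 * (2 * (2 * r)))%R by field; rewrite !gt_eqF.
  by rewrite EFinM muleA.
(* Here [|sin s| <= 2 * s0] keeps the image in a ball of radius [4 * s0 * r], and the expansion
   factor [r / 2] does not degenerate: [8 * s0 * r] divided by it is [16 * s0]. *)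
have IG : \int[mu]_(s in D) (G (x + u * sin s) `^ b)%:E <= (16 * s0)%:E * B.
  have rs : (0 < r * 2^-1)%R by rewrite !mulr_gt0// invr_gt0.
  have := @le_integral_expanding R D (ball x (4 * s0 * r)) (fun s => x + u * sin s)%R
    (r * 2^-1) (fun y => (G y `^ b)%:E) rs mD (measurable_ball _ _) msin.
  move=> /(_ _ _ (mpow _ _ mG)) H; apply: le_trans (H _ _ _) _ => {H}.
  - move=> s s' /DE[s1 s2] /DE[s1' s2'].
    have -> : (x + u * sin s - (x + u * sin s') = u * (sin s - sin s'))%R by ring.
    rewrite normrM ur -mulrA.
    rewrite ler_wpM2l ?(ltW r0)//; apply: sin_expanding.
      by apply/andP; split; lra.
    by apply/andP; split; lra.
  - move=> s /DE[s1 s2]; rewrite /ball/= opprD addNKr normrN normrM ur.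
    have s_0 : (0 <= s)%R by lra.
    by have := sin_le_id s_0; nra.
  - by move=> y; rewrite lee_fin powR_ge0.
  apply: (@le_trans _ _ ((r * 2^-1)^-1%:E * ((2 * (4 * s0 * r))%:E * B))).
    apply: lee_wpmul2l; first by rewrite lee_fin invr_ge0 ltW.
    by apply: ballB; rewrite !mulr_gt0.
  have -> : (16 * s0 = (r * 2^-1)^-1 * (2 * (4 * s0 * r)))%R by field; rewrite gt_eqF.
  by rewrite EFinM muleA.
have mFc : measurable_fun setT (fun s => F (x + t * cos s)%R).
  exact: (measurableT_comp mF mcos).
have mGs : measurable_fun setT (fun s => G (x + u * sin s)%R).
  exact: (measurableT_comp mG msin).
have H := hoelder_ge0 mu mD mFc mGs (fun s => F0 _) (fun s => G0 _) a0 b0 ab.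
apply: le_trans H _.
apply: (@le_trans _ _ (((8 / s0)%:E * A) `^ a^-1 * ((16 * s0)%:E * B) `^ b^-1)).
  apply: lee_pmul; rewrite ?poweR_ge0//; apply: le_poweR => //.
  - by rewrite invr_ge0 ltW.
  - by apply: integral_ge0 => s _; rewrite lee_fin powR_ge0.
  - by rewrite invr_ge0 ltW.
  - by apply: integral_ge0 => s _; rewrite lee_fin powR_ge0.
rewrite !poweRM ?lee_fin ?divr_ge0 ?mulr_ge0 ?(ltW s00)//.
rewrite muleACA lee_wpmul2r ?mule_ge0 ?poweR_ge0//.
rewrite !poweR_EFin -EFinM lee_fin.
have sV0 : (0 <= s0^-1)%R by rewrite invr_ge0 ltW.
rewrite (powRM _ (ler0n _ 8) sV0) (powRM _ (ler0n _ 16) (ltW s00)) mulrACA.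
have -> : (s0^-1 `^ a^-1 * s0 `^ b^-1 = s0 `^ (b^-1 - a^-1))%R.
  rewrite -powR_inv1 ?(ltW s00)// -powRrM mulN1r -powRD ?(gt_eqF s00) ?implybT//.
  by rewrite addrC.
rewrite ler_wpM2r ?powR_ge0//.
(* Raising [8] to [16] merges the two constants into [16^(1/a + 1/b) = 16]. *)
apply: (@le_trans _ _ (16 `^ a^-1 * 16 `^ b^-1)%R).
  rewrite ler_wpM2r ?powR_ge0// ge0_ler_powR ?nnegrE ?invr_ge0 ?(ltW a0)//.
  by rewrite ler_nat.
by rewrite -powRD ?ab ?powRr1// oner_eq0.
Qed.

(** The arcs [(s k, 2 * s k]] tile [(0, pi / 4]]. As [a > 2] forces [b < 2], the exponent [d] is
    positive and the bounds of [shell_estimate] are dominated by a geometric series of ratio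
    [rho = 2^-d]. *)
Lemma quarter_arc_estimate (a b : R) : (2 < a)%R -> (a^-1 + b^-1 = 1)%R ->
  exists2 K : R, (0 <= K)%R & forall (F G : R -> R) (x r t u : R),
  measurable_fun setT F -> measurable_fun setT G ->
  (forall y, 0 <= F y)%R -> (forall y, 0 <= G y)%R ->
  (0 < r)%R -> `|t|%R = r -> `|u|%R = r ->
  \int[mu]_(s in `]0%R, (pi / 4)%R]) (F (x + t * cos s) * G (x + u * sin s))%:E <=
  K%:E * (HL_maximal (fun y => F y `^ a)%R x `^ a^-1 *
          HL_maximal (fun y => G y `^ b)%R x `^ b^-1).
Proof.
move=> a2 ab.
have a0 : (0 < a)%R by lra.
have ai2 : (a^-1 < 2^-1)%R by rewrite ltf_pV2 ?posrE.
have b0 : (0 < b)%R by rewrite -invr_gt0; lra.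
pose d := (b^-1 - a^-1)%R.
have d0 : (0 < d)%R by rewrite /d; lra.
pose rho : R := (2^-1 `^ d)%R.
have rho0 : (0 < rho)%R by rewrite powR_gt0// invr_gt0.
have rho1 : (rho < 1)%R.
  have : (2^-1 `^ d < 1 `^ d :> R)%R.
    by apply: gt0_ltr_powR => //; rewrite ?nnegrE ?invr_ge0// invf_lt1// ltr1n.
  by rewrite powR1.
exists (16 / (1 - rho))%R; first by rewrite divr_ge0// subr_ge0 ltW.
move=> F G x r t u mF mG F0 G0 r0 tr ur.
pose c : R := (pi / 4)%R.
have c0 : (0 < c)%R by rewrite divr_gt0// pi_gt0.
have c1 : (c < 1)%R by have := pihalf_lt2 R; rewrite /c; lra.
pose s (k : nat) : R := (c * 2^-1 ^+ k.+1)%R.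
have s0 k : (0 < s k)%R by rewrite mulr_gt0// exprn_gt0// invr_gt0.
have sS k : (2 * s k.+1 = s k)%R.
  by rewrite /s [(2^-1 ^+ k.+2)%R]exprS; set y := (2^-1 ^+ k.+1)%R; field.
have s00 : (2 * s 0%N = c)%R by rewrite /s expr1 mulrCA divff// mulr1.
have sle : {homo s : i j / (i <= j)%N >-> (j <= i)%O}.
  move=> i j ij; apply: ler_wpM2l; first exact: ltW.
  by apply: ler_wiXn2l; rewrite ?invr_ge0// ?invf_le1// ler1n.
have s2c k : (2 * s k <= c)%R by rewrite -s00 ler_pM2l// sle.
pose D k := `]s k, (2 * s k)%R]%classic.
have DE : `]0%R, c]%classic = \bigcup_k D k.
  apply/seteqP; split => [y /=|y [k _]]; rewrite /D/= !in_itv/=; last first.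
    by move=> /andP[y1 y2]; rewrite (lt_trans (s0 k) y1) (le_trans y2).
  move=> /andP[y0 yc].
  have exk : exists k, (s k < y)%R.
    have : (@geometric R c 2^-1 @ \oo --> (0 : R))%R.
      by apply: cvg_geometric; rewrite ger0_norm ?invr_ge0// invf_lt1// ltr1n.
    move=> /cvgr0_norm_lt/(_ y y0)[N _ NP]; exists N.
    apply: le_lt_trans (NP N.+1 (leqnSn N)).
    exact: ler_norm.
  (* The first arc whose left end is below [y]: minimality gives [y <= s k.-1 = 2 * s k] when [k] is
     positive, and [y <= c = 2 * s 0] settles [k = 0]. *)
  have [k ky kmin] := ex_minnP exk; exists k => //=.
  rewrite in_itv/= ky/=; case: k ky kmin => [|k] ky kmin; first by rewrite s00.
  by rewrite sS leNgt; apply/negP => /kmin; rewrite ltnn.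
have tD : trivIset setT D.
  apply/trivIsetP => i j _ _.
  wlog ij : i j / (i < j)%N.
    move=> H; rewrite neq_ltn => /orP[ij|ij]; first by apply: H; rewrite ?neq_ltn ?ij.
    by rewrite setIC; apply: H; rewrite ?neq_ltn ?ij.
  move=> _; apply/seteqP; split => // y []; rewrite /D/= !in_itv/=.
  move=> /andP[y1 _] /andP[_ y2]; have := lt_le_trans y1 y2.
  apply/negP; rewrite -leNgt; case: j {y2} ij => // j ij.
  by rewrite sS sle.
set M := (X in _ <= _ * X).
have M0 : 0 <= M by rewrite mule_ge0// poweR_ge0.
have shell k := shell_estimate x a0 b0 ab mF mG F0 G0 r0 tr ur (s0 k) (s2c k).
rewrite DE ge0_integral_bigcup//; last 3 first.
- by move=> k; exact: measurable_itv.
- apply: measurable_funTS; apply: measurable_EFin_fun; apply: measurable_funM.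
    apply: (measurableT_comp mF); apply: measurable_funD => //.
    apply: measurable_funM => //.
    by apply: continuous_measurable_fun; exact: continuous_cos.
  apply: (measurableT_comp mG); apply: measurable_funD => //.
  apply: measurable_funM => //.
  by apply: continuous_measurable_fun; exact: continuous_sin.
- by move=> y _; rewrite lee_fin mulr_ge0.
have powle k : (s k `^ d <= rho ^+ k)%R.
  apply: (@le_trans _ _ ((2^-1 ^+ k) `^ d)%R).
    apply: ge0_ler_powR; rewrite ?nnegrE ?exprn_ge0 ?invr_ge0 ?(ltW d0) ?(ltW (s0 k))//.
    rewrite /s exprS mulrA ler_piMl ?exprn_ge0 ?invr_ge0//; lra.
  rewrite /rho -[(2^-1 ^+ k)%R]powR_mulrn ?invr_ge0// -[leRHS]powR_mulrn ?powR_ge0//.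
  by rewrite -!powRrM mulrC.
apply: (@le_trans _ _ (\sum_(k <oo) (16 * rho ^+ k)%:E * M)).
  apply: lee_nneseries => [k _ _|k _].
    by apply: integral_ge0 => y _; rewrite lee_fin mulr_ge0.
  apply: le_trans (shell k) _; rewrite -/M lee_wpmul2r// lee_fin ler_pM2l//.
apply: lime_le.
  by apply: is_cvg_nneseries => k _ _; rewrite mule_ge0// lee_fin mulr_ge0// exprn_ge0// ltW.
apply: nearW => n; rewrite -ge0_sume_distrl; last first.
  by move=> k _; rewrite lee_fin mulr_ge0// exprn_ge0// ltW.
rewrite lee_wpmul2r// sumEFin lee_fin.
have := @geometric_le_lim R n 16 rho (ler0n _ _) rho0.
by rewrite ger0_norm ?(ltW rho0)//; apply.
Qed.

End key_estimate.

(** * From one arc to the whole circle *)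

Section circle_estimate.
Context {R : realType}.
Notation mu := (@lebesgue_measure R).
Local Open Scope ereal_scope.

Lemma ge0_integral_setU_le d (T : measurableType d) (m : {measure set T -> \bar R})
    (D A B : set T) (h : T -> \bar R) :
  measurable D -> measurable A -> measurable B -> D `<=` A `|` B ->
  measurable_fun setT h -> (forall x, 0 <= h x) ->
  \int[m]_(x in D) h x <= \int[m]_(x in A) h x + \int[m]_(x in B) h x.
Proof.
move=> mD mA mB DAB mh h0.
have mBA : measurable (B `\` A) by exact: measurableD.
apply: (@le_trans _ _ (\int[m]_(x in A `|` (B `\` A)) h x)).
  apply: ge0_subset_integral => //; first exact: measurableU.
    exact: measurable_funTS.
  by rewrite setUDr setDv setD0.
rewrite ge0_integral_setU//; last 2 first.
- exact: measurable_funTS.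
- by apply/disj_set2P; rewrite setDE setICA setICr setI0.
by apply: leeD2l; apply: ge0_subset_integral => //; exact: measurable_funTS.
Qed.

(** The maximal operator of [L^s] means, [M(F^s)^(1/s)]; it is bounded on [L^p] for [p > s], see
    [maxop_bound]. *)
Definition maxop (s : R) (F : R -> R) (x : R) : \bar R :=
  HL_maximal (fun y => F y `^ s)%R x `^ s^-1.

Lemma maxop_ge0 s F x : 0 <= maxop s F x.
Proof. exact: poweR_ge0. Qed.

(** Eight arcs of length [pi / 4], each with one end at a multiple of [pi / 2], cover the circle.
    Next to a zero of [sin] the exponent [a] falls on [F], next to a zero of [cos] it falls on [G];
    hence the two summands and the factor 8. *)
Lemma circle_estimate (a b : R) : (2 < a)%R -> (a^-1 + b^-1 = 1)%R ->
  exists2 K : R, (0 <= K)%R & forall (F G : R -> R) (x t : R),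
  measurable_fun setT F -> measurable_fun setT G ->
  (forall y, 0 <= F y)%R -> (forall y, 0 <= G y)%R -> (0 < t)%R ->
  \int[mu]_(s in `[0%R, (2 * pi)%R]) (F (x - t * cos s) * G (x - t * sin s))%:E <=
  K%:E * (maxop a F x * maxop b G x + maxop b F x * maxop a G x).
Proof.
move=> a2 ab; have [K K0 quarter] := quarter_arc_estimate a2 ab.
exists (8 * K)%R; first by rewrite mulr_ge0.
move=> F G x t mF mG F0 G0 t0.
have A10 : 0 <= maxop a F x * maxop b G x by rewrite mule_ge0// maxop_ge0.
have A20 : 0 <= maxop b F x * maxop a G x by rewrite mule_ge0// maxop_ge0.
set M := _ + _.
have M0 : 0 <= M by rewrite adde_ge0.
pose h s : R := (F (x - t * cos s) * G (x - t * sin s))%R.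
have h0 s : 0 <= (h s)%:E by rewrite lee_fin mulr_ge0.
have mh : measurable_fun setT (fun s => (h s)%:E).
  apply: measurable_EFin_fun; apply: measurable_funM.
    apply: (measurableT_comp mF); apply: measurable_funB => //.
    apply: measurable_funM => //.
    by apply: continuous_measurable_fun; exact: continuous_cos.
  apply: (measurableT_comp mG); apply: measurable_funB => //.
  apply: measurable_funM => //.
  by apply: continuous_measurable_fun; exact: continuous_sin.
pose axis (c : R) : Prop := (`|cos c| = 1 /\ sin c = 0)%R \/ (cos c = 0 /\ `|sin c| = 1)%R.
pose c (n : nat) : R := (n%:R * (pi / 2))%R.
have cS n : (c n.+1 = c n + pi / 2)%R by rewrite /c -natr1 mulrDl mul1r.
have axisc n : axis (c n).
  elim: n => [|n IH]; first by left; rewrite /c mul0r cos0 sin0 normr1.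
  rewrite cS /axis cosDpihalf sinDpihalf normrN.
  by case: IH => -[-> ->]; [right|left]; rewrite ?oppr0.
have closed_quarter (F' G' : R -> R) (t' u' : R) :
    measurable_fun setT F' -> measurable_fun setT G' ->
    (forall y, 0 <= F' y)%R -> (forall y, 0 <= G' y)%R ->
    `|t'|%R = t -> `|u'|%R = t ->
    \int[mu]_(s in `[0%R, (pi / 4)%R]) (F' (x + t' * cos s) * G' (x + u' * sin s))%:E <=
    K%:E * (maxop a F' x * maxop b G' x).
  move=> mF' mG' F'0 G'0 tt uu.
  rewrite -integral_itv_obnd_cbnd.
    exact: (quarter F' G' x t t' u' mF' mG' F'0 G'0 t0 tt uu).
  apply: measurable_funTS; apply: measurable_EFin_fun; apply: measurable_funM.
    apply: (measurableT_comp mF'); apply: measurable_funD => //.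
    apply: measurable_funM => //.
    by apply: continuous_measurable_fun; exact: continuous_cos.
  apply: (measurableT_comp mG'); apply: measurable_funD => //.
  apply: measurable_funM => //.
  by apply: continuous_measurable_fun; exact: continuous_sin.
have arc (e sg : R) : axis e -> sg = 1%R \/ sg = (-1)%R ->
    \int[mu]_(s in `[0%R, (pi / 4)%R]) (h (e + sg * s))%:E <= K%:E * M.
  move=> axe sgE.
  have cs s : cos (sg * s) = cos s by case: sgE => ->; rewrite ?mul1r// mulN1r cosN.
  have sn s : (sin (sg * s) = sg * sin s)%R.
    by case: sgE => ->; rewrite ?mul1r// !mulN1r sinN.
  have nsg : `|sg|%R = 1%R by case: sgE => ->; rewrite ?normrN normr1.
  (* Next to a zero of [sin] the two coordinates are [cos s] and [sin s] up to sign; next to a zero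
     of [cos] they trade places, and the arc estimate is applied with [F] and [G] exchanged. *)
  case: axe => -[ce se].
    apply: (@le_trans _ _ (K%:E * (maxop a F x * maxop b G x))); last first.
      by rewrite lee_wpmul2l ?lee_fin// leeDl.
    apply: le_trans (closed_quarter F G (- (t * cos e))%R (- (t * (sg * cos e)))%R
      mF mG F0 G0 _ _).
    - apply: le_ge0_integral => s _; rewrite ?h0// /h cosD sinD cs sn se !mul0r subr0 add0r.
      rewrite lee_fin le_eqVlt; apply/orP; left; apply/eqP.
      by congr (F _ * G _)%R; ring.
    - by rewrite normrN normrM ce mulr1 gtr0_norm.
    - by rewrite normrN !normrM ce nsg !mulr1 gtr0_norm.
  apply: (@le_trans _ _ (K%:E * (maxop a G x * maxop b F x))); last first.
    by rewrite lee_wpmul2l ?lee_fin// (muleC (maxop a G x)) leeDr.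
  apply: le_trans (closed_quarter G F (- (t * sin e))%R (t * (sg * sin e))%R
    mG mF G0 F0 _ _).
  - apply: le_ge0_integral => s _; rewrite ?h0// /h cosD sinD cs sn ce !mul0r sub0r addr0.
    rewrite lee_fin le_eqVlt; apply/orP; left; apply/eqP.
    by rewrite mulrC; congr (G _ * F _)%R; ring.
  - by rewrite normrN normrM se mulr1 gtr0_norm.
  - by rewrite !normrM se nsg !mulr1 gtr0_norm.
(* An arc on either side of [e] is carried into [[0, pi / 4]] by the isometry [s -> sg * (s - e)],
   whose expansion factor is 1. *)
have moved (e sg : R) (D : set R) : axis e -> sg = 1%R \/ sg = (-1)%R -> measurable D ->
    (forall s, D s -> 0 <= sg * (s - e) <= pi / 4)%R ->
    \int[mu]_(s in D) (h s)%:E <= K%:E * M.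
  move=> axe sgE mD DE.
  have sg2 : (sg * sg = 1)%R by case: sgE => ->; rewrite ?mulrNN mulr1.
  have nsg : `|sg|%R = 1%R by case: sgE => ->; rewrite ?normrN normr1.
  have hE s : h s = h (e + sg * (sg * (s - e)))%R by rewrite mulrA sg2 mul1r subrKC.
  under eq_integral do rewrite hE.
  apply: le_trans (arc _ _ axe sgE).
  have mphi : measurable_fun setT (fun s : R => sg * (s - e))%R.
    by apply: measurable_funM => //; exact: measurable_funB.
  have mH : measurable_fun setT (fun s => (h (e + sg * s))%:E).
    apply: (measurableT_comp mh); apply: measurable_funD => //.
  have := @le_integral_expanding R D `[0%R, (pi / 4)%R]%classic
    (fun s => sg * (s - e))%R 1 (fun s => (h (e + sg * s))%:E) ltr01 mD
    (measurable_itv _) mphi.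
  rewrite invr1 mul1e; apply => //.
  move=> s s' _ _; rewrite mul1r -mulrBr normrM nsg mul1r.
  by rewrite opprB addrA subrK.
have pi0 : (0 < pi :> R)%R := pi_gt0 R.
have J n : \int[mu]_(s in `]0%R, c n]) (h s)%:E <= (n%:R * 2)%:E * (K%:E * M).
  elim: n => [|n IH].
    by rewrite /c mul0r set_itvoc0 integral_set0 mule_ge0// mule_ge0.
  apply: le_trans (@ge0_integral_setU_le _ _ mu _ `]0%R, c n]%classic
     `]c n, c n.+1]%classic _ _ _ _ _ mh h0) _ => //.
    move=> s /=; rewrite !in_itv/= => /andP[s0 sc].
    by have [|] := leP s (c n); [left|right]; rewrite ?s0.
  rewrite -natr1 mulrDl mul1r EFinD ge0_muleDl ?lee_fin//.
  apply: leeD => //.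
  (* The quarter turn is halved: its first half is measured forwards from the axis [c n], its second
     half backwards from [c n.+1]. *)
  apply: le_trans (@ge0_integral_setU_le _ _ mu _ `]c n, (c n + pi / 4)%R]%classic
     `](c n + pi / 4)%R, c n.+1]%classic _ _ _ _ _ mh h0) _ => //.
    move=> s /=; rewrite !in_itv/= => /andP[s0 sc].
    by have [|] := leP s (c n + pi / 4)%R; [left|right]; rewrite ?s0.
  rewrite [X in _ <= X * _](_ : _ = 1 + 1); last by rewrite -EFinD.
  rewrite ge0_muleDl ?mul1e//; apply: leeD.
    apply: (moved (c n) 1%R) => //; first by left.
    by move=> s /=; rewrite in_itv/= => /andP[? ?]; apply/andP; split; lra.
  apply: (moved (c n.+1) (-1)%R) => //; first by right.
  by move=> s /=; rewrite in_itv/= cS => /andP[? ?]; apply/andP; split; lra.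
rewrite -integral_itv_obnd_cbnd; last exact: measurable_funTS.
have -> : (2 * pi = c 4%N)%R by rewrite /c; lra.
apply: le_trans (J 4%N) _; rewrite muleA -EFinM.
by have -> : (4 * 2 * K = 8 * K)%R by ring.
Qed.

End circle_estimate.

(** * Averages of complex-valued functions over the circle *)

Section complex_circle_averages.
Context {R : realType}.
Notation mu := (@lebesgue_measure R).
Notation Re := (@complex.Re R).
Notation Im := (@complex.Im R).
Notation normc := (@Normc.normc R).
Local Open Scope ereal_scope.

Definition cmeasurable d (T : measurableType d) (f : T -> R[i]) : Prop :=
  measurable_fun setT (Re \o f) /\ measurable_fun setT (Im \o f).

Lemma normc_ge0 z : (0 <= normc z)%R.
Proof. by case: z => a b /=; exact: sqrtr_ge0. Qed.

Lemma normcE z : normc z = Num.sqrt (Re z ^+ 2 + Im z ^+ 2)%R.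
Proof. by case: z. Qed.

Lemma Re_le_normc z : (`|Re z| <= normc z)%R.
Proof. by rewrite normcE -sqrtr_sqr ler_wsqrtr// lerDl sqr_ge0. Qed.

Lemma Im_le_normc z : (`|Im z| <= normc z)%R.
Proof. by rewrite normcE -sqrtr_sqr ler_wsqrtr// lerDr sqr_ge0. Qed.

Lemma normc_le_ReIm z : (normc z <= `|Re z| + `|Im z|)%R.
Proof.
rewrite normcE -[leRHS]ger0_norm ?addr_ge0// -sqrtr_sqr ler_wsqrtr//.
rewrite sqrrD !real_normK ?num_real//.
by rewrite lerD2r lerDl mulrn_wge0// mulr_ge0.
Qed.

Lemma cmeasurableM d (T : measurableType d) (f g : T -> R[i]) :
  cmeasurable f -> cmeasurable g -> cmeasurable (fun x => f x * g x)%R.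
Proof.
move=> [f1 f2] [g1 g2].
have E x : (f x * g x = Complex (Re (f x) * Re (g x) - Im (f x) * Im (g x))
   (Re (f x) * Im (g x) + Im (f x) * Re (g x)))%R.
  by case: (f x) => ? ?; case: (g x).
split.
- rewrite (_ : _ \o _ = fun x => (Re (f x) * Re (g x) - Im (f x) * Im (g x))%R).
    by apply: measurable_funB; apply: measurable_funM.
  by apply/funext => x /=; rewrite E.
- rewrite (_ : _ \o _ = fun x => (Re (f x) * Im (g x) + Im (f x) * Re (g x))%R).
    by apply: measurable_funD; apply: measurable_funM.
  by apply/funext => x /=; rewrite E.
Qed.

Lemma cmeasurableB d (T : measurableType d) (f g : T -> R[i]) :
  cmeasurable f -> cmeasurable g -> cmeasurable (fun x => f x - g x)%R.
Proof.
move=> [f1 f2] [g1 g2]; split.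
- rewrite (_ : _ \o _ = fun x => (Re (f x) - Re (g x))%R).
    exact: measurable_funB.
  by apply/funext => x /=; case: (f x) => ? ?; case: (g x).
- rewrite (_ : _ \o _ = fun x => (Im (f x) - Im (g x))%R).
    exact: measurable_funB.
  by apply/funext => x /=; case: (f x) => ? ?; case: (g x).
Qed.

Lemma cmeasurable_comp d1 d2 (T1 : measurableType d1) (T2 : measurableType d2)
    (f : T2 -> R[i]) (phi : T1 -> T2) :
  cmeasurable f -> measurable_fun setT phi -> cmeasurable (f \o phi).
Proof. by move=> [f1 f2] mphi; split; [exact: (measurableT_comp f1)|exact: (measurableT_comp f2)]. Qed.

Lemma measurable_normc d (T : measurableType d) (f : T -> R[i]) :
  cmeasurable f -> measurable_fun setT (fun x => normc (f x)).
Proof.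
move=> [f1 f2].
rewrite (_ : (fun x => normc (f x)) = @Num.sqrt R \o (fun x => Re (f x) ^+ 2 + Im (f x) ^+ 2)%R).
  apply: measurableT_comp.
    by apply: continuous_measurable_fun; exact: sqrt_continuous.
  by apply: measurable_funD; exact: measurable_funX.
by apply/funext => x /=; rewrite normcE.
Qed.

Lemma measurable_unit_circle : measurable (@unit_circle R).
Proof.
have -> : @unit_circle R = (fun y => y.1 ^+ 2 + y.2 ^+ 2)%R @^-1` [set 1%R] by [].
rewrite -[X in measurable X]setTI.
have m : measurable_fun setT (fun y : R * R => y.1 ^+ 2 + y.2 ^+ 2)%R.
  apply: measurable_funD; apply: measurable_funX.
    exact: measurable_fst.
  exact: measurable_snd.
by apply: m => //; exact: measurable_set1.
Qed.

Lemma ge0_integral_arclength (H : R * R -> \bar R) :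
  measurable_fun setT H -> (forall y, 0 <= H y) ->
  \int[@arclength R]_(y in @unit_circle R) H y =
  ((2 * pi)^-1)%:E * \int[mu]_(s in `[0%R, (2 * pi)%R]) H (cos s, sin s).
Proof.
move=> mH H0.
have mU := measurable_unit_circle.
rewrite /arclength /distribution ge0_integral_pushforward//; last exact: measurable_funTS.
have -> : circle_map @^-1` @unit_circle R = setT.
  by apply/seteqP; split => // s _; rewrite /unit_circle/circle_map/= cos2Dsin2.
rewrite integral_uniform ?subr0//; first exact: (measurableT_comp mH measurable_circle_map).
by move=> s; exact: H0.
Qed.

(** The absolute values stand inside the integral, so that the bound also yields the integrability
    needed to split averages of differences. *)
Lemma circle_avg_le (a b : R) : (2 < a)%R -> (a^-1 + b^-1 = 1)%R ->
  exists2 K : R, (0 <= K)%R & forall (f g : R -> R[i]) (t x : R),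
  cmeasurable f -> cmeasurable g -> (0 < t)%R ->
  \int[@arclength R]_(y in @unit_circle R)
     (normc (f (x - t * y.1)) * normc (g (x - t * y.2)))%:E <=
  K%:E * (maxop a (normc \o f) x * maxop b (normc \o g) x +
          maxop b (normc \o f) x * maxop a (normc \o g) x).
Proof.
move=> a2 ab; have [K K0 H] := circle_estimate a2 ab.
have pi20 : (0 <= (2 * pi)^-1 :> R)%R by rewrite invr_ge0 mulr_ge0// pi_ge0.
exists ((2 * pi)^-1 * K)%R; first by rewrite mulr_ge0.
move=> f g t x mf mg t0.
rewrite ge0_integral_arclength; last 2 first.
- apply: measurable_EFin_fun; apply: measurable_funM.
    apply: (measurableT_comp (measurable_normc mf)); apply: measurable_funB => //.
    by apply: measurable_funM => //; exact: measurable_fst.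
  apply: (measurableT_comp (measurable_normc mg)); apply: measurable_funB => //.
  by apply: measurable_funM => //; exact: measurable_snd.
- by move=> y; rewrite lee_fin mulr_ge0// normc_ge0.
rewrite EFinM -muleA; apply: lee_wpmul2l; first by rewrite lee_fin.
apply: (H (normc \o f) (normc \o g)) => //; try by move=> ?; exact: normc_ge0.
  exact: measurable_normc.
exact: measurable_normc.
Qed.

Lemma cmeasurable_circle_integrand (f g : R -> R[i]) (t x : R) :
  cmeasurable f -> cmeasurable g ->
  cmeasurable (fun y : R * R => f (x - t * y.1) * g (x - t * y.2))%R.
Proof.
move=> mf mg; apply: cmeasurableM.
  apply: (@cmeasurable_comp _ _ _ _ f (fun y : R * R => x - t * y.1)%R) => //.
  apply: measurable_funB => //.
  by apply: measurable_funM => //; exact: measurable_fst.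
apply: (@cmeasurable_comp _ _ _ _ g (fun y : R * R => x - t * y.2)%R) => //.
apply: measurable_funB => //.
by apply: measurable_funM => //; exact: measurable_snd.
Qed.

(** The factor 2 is the price of treating real and imaginary parts separately. Should the integral
    of a part be infinite, [fine] returns 0 and the bound persists. *)
Lemma normc_Cintegral_le d (T : measurableType d) (nu : {measure set T -> \bar R})
    (D : set T) (h : T -> R[i]) : measurable D -> cmeasurable h ->
  (normc (Cintegral nu D h))%:E <= 2%:E * \int[nu]_(y in D) (normc (h y))%:E.
Proof.
move=> mD [h1 h2].
have part (k : T -> R) : measurable_fun setT k -> (forall y, `|k y| <= normc (h y))%R ->
    (`|\int[nu]_(y in D) k y|%R)%:E <= \int[nu]_(y in D) (normc (h y))%:E.
  move=> mk kh; rewrite /Rintegral.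
  have fle (z : \bar R) : (`|fine z|%R)%:E <= `|z|.
    by case: z => [z| |]//=; rewrite normr0 leey.
  apply: le_trans (fle _) _; apply: le_trans (le_abse_integral _ _ _) _ => //.
    by apply: measurable_funTS; exact: measurable_EFin_fun.
  by apply: le_ge0_integral => // y _; rewrite lee_fin.
apply: (@le_trans _ _ ((`|\int[nu]_(y in D) Re (h y)|%R)%:E + (`|\int[nu]_(y in D) Im (h y)|%R)%:E)).
  by rewrite -EFinD lee_fin; exact: normc_le_ReIm.
rewrite [X in _ <= X * _](_ : _ = 1 + 1); last by rewrite -EFinD.
rewrite ge0_muleDl// mul1e; apply: leeD.
  by apply: part => // y; exact: Re_le_normc.
by apply: part => // y; exact: Im_le_normc.
Qed.

Lemma normc_circle_avg_le (f g : R -> R[i]) (t x : R) :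
  cmeasurable f -> cmeasurable g ->
  (normc (circle_avg f g t x))%:E <= 2%:E *
  \int[@arclength R]_(y in @unit_circle R)
     (normc (f (x - t * y.1)) * normc (g (x - t * y.2)))%:E.
Proof.
move=> mf mg.
apply: le_trans (normc_Cintegral_le _ measurable_unit_circle
  (cmeasurable_circle_integrand t x mf mg)) _.
by under eq_integral do rewrite Normc.normcM.
Qed.

Lemma CintegralD d (T : measurableType d) (nu : {measure set T -> \bar R})
    (D : set T) (h k : T -> R[i]) : measurable D -> cmeasurable h -> cmeasurable k ->
  \int[nu]_(y in D) (normc (h y))%:E < +oo ->
  \int[nu]_(y in D) (normc (k y))%:E < +oo ->
  Cintegral nu D (fun y => h y + k y)%R = (Cintegral nu D h + Cintegral nu D k)%R.
Proof.
move=> mD [h1 h2] [k1 k2] hoo koo.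
have int (w : T -> R[i]) (l : T -> R) : measurable_fun setT l ->
    (forall y, `|l y| <= normc (w y))%R ->
    \int[nu]_(y in D) (normc (w y))%:E < +oo -> nu.-integrable D (EFin \o l).
  move=> ml lw woo; apply/integrableP; split.
    by apply: measurable_funTS; exact: measurable_EFin_fun.
  by apply: le_lt_trans woo; apply: le_ge0_integral => // y _; rewrite lee_fin.
have E (z w : R[i]) : Re (z + w)%R = (Re z + Re w)%R /\ Im (z + w)%R = (Im z + Im w)%R.
  by case: z => ? ?; case: w.
rewrite /Cintegral.
under eq_Rintegral do rewrite (E _ _).1.
under [X in Complex _ X]eq_Rintegral do rewrite (E _ _).2.
rewrite RintegralD//; last 2 first.
- by apply: (int h) => // y; exact: Re_le_normc.
- by apply: (int k) => // y; exact: Re_le_normc.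
rewrite RintegralD//.
- by apply: (int h) => // y; exact: Im_le_normc.
- by apply: (int k) => // y; exact: Im_le_normc.
Qed.

(** Bilinear telescoping, [f g = (f - f') g + f' (g - g') + f' g'], followed by the reverse triangle
    inequality. The three finiteness hypotheses are what additivity of the integral requires. *)
Lemma circle_avg_difference (f f' g g' : R -> R[i]) (t x : R) :
  let J (u v : R -> R[i]) := \int[@arclength R]_(y in @unit_circle R)
     (normc (u (x - t * y.1)) * normc (v (x - t * y.2)))%:E in
  cmeasurable f -> cmeasurable f' -> cmeasurable g -> cmeasurable g' ->
  J (fun y => f y - f' y)%R g < +oo -> J f' (fun y => g y - g' y)%R < +oo ->
  J f' g' < +oo ->
  `| (normc (circle_avg f g t x))%:E - (normc (circle_avg f' g' t x))%:E | <=
  2%:E * (J (fun y => f y - f' y)%R g + J f' (fun y => g y - g' y)%R).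
Proof.
move=> J mf mf' mg mg' J1 J2 J3.
have mD := measurable_unit_circle.
have JE u v : J u v = \int[@arclength R]_(y in @unit_circle R)
    (normc (u (x - t * y.1) * v (x - t * y.2))%R)%:E.
  by apply: eq_integral => y _; rewrite Normc.normcM.
have mff' := cmeasurableB mf mf'.
have mgg' := cmeasurableB mg mg'.
have E : circle_avg f g t x = (circle_avg (fun y => f y - f' y) g t x +
    circle_avg f' (fun y => g y - g' y) t x + circle_avg f' g' t x)%R.
  rewrite -addrA {2 3}/circle_avg -CintegralD//; last 4 first.
  - exact: (@cmeasurable_circle_integrand f' (fun y => g y - g' y)%R).
  - exact: cmeasurable_circle_integrand.
  - by move: J2; rewrite JE.
  - by move: J3; rewrite JE.
  rewrite /circle_avg -CintegralD//.
  - by congr (Cintegral _ _ _); apply/funext => y; ring.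
  - exact: (@cmeasurable_circle_integrand (fun y => f y - f' y)%R g).
  - rewrite (_ : (fun y => _) = (fun y : R * R => f' (x - t * y.1) * g (x - t * y.2)))%R.
      exact: cmeasurable_circle_integrand.
    by apply/funext => y; ring.
  - by move: J1; rewrite JE.
  (* Additivity is used twice, so the sum [f' g] of the last two integrands must be integrable as
     well. *)
  - have := lte_add_pinfty J2 J3; apply: le_lt_trans.
    rewrite !JE -ge0_integralD//; last 4 first.
    + by move=> y _; rewrite lee_fin normc_ge0.
    + apply: measurable_funTS; apply: measurable_EFin_fun; apply: measurable_normc.
      exact: (@cmeasurable_circle_integrand f' (fun y => g y - g' y)%R).
    + by move=> y _; rewrite lee_fin normc_ge0.
    + apply: measurable_funTS; apply: measurable_EFin_fun; apply: measurable_normc.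
      exact: cmeasurable_circle_integrand.
    apply: le_ge0_integral => y _; first by rewrite lee_fin normc_ge0.
    by rewrite -EFinD lee_fin; exact: le_normcD.
have normcB (z w : R[i]) : (`|normc z - normc w| <= normc (z - w))%R.
  have := le_normcD (z - w)%R w; have := le_normcD (w - z)%R z.
  rewrite !subrK -(opprB z w) normcN ler_norml => h1 h2.
  by apply/andP; split; lra.
rewrite -EFinB abse_EFin; apply: le_trans (_ : (normc (circle_avg f g t x - circle_avg f' g' t x))%:E <= _).
  by rewrite lee_fin normcB.
rewrite E addrK; apply: (@le_trans _ _ ((normc (circle_avg (fun y => f y - f' y)%R g t x))%:E +
    (normc (circle_avg f' (fun y => g y - g' y)%R t x))%:E)).
  by rewrite -EFinD lee_fin le_normcD.
rewrite ge0_muleDr; last 2 first.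
- by apply: integral_ge0 => y _; rewrite lee_fin mulr_ge0// normc_ge0.
- by apply: integral_ge0 => y _; rewrite lee_fin mulr_ge0// normc_ge0.
by apply: leeD; exact: normc_circle_avg_le.
Qed.

End complex_circle_averages.

(** * Inequalities in [L^p] for extended-valued functions *)

Section Lp_bounds.
Context {R : realType}.
Notation mu := (@lebesgue_measure R).
Local Open Scope ereal_scope.
Implicit Types u v : R -> \bar R.

Lemma ae_mp (P Q : R -> Prop) : {ae mu, forall x, P x} -> (forall x, P x -> Q x) ->
  {ae mu, forall x, Q x}.
Proof. by move=> h PQ; exact: (@filterS _ _ (ae_filter_ringOfSetsType mu) _ _ PQ h). Qed.

Lemma ae_mp2 (P1 P2 Q : R -> Prop) : {ae mu, forall x, P1 x} -> {ae mu, forall x, P2 x} ->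
  (forall x, P1 x -> P2 x -> Q x) -> {ae mu, forall x, Q x}.
Proof. by move=> h1 h2 PQ; exact: (@filterS2 _ _ (ae_filter_ringOfSetsType mu) _ _ _ PQ h1 h2). Qed.

Lemma LnormE (p : R) u : 'N[mu]_p%:E[u] = (\int[mu]_x (`|u x| `^ p)) `^ p^-1.
Proof. by rewrite unlock. Qed.

Lemma Lnorm_le (p : R) u v : (0 < p)%R -> (forall x, `|u x| <= `|v x|) ->
  'N[mu]_p%:E[u] <= 'N[mu]_p%:E[v].
Proof.
move=> p0 uv; rewrite unlock; apply: le_poweR; first by rewrite invr_ge0 ltW.
  by apply: integral_ge0 => x _; exact: poweR_ge0.
apply: le_ge0_integral => x _; first exact: poweR_ge0.
by apply: le_poweR; [exact: ltW|exact: abse_ge0|exact: uv].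
Qed.

(** The strong type of [M] with exponent [q = p / s > 1], applied to [F^s]; the outer power [1 / s]
    restores homogeneity. *)
Lemma maxop_bound (s p : R) : (0 < s)%R -> (s < p)%R ->
  exists2 C : R, (0 <= C)%R & forall F : R -> R, measurable_fun setT F ->
    (forall y, 0 <= F y)%R -> 'N[mu]_p%:E[EFin \o F] < +oo ->
    measurable_fun setT (maxop s F) /\
    'N[mu]_p%:E[maxop s F] <= C%:E * 'N[mu]_p%:E[EFin \o F].
Proof.
move=> s0 sp; have p0 : (0 < p)%R by exact: lt_trans sp.
pose q := (p / s)%R.
have q1 : (1 < q)%R by rewrite ltr_pdivlMr// mul1r.
have sq : (s * q = p)%R by rewrite /q mulrC divfK// gt_eqF.
have sVp : (s^-1 * p = q)%R by rewrite mulrC.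
exists ((HL_strong_cst q) `^ p^-1)%R; first exact: powR_ge0.
move=> F mF F0 Foo.
pose f y := (F y `^ s)%R.
have mf : measurable_fun setT f by apply: (measurableT_comp (measurable_powR s)).
have fq y : (`|f y| `^ q = F y `^ p)%R.
  by rewrite ger0_norm ?powR_ge0// -powRrM sq.
have NF : \int[mu]_x (F x `^ p)%:E = 'N[mu]_p%:E[EFin \o F] `^ p.
  rewrite poweR_Lnorm ?gt_eqF//; apply: eq_integral => x _.
  by rewrite /= ger0_norm.
have fqoo : \int[mu]_x (`|f x| `^ q)%:E < +oo.
  under eq_integral do rewrite fq.
  by rewrite NF; exact: poweR_lty.
have lf := Lp_locally_integrable (ltW q1) mf fqoo.
split.
  by apply: measurable_poweR_fun; exact: (measurable_HL_maximal lf).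
have := HL_maximal_strong q1 mf fqoo.
under [in leRHS]eq_integral do rewrite fq.
rewrite NF => H.
rewrite [leLHS]LnormE.
have E x : `|maxop s F x| `^ p = HL_maximal f x `^ q.
  by rewrite gee0_abs ?maxop_ge0// /maxop -poweRrM sVp.
under eq_integral do rewrite E.
apply: (@le_trans _ _ (((HL_strong_cst q)%:E * 'N[mu]_p%:E[EFin \o F] `^ p) `^ p^-1)).
  apply: le_poweR H; first by rewrite invr_ge0 ltW.
  by apply: integral_ge0 => x _; exact: poweR_ge0.
rewrite poweRM ?poweR_ge0 ?lee_fin ?HL_strong_cst_ge0//.
by rewrite -poweRrM divff ?gt_eqF// poweRe1// ?Lnorm_ge0.
Qed.

Lemma fine_le_ge0 (z : \bar R) : 0 <= z -> (fine z)%:E <= z.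
Proof. by case: z => [z| |]//= _; rewrite leey. Qed.

Lemma Lnorm_ae_fin_num (p : R) u : (0 < p)%R -> measurable_fun setT u ->
  (forall x, 0 <= u x) -> 'N[mu]_p%:E[u] < +oo ->
  {ae mu, forall x, u x \is a fin_num}.
Proof.
move=> p0 mu_ u0 uoo.
have up : \int[mu]_x (u x `^ p) < +oo.
  have := poweR_lty p uoo; rewrite poweR_Lnorm ?gt_eqF//.
  by under eq_integral do rewrite gee0_abs//.
have : mu.-integrable setT (fun x => u x `^ p).
  apply/integrableP; split; first exact: measurable_poweR_fun.
  by under eq_integral do rewrite gee0_abs ?poweR_ge0//.
move=> /(integrable_ae measurableT)/ae_mp; apply => x /(_ I).
rewrite ge0_fin_numE ?poweR_ge0// => uxp; rewrite ge0_fin_numE//.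
by apply: lty_poweRy uxp; rewrite gt_eqF.
Qed.

Lemma measurable_fine_fun u : measurable_fun setT u -> measurable_fun setT (fine \o u).
Proof. by move=> mu_; exact: (measurableT_comp (fine_measurable measurableT)). Qed.

Lemma Lnorm_fine (p : R) u : (0 < p)%R -> (forall x, 0 <= u x) ->
  'N[mu]_p%:E[EFin \o (fine \o u)] <= 'N[mu]_p%:E[u].
Proof.
move=> p0 u0; apply: Lnorm_le => // x; rewrite /= gee0_abs ?lee_fin ?fine_ge0//.
by rewrite ger0_norm ?fine_ge0// fine_le_ge0.
Qed.

Lemma ae_eq_Lnorm (p : R) u v : measurable_fun setT u -> measurable_fun setT v ->
  {ae mu, forall x, u x = v x} -> 'N[mu]_p%:E[u] = 'N[mu]_p%:E[v].
Proof.
move=> mu_ mv uv; rewrite unlock; congr (_ `^ _).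
apply: ge0_ae_eq_integral => //.
- by apply: measurable_poweR_fun; exact: measurableT_comp.
- by apply: measurable_poweR_fun; exact: measurableT_comp.
- by move=> x _; exact: poweR_ge0.
- by move=> x _; exact: poweR_ge0.
- by apply: (ae_mp uv) => x -> _.
Qed.

(** Hoelder's inequality for [u^p] and [v^p] with the conjugate exponents [p1 / p] and [p2 / p].
    Finite norms make [u] and [v] finite almost everywhere, which allows real representatives. *)
Lemma Lnorm_mul (p1 p2 p : R) u v : (0 < p1)%R -> (0 < p2)%R ->
  (p^-1 = p1^-1 + p2^-1)%R ->
  measurable_fun setT u -> measurable_fun setT v ->
  (forall x, 0 <= u x) -> (forall x, 0 <= v x) ->
  'N[mu]_p1%:E[u] < +oo -> 'N[mu]_p2%:E[v] < +oo ->
  'N[mu]_p%:E[(fun x => u x * v x)] <= 'N[mu]_p1%:E[u] * 'N[mu]_p2%:E[v].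
Proof.
move=> p10 p20 pE mu_ mv u0 v0 uoo voo.
have p0 : (0 < p)%R by rewrite -invr_gt0 pE addr_gt0// invr_gt0.
pose u1 := fine \o u; pose v1 := fine \o v.
have mu1 : measurable_fun setT u1 by exact: measurable_fine_fun.
have mv1 : measurable_fun setT v1 by exact: measurable_fine_fun.
have u10 x : (0 <= u1 x)%R by rewrite fine_ge0.
have v10 x : (0 <= v1 x)%R by rewrite fine_ge0.
rewrite (@ae_eq_Lnorm p _ (fun x => (u1 x * v1 x)%:E)); last 3 first.
- exact: emeasurable_funM.
- by apply: measurable_EFin_fun; exact: measurable_funM.
- apply: (ae_mp2 (Lnorm_ae_fin_num p10 mu_ u0 uoo) (Lnorm_ae_fin_num p20 mv v0 voo)).
  move=> x ux vx.
  by rewrite EFinM /u1 /v1 /= !fineK.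
apply: (@le_trans _ _ ('N[mu]_p1%:E[EFin \o u1] * 'N[mu]_p2%:E[EFin \o v1])); last first.
  by apply: lee_pmul; rewrite ?Lnorm_ge0//; exact: Lnorm_fine.
clearbody u1 v1.
have r10 : (0 < p1 / p)%R by rewrite divr_gt0.
have r20 : (0 < p2 / p)%R by rewrite divr_gt0.
have rE : ((p1 / p)^-1 + (p2 / p)^-1 = 1)%R.
  by rewrite !invf_div -mulrDr -pE divff// gt_eqF.
have mpow (w : R -> R) : measurable_fun setT w -> measurable_fun setT (fun x => w x `^ p)%R.
  by move=> mw; exact: (measurableT_comp (measurable_powR p)).
have := hoelder_ge0 mu measurableT (mpow _ mu1) (mpow _ mv1)
  (fun x => powR_ge0 _ _) (fun x => powR_ge0 _ _) r10 r20 rE.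
have E (w : R -> R) (r : R) : (0 < r)%R -> (forall x, 0 <= w x)%R ->
  (\int[mu]_x ((w x `^ p) `^ (r / p))%:E) `^ (r / p)^-1 = 'N[mu]_r%:E[EFin \o w] `^ p.
  move=> r0 w0; rewrite [in RHS]unlock -poweRrM invf_div [(r^-1 * p)%R]mulrC; congr (_ `^ _).
  apply: eq_integral => x _; rewrite -powRrM mulrCA divff ?gt_eqF// mulr1.
  by rewrite /= ger0_norm.
move=> H.
have {}H : \int[mu]_x (u1 x `^ p * v1 x `^ p)%:E <=
    'N[mu]_p1%:E[EFin \o u1] `^ p * 'N[mu]_p2%:E[EFin \o v1] `^ p.
  by rewrite -(E u1 p1 p10 u10) -(E v1 p2 p20 v10); exact: H.
have -> : 'N[mu]_p1%:E[EFin \o u1] * 'N[mu]_p2%:E[EFin \o v1] =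
    ('N[mu]_p1%:E[EFin \o u1] `^ p * 'N[mu]_p2%:E[EFin \o v1] `^ p) `^ p^-1.
  rewrite -poweRM ?Lnorm_ge0// -poweRrM divff ?gt_eqF// poweRe1//.
  by rewrite mule_ge0 ?Lnorm_ge0.
rewrite LnormE.
apply: le_poweR; first by rewrite invr_ge0 ltW.
  by apply: integral_ge0 => x _; exact: poweR_ge0.
apply: le_trans H; apply: le_ge0_integral => x _; first exact: poweR_ge0.
by rewrite /= -powRM// ger0_norm ?mulr_ge0.
Qed.

(** An infinite norm on the right leaves nothing to prove; otherwise both functions are finite
    almost everywhere and Minkowski's inequality applies to their finite parts. *)
Lemma Lnorm_add (p : R) u v : (1 <= p)%R ->
  measurable_fun setT u -> measurable_fun setT v ->
  (forall x, 0 <= u x) -> (forall x, 0 <= v x) ->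
  'N[mu]_p%:E[(fun x => u x + v x)] <= 'N[mu]_p%:E[u] + 'N[mu]_p%:E[v].
Proof.
move=> p1 mu_ mv u0 v0; have p0 : (0 < p)%R by exact: lt_le_trans p1.
have [uoo|] := ltP 'N[mu]_p%:E[u] +oo; last first.
  by rewrite leye_eq => /eqP ->; rewrite addye ?leey// -ltNye (lt_le_trans _ (Lnorm_ge0 _ _ _)).
have [voo|] := ltP 'N[mu]_p%:E[v] +oo; last first.
  by rewrite leye_eq => /eqP ->; rewrite addey ?leey// -ltNye (lt_le_trans _ (Lnorm_ge0 _ _ _)).
have mu1 := measurable_fine_fun mu_; have mv1 := measurable_fine_fun mv.
rewrite (@ae_eq_Lnorm p _ (EFin \o ((fine \o u) \+ (fine \o v))%R)); last 3 first.
- exact: emeasurable_funD.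
- by apply: measurable_EFin_fun; exact: measurable_funD.
- apply: (ae_mp2 (Lnorm_ae_fin_num p0 mu_ u0 uoo) (Lnorm_ae_fin_num p0 mv v0 voo)).
  by move=> x ux vx; rewrite /= EFinD !fineK.
apply: le_trans (minkowski_EFin mu mu1 mv1 p1) _.
by apply: leeD; exact: Lnorm_fine.
Qed.

Lemma LnormZ_EFin (p c : R) u : (0 < p)%R -> (0 <= c)%R -> measurable_fun setT u ->
  'N[mu]_p%:E[(fun x => c%:E * u x)] = c%:E * 'N[mu]_p%:E[u].
Proof.
move=> p0 c0 mu_; rewrite unlock.
have E x : `|c%:E * u x| `^ p = (c `^ p)%:E * (`|u x| `^ p).
  by rewrite abseM gee0_abs ?lee_fin// poweRM// poweR_EFin.
under eq_integral do rewrite E.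
rewrite ge0_integralZl//; last 3 first.
- by apply: measurable_poweR_fun; exact: measurableT_comp.
- by move=> x _; exact: poweR_ge0.
- by rewrite lee_fin powR_ge0.
rewrite poweRM ?lee_fin ?powR_ge0//; last by apply: integral_ge0 => x _; exact: poweR_ge0.
by rewrite poweR_EFin -powRrM divff ?gt_eqF// powRr1.
Qed.

End Lp_bounds.

(** * The supremum over rational radii: measurability and norm bound *)

Section rational_supremum.
Context {R : realType}.
Notation mu := (@lebesgue_measure R).
Notation Re := (@complex.Re R).
Notation Im := (@complex.Im R).
Notation normc := (@Normc.normc R).
Local Open Scope ereal_scope.
Implicit Types f g : R -> R[i].

(** An enumeration of the positive rationals. Codes that name no positive rational are sent to 1, so
    that every index is a legitimate radius. *)
Definition pos_rat (n : nat) : R :=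
  if @unpickle rat n is Some q then (if 0 < ratr q :> R then ratr q else 1)%R else 1%R.

Lemma pos_rat_gt0 n : (0 < pos_rat n)%R.
Proof. by rewrite /pos_rat; case: unpickle => // q; case: ifP. Qed.

Lemma pos_ratP (q : rat) : (0 < ratr q :> R)%R -> exists n, pos_rat n = ratr q.
Proof. by move=> q0; exists (pickle q); rewrite /pos_rat pickleK q0. Qed.

(* The supremum over rational radii only: it is measurable and has [L^p] bounds for all
   measurable functions, and agrees with [S2] on Schwartz functions. *)
Definition Smax f g (x : R) : \bar R :=
  ereal_sup (range (fun n => (normc (circle_avg f g (pos_rat n) x))%:E)).

Lemma Smax_ge f g x n : (normc (circle_avg f g (pos_rat n) x))%:E <= Smax f g x.
Proof. by apply: ereal_sup_ubound; exists n. Qed.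

Lemma Smax_le f g x y : (forall n, (normc (circle_avg f g (pos_rat n) x))%:E <= y) ->
  Smax f g x <= y.
Proof. by move=> H; apply: ge_ereal_sup => _ [n _ <-]. Qed.

Lemma Smax_ge0 f g x : 0 <= Smax f g x.
Proof. by apply: le_trans (Smax_ge f g x 0); rewrite lee_fin normc_ge0. Qed.

(** Parametrizing the circle and inserting an indicator turns the integral into one against Lebesgue
    measure on the whole line, to which Tonelli's theorem on a product applies. *)
Lemma measurable_ge0_integral_circle (H : R * (R * R) -> \bar R) :
  measurable_fun setT H -> (forall z, 0 <= H z) ->
  measurable_fun setT (fun x : R => \int[@arclength R]_(y in @unit_circle R) H (x, y)).
Proof.
move=> mH H0.
have E x : \int[@arclength R]_(y in @unit_circle R) H (x, y) = ((2 * pi)^-1)%:E *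
    \int[mu]_s (H (x, (cos s, sin s)) * (\1_(`[0%R, (2 * pi)%R]%classic) s)%:E).
  rewrite ge0_integral_arclength//; last first.
    exact: (measurableT_comp mH (measurable_pair1 x)).
  congr (_ * _); rewrite integral_mkcond; apply: eq_integral => s _.
  by rewrite patchE indicE; case: ifPn => _; rewrite ?mule1 ?mule0.
rewrite (eq_fun E); apply: measurable_funeM.
pose k (z : R * R) := H (z.1, (cos z.2, sin z.2)) * (\1_(`[0%R, (2 * pi)%R]%classic) z.2)%:E.
have mk : measurable_fun setT k.
  apply: emeasurable_funM.
    apply: (@measurableT_comp _ _ _ _ _ _ H _ (fun z : R * R => (z.1, (cos z.2, sin z.2)))) => //.
    apply: measurable_fun_pair; first exact: measurable_fst.
    exact: (measurableT_comp measurable_circle_map measurable_snd).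
  apply: measurable_EFin_fun; apply: (measurableT_comp _ measurable_snd).
  exact: measurable_indic.
apply: (@measurable_fun_fubini_tonelli_F _ _ _ _ R mu k mk).
by move=> z; rewrite mule_ge0// lee_fin.
Qed.

Lemma measurable_Rintegral_circle (h : R -> R * R -> R) :
  measurable_fun setT (fun z : R * (R * R) => h z.1 z.2) ->
  measurable_fun setT (fun x : R => \int[@arclength R]_(y in @unit_circle R) h x y)%R.
Proof.
move=> mh; apply: measurable_fine_fun.
pose e (z : R * (R * R)) := (h z.1 z.2)%:E.
have me : measurable_fun setT e by exact: measurable_EFin_fun.
rewrite (_ : (fun x => _) = fun x =>
    \int[@arclength R]_(y in @unit_circle R) e^\+ (x, y) -
    \int[@arclength R]_(y in @unit_circle R) e^\- (x, y)); last first.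
  by apply/funext => x; rewrite integralE; congr (_ - _); apply: eq_integral => y _; rewrite ?funeposE ?funenegE.
apply: emeasurable_funB.
  by apply: measurable_ge0_integral_circle => //; exact: measurable_funepos.
by apply: measurable_ge0_integral_circle => //; exact: measurable_funeneg.
Qed.

Lemma measurable_circle_avg f g t : cmeasurable f -> cmeasurable g ->
  cmeasurable (circle_avg f g t).
Proof.
move=> mf mg.
have mfg : cmeasurable (fun z : R * (R * R) => f (z.1 - t * z.2.1) * g (z.1 - t * z.2.2))%R.
  apply: cmeasurableM.
    apply: (@cmeasurable_comp _ _ _ _ _ f (fun z : R * (R * R) => z.1 - t * z.2.1)%R) => //.
    apply: measurable_funB; first exact: measurable_fst.
    apply: measurable_funM => //.
    exact: (measurableT_comp measurable_fst measurable_snd).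
  apply: (@cmeasurable_comp _ _ _ _ _ g (fun z : R * (R * R) => z.1 - t * z.2.2)%R) => //.
  apply: measurable_funB; first exact: measurable_fst.
  apply: measurable_funM => //.
  exact: (measurableT_comp measurable_snd measurable_snd).
split.
- exact: (@measurable_Rintegral_circle
    (fun x y => Re (f (x - t * y.1) * g (x - t * y.2)))%R mfg.1).
- exact: (@measurable_Rintegral_circle
    (fun x y => Im (f (x - t * y.1) * g (x - t * y.2)))%R mfg.2).
Qed.

Lemma measurable_Smax f g : cmeasurable f -> cmeasurable g ->
  measurable_fun setT (Smax f g).
Proof.
move=> mf mg.
pose u n x := (normc (circle_avg f g (pos_rat n) x))%:E.
have mu_ n : measurable_fun setT (u n).
  by apply: measurable_EFin_fun; apply: measurable_normc; exact: measurable_circle_avg.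
have := measurable_fun_esups mu_ 0.
congr (measurable_fun _ _); apply/funext => x; rewrite /esups/sdrop/= /Smax.
by congr ereal_sup; apply/seteqP; split => [_ [n _ <-]|_ [n _ <-]]; exists n.
Qed.

Definition maxop2 (a b : R) f g (x : R) : \bar R :=
  maxop a (normc \o f) x * maxop b (normc \o g) x +
  maxop b (normc \o f) x * maxop a (normc \o g) x.

Lemma maxop2_ge0 a b f g x : 0 <= maxop2 a b f g x.
Proof. by rewrite adde_ge0// mule_ge0// maxop_ge0. Qed.

(** Each function appears under both [maxop a] and [maxop b], hence the four inequalities between
    exponents; [1 <= p] serves to add the two products by Minkowski. *)
Lemma Lnorm_maxop2 (a b p1 p2 p : R) : (0 < a)%R -> (0 < b)%R ->
  (a < p1)%R -> (a < p2)%R -> (b < p1)%R -> (b < p2)%R ->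
  (p^-1 = p1^-1 + p2^-1)%R -> (1 <= p)%R ->
  exists2 C : R, (0 <= C)%R & forall f g, cmeasurable f -> cmeasurable g ->
    CLnorm p1%:E f < +oo -> CLnorm p2%:E g < +oo ->
    measurable_fun setT (maxop2 a b f g) /\
    'N[mu]_p%:E[maxop2 a b f g] <= C%:E * (CLnorm p1%:E f * CLnorm p2%:E g).
Proof.
move=> a0 b0 ap1 ap2 bp1 bp2 pE p1_.
have p10 : (0 < p1)%R by exact: lt_trans ap1.
have p20 : (0 < p2)%R by exact: lt_trans ap2.
have [C1 C10 H1] := maxop_bound a0 ap1.
have [C2 C20 H2] := maxop_bound a0 ap2.
have [C3 C30 H3] := maxop_bound b0 bp1.
have [C4 C40 H4] := maxop_bound b0 bp2.
exists (C1 * C4 + C3 * C2)%R; first by rewrite addr_ge0// mulr_ge0.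
move=> f g mf mg foo goo.
have mnf := measurable_normc mf; have mng := measurable_normc mg.
have nf0 y : (0 <= (normc \o f) y)%R by exact: normc_ge0.
have ng0 y : (0 <= (normc \o g) y)%R by exact: normc_ge0.
have [m1 b1] := H1 _ mnf nf0 foo; have [m2 b2] := H2 _ mng ng0 goo.
have [m3 b3] := H3 _ mnf nf0 foo; have [m4 b4] := H4 _ mng ng0 goo.
have f0 : 0 <= CLnorm p1%:E f by exact: Lnorm_ge0.
have g0 : 0 <= CLnorm p2%:E g by exact: Lnorm_ge0.
have step (u v : R -> \bar R) (c d : R) : (0 <= c)%R -> (0 <= d)%R ->
    measurable_fun setT u -> measurable_fun setT v ->
    (forall x, 0 <= u x) -> (forall x, 0 <= v x) ->
    'N[mu]_p1%:E[u] <= c%:E * CLnorm p1%:E f -> 'N[mu]_p2%:E[v] <= d%:E * CLnorm p2%:E g ->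
    'N[mu]_p%:E[(fun x => u x * v x)] <= (c * d)%:E * (CLnorm p1%:E f * CLnorm p2%:E g).
  move=> c0 d0 mu_ mv u0 v0 uc vd.
  apply: le_trans (Lnorm_mul p10 p20 pE mu_ mv u0 v0 _ _) _.
  - by apply: le_lt_trans uc _; rewrite lte_mul_pinfty// lee_fin.
  - by apply: le_lt_trans vd _; rewrite lte_mul_pinfty// lee_fin.
  by rewrite EFinM muleACA; apply: lee_pmul => //; exact: Lnorm_ge0.
have ge0 s F x := @maxop_ge0 R s F x.
have m14 := emeasurable_funM m1 m4; have m32 := emeasurable_funM m3 m2.
have s14 := step _ _ _ _ C10 C40 m1 m4 (ge0 _ _) (ge0 _ _) b1 b4.
have s32 := step _ _ _ _ C30 C20 m3 m2 (ge0 _ _) (ge0 _ _) b3 b2.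
have ge14 x : 0 <= maxop a (normc \o f) x * maxop b (normc \o g) x by rewrite mule_ge0.
have ge32 x : 0 <= maxop b (normc \o f) x * maxop a (normc \o g) x by rewrite mule_ge0.
split; first exact: (emeasurable_funD m14 m32).
apply: le_trans (Lnorm_add p1_ m14 m32 ge14 ge32) _.
by rewrite EFinD ge0_muleDl ?lee_fin ?mulr_ge0//; exact: leeD.
Qed.

End rational_supremum.

(** * Representatives and norms in the quotient spaces *)

Section Lp_quotient.
Local Open Scope quotient_scope.
Context {R : realType}.
Notation mu := (@lebesgue_measure R).
Notation normc := (@Normc.normc R).
Local Open Scope ereal_scope.
Implicit Types f g : R -> R[i].

Lemma CLfun_cmeasurable (p : \bar R) (f : CLfun p) : cmeasurable f.
Proof. by split; [exact: CLfun_Re|exact: CLfun_Im]. Qed.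

Lemma CLrepr_class (p : \bar R) (f : CLfun p) :
  {ae mu, forall x, CLrepr (CLclass f) x = f x}.
Proof.
have /eqquotP : CLrepr (CLclass f) = f %[mod {eq_quot @CLfun_eq R p}].
  by rewrite reprK.
by move=> /asboolP.
Qed.

Lemma CLspace_ae_eq (p : \bar R) (u v : CLspace p) :
  {ae mu, forall x, CLrepr u x = CLrepr v x} -> u = v.
Proof.
move=> uv; rewrite -[u](@reprK _ {eq_quot @CLfun_eq R p}) -[v](@reprK _ {eq_quot @CLfun_eq R p}).
by apply/eqquotP/asboolP.
Qed.

Lemma CLnorm_ge0 (p : \bar R) f : 0 <= CLnorm p f.
Proof. exact: Lnorm_ge0. Qed.

Lemma measurable_EFin_normc f : cmeasurable f ->
  measurable_fun setT (EFin \o (normc \o f)).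
Proof. by move=> mf; apply: measurable_EFin_fun; exact: measurable_normc. Qed.

Lemma CLnorm_distC (p : R) f g :
  CLnorm p%:E (fun x => f x - g x)%R = CLnorm p%:E (fun x => g x - f x)%R.
Proof. by apply: eq_Lnorm => x; rewrite -(opprB (g x)) normcN. Qed.

Lemma CLnorm_add (p : R) f g : (1 <= p)%R -> cmeasurable f -> cmeasurable g ->
  CLnorm p%:E (fun x => f x + g x)%R <= CLnorm p%:E f + CLnorm p%:E g.
Proof.
move=> p1 mf mg; have p0 : (0 < p)%R by exact: lt_le_trans p1.
apply: le_trans (Lnorm_add p1 (measurable_EFin_normc mf) (measurable_EFin_normc mg) _ _).
- apply: Lnorm_le => // x; rewrite -EFinD !abse_EFin lee_fin !ger0_norm ?addr_ge0 ?normc_ge0//.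
  exact: le_normcD.
- by move=> x; rewrite lee_fin normc_ge0.
- by move=> x; rewrite lee_fin normc_ge0.
Qed.

Lemma CLnorm_sub (p : R) f g : (1 <= p)%R -> cmeasurable f -> cmeasurable g ->
  CLnorm p%:E (fun x => f x - g x)%R <= CLnorm p%:E f + CLnorm p%:E g.
Proof.
move=> p1 mf mg.
have mNg : cmeasurable (fun x => - g x)%R.
  have m0 : cmeasurable (fun _ : R => 0%R : R[i]) by split; exact: measurable_cst.
  by have := cmeasurableB m0 mg; congr cmeasurable; apply/funext => x; rewrite sub0r.
apply: le_trans (CLnorm_add p1 mf mNg) _; apply: leeD => //.
by rewrite le_eqVlt; apply/orP; left; apply/eqP/eq_Lnorm => x; rewrite normcN.
Qed.

Lemma CLnorm_triangle (p : R) f g h : (1 <= p)%R ->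
  cmeasurable f -> cmeasurable g -> cmeasurable h ->
  CLnorm p%:E (fun x => f x - h x)%R <=
  CLnorm p%:E (fun x => f x - g x)%R + CLnorm p%:E (fun x => g x - h x)%R.
Proof.
move=> p1 mf mg mh.
apply: le_trans (CLnorm_add p1 (cmeasurableB mf mg) (cmeasurableB mg mh)).
rewrite le_eqVlt; apply/orP; left; apply/eqP/eq_Lnorm => x.
by rewrite addrA subrK.
Qed.

Lemma CLnorm_ae_eq (p : R) f g : cmeasurable f -> cmeasurable g ->
  {ae mu, forall x, f x = g x} -> CLnorm p%:E f = CLnorm p%:E g.
Proof.
move=> mf mg fg; apply: ae_eq_Lnorm; try exact: measurable_EFin_normc.
by apply: (ae_mp fg) => x ->.
Qed.

Lemma CLnorm_eq0 (p : R) f : (0 < p)%R -> cmeasurable f -> CLnorm p%:E f = 0 ->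
  {ae mu, forall x, f x = 0%R}.
Proof.
move=> p0 mf f0; rewrite -lte_fin in p0.
have H := @Lnorm_eq0_eq0 _ _ _ mu (EFin \o (normc \o f)) p%:E
  (measurable_EFin_normc mf) p0 f0.
by apply: (ae_mp H) => x /(_ I) [] /Normc.eq0_normc.
Qed.

End Lp_quotient.

(** * Norm bounds for the maximal function and for its differences *)

Section extension.
Context {R : realType}.
Notation mu := (@lebesgue_measure R).
Notation Re := (@complex.Re R).
Notation Im := (@complex.Im R).
Notation normc := (@Normc.normc R).
Local Open Scope ereal_scope.
Implicit Types f g : R -> R[i].

Lemma intermediate_exponents (p1 p2 : R) : (2 < p1)%R -> (2 < p2)%R ->
  exists a b : R, [/\ (2 < a)%R, (0 < b)%R, (a^-1 + b^-1 = 1)%R &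
    [/\ (a < p1)%R, (a < p2)%R, (b < p1)%R & (b < p2)%R]].
Proof.
move=> h1 h2; pose m := Num.min p1 p2.
have m2 : (2 < m)%R by rewrite lt_min h1.
have mp1 : (m <= p1)%R by rewrite ge_min lexx.
have mp2 : (m <= p2)%R by rewrite ge_min lexx orbT.
(* The midpoint of 2 and [min (p1, p2)]. Its conjugate [a / (a - 1)] is below 2, hence below both
   [p1] and [p2]. *)
pose a : R := ((2 + m) / 2)%R.
have a2 : (2 < a)%R by rewrite /a; lra.
have am : (a < m)%R by rewrite /a; lra.
clearbody a m.
have a1 : (0 < a - 1)%R by lra.
have b0 : (0 < a / (a - 1))%R by rewrite divr_gt0//; lra.
have b2 : (a / (a - 1) < 2)%R by rewrite ltr_pdivrMr//; lra.
exists a, (a / (a - 1))%R; split => //; last by split; lra.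
by rewrite invf_div; field; rewrite gt_eqF//; lra.
Qed.

Lemma circle_avg_maxop2 (a b : R) : (2 < a)%R -> (a^-1 + b^-1 = 1)%R ->
  exists2 K : R, (0 <= K)%R & forall f g t x, cmeasurable f -> cmeasurable g -> (0 < t)%R ->
    (normc (circle_avg f g t x))%:E <= K%:E * maxop2 a b f g x.
Proof.
move=> a2 ab; have [K K0 H] := circle_avg_le a2 ab.
exists (2 * K)%R; first by rewrite mulr_ge0.
move=> f g t x mf mg t0; apply: le_trans (normc_circle_avg_le t x mf mg) _.
by rewrite EFinM -muleA; apply: lee_wpmul2l => //; exact: H.
Qed.

(** Every radius changes the average by at most the same [D], so the suprema differ by at most [D].
    Finiteness of the third maximal function makes [Smax f' g'] finite, then that of [D] makes
    [Smax f g] finite, and [fine] is faithful on both. *)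
Lemma Smax_difference (a b : R) : (2 < a)%R -> (a^-1 + b^-1 = 1)%R ->
  exists2 K : R, (0 <= K)%R & forall f f' g g' x,
    cmeasurable f -> cmeasurable f' -> cmeasurable g -> cmeasurable g' ->
    maxop2 a b (fun y => f y - f' y)%R g x \is a fin_num ->
    maxop2 a b f' (fun y => g y - g' y)%R x \is a fin_num ->
    maxop2 a b f' g' x \is a fin_num ->
    (`|fine (Smax f g x) - fine (Smax f' g' x)|%R)%:E <=
    K%:E * (maxop2 a b (fun y => f y - f' y)%R g x +
            maxop2 a b f' (fun y => g y - g' y)%R x).
Proof.
move=> a2 ab; have [K K0 H] := circle_avg_le a2 ab.
have [K' K'0 H'] := circle_avg_maxop2 a2 ab.
exists (2 * K)%R; first by rewrite mulr_ge0.
move=> f f' g g' x mf mf' mg mg'.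
have mff' := cmeasurableB mf mf'; have mgg' := cmeasurableB mg mg'.
move=> fin1 fin2 fin3.
set B1 := maxop2 _ _ _ _ _ in fin1 *; set B2 := maxop2 _ _ _ _ _ in fin2 *.
have B10 : 0 <= B1 by exact: maxop2_ge0.
have B20 : 0 <= B2 by exact: maxop2_ge0.
set D := (2 * K)%:E * (B1 + B2).
have diff n : `|(normc (circle_avg f g (pos_rat n) x))%:E -
    (normc (circle_avg f' g' (pos_rat n) x))%:E| <= D.
  have t0 := @pos_rat_gt0 R n.
  have h1 := H _ _ _ x mff' mg t0; have h2 := H _ _ _ x mf' mgg' t0.
  have h3 := H _ _ _ x mf' mg' t0.
  have fin_lt (y z : \bar R) : y \is a fin_num -> z <= K%:E * y -> z < +oo.
    by move=> yf; move=> /le_lt_trans; apply; rewrite ltey_eq fin_numM.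
  have := circle_avg_difference mf mf' mg mg' (fin_lt _ _ fin1 h1) (fin_lt _ _ fin2 h2)
    (fin_lt _ _ fin3 h3).
  move=> /le_trans; apply; rewrite /D EFinM -muleA; apply: lee_wpmul2l => //.
  by rewrite (ge0_muleDr _ B10 B20); exact: (leeD h1 h2).
have Dfin : D \is a fin_num.
  by rewrite /D; clearbody B1 B2; rewrite fin_numM// fin_numD fin1.
clearbody D.
have S'fin : Smax f' g' x \is a fin_num.
  rewrite ge0_fin_numE ?Smax_ge0//; apply: (@le_lt_trans _ _ (K'%:E * maxop2 a b f' g' x)).
    by apply: Smax_le => n; apply: H' => //; exact: pos_rat_gt0.
  by rewrite -(fineK fin3) -EFinM ltry.
have up : Smax f g x <= Smax f' g' x + D.
  apply: Smax_le => n; apply: le_trans (leeD (Smax_ge f' g' x n) (diff n)).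
  by rewrite -EFinB abse_EFin -EFinD lee_fin -lerBlDl ler_norm.
have Sfin : Smax f g x \is a fin_num.
  rewrite ge0_fin_numE ?Smax_ge0//; apply: le_lt_trans up _.
  by rewrite -(fineK S'fin) -(fineK Dfin) -EFinD ltry.
have down : Smax f' g' x <= Smax f g x + D.
  apply: Smax_le => n; apply: le_trans (leeD (Smax_ge f g x n) (diff n)).
  by rewrite -EFinB abse_EFin -EFinD lee_fin -lerBlDl distrC ler_norm.
move: up down; rewrite -(fineK Sfin) -(fineK S'fin) -(fineK Dfin) -!EFinD !lee_fin.
by move=> up down; rewrite /= ler_norml; apply/andP; split; lra.
Qed.

Section fixed_exponents.
Variables p1 p2 p : R.
Hypotheses (p12 : (2 < p1)%R) (p22 : (2 < p2)%R).
Hypothesis exponentE : (p^-1 = p1^-1 + p2^-1)%R.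

(** Both reciprocals are below [1/2]. This is what gives access to Minkowski's inequality in
    [L^p]. *)
Lemma exponent_ge1 : (1 <= p)%R.
Proof.
have p10 : (0 < p1)%R by exact: lt_trans p12.
have p20 : (0 < p2)%R by exact: lt_trans p22.
have i1 : (p1^-1 < 2^-1)%R by rewrite ltf_pV2 ?posrE.
have i2 : (p2^-1 < 2^-1)%R by rewrite ltf_pV2 ?posrE.
have i10 : (0 < p1^-1)%R by rewrite invr_gt0.
have i20 : (0 < p2^-1)%R by rewrite invr_gt0.
have pV0 : (0 < p^-1)%R by rewrite exponentE addr_gt0.
by rewrite -(invrK p) invf_ge1// exponentE; lra.
Qed.

Lemma Smax_Lnorm_difference : exists2 C : R, (0 <= C)%R &
  forall f f' g g', cmeasurable f -> cmeasurable f' -> cmeasurable g -> cmeasurable g' ->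
    CLnorm p1%:E f < +oo -> CLnorm p1%:E f' < +oo ->
    CLnorm p2%:E g < +oo -> CLnorm p2%:E g' < +oo ->
    'N[mu]_p%:E[(fun x => (fine (Smax f g x) - fine (Smax f' g' x))%R%:E)] <=
    C%:E * (CLnorm p1%:E (fun y => f y - f' y)%R * CLnorm p2%:E g +
            CLnorm p1%:E f' * CLnorm p2%:E (fun y => g y - g' y)%R).
Proof.
have [a [b [a2 b0 ab [ap1 ap2 bp1 bp2]]]] := intermediate_exponents p12 p22.
have a0 : (0 < a)%R by lra.
have p0 : (0 < p)%R by exact: lt_le_trans exponent_ge1.
have p1_1 : (1 <= p1)%R by move: p12; lra.
have p2_1 : (1 <= p2)%R by move: p22; lra.
have [K K0 H] := Smax_difference a2 ab.
have [C C0 HC] := Lnorm_maxop2 a0 b0 ap1 ap2 bp1 bp2 exponentE exponent_ge1.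
exists (K * C)%R; first by rewrite mulr_ge0.
move=> f f' g g' mf mf' mg mg' foo f'oo goo g'oo.
have mff' := cmeasurableB mf mf'; have mgg' := cmeasurableB mg mg'.
have ff'oo : CLnorm p1%:E (fun y => f y - f' y)%R < +oo.
  by apply: le_lt_trans (CLnorm_sub p1_1 mf mf') _; rewrite lte_add_pinfty.
have gg'oo : CLnorm p2%:E (fun y => g y - g' y)%R < +oo.
  by apply: le_lt_trans (CLnorm_sub p2_1 mg mg') _; rewrite lte_add_pinfty.
have [m1 b1] := HC _ _ mff' mg ff'oo goo.
have [m2 b2] := HC _ _ mf' mgg' f'oo gg'oo.
have [m3 b3] := HC _ _ mf' mg' f'oo g'oo.
(* The pointwise bound holds only where the maximal functions are finite; a finite [L^p] norm
   ensures this almost everywhere. *)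
have fin u v : measurable_fun setT (maxop2 a b u v) ->
    'N[mu]_p%:E[maxop2 a b u v] <= C%:E * (CLnorm p1%:E u * CLnorm p2%:E v) ->
    CLnorm p1%:E u < +oo -> CLnorm p2%:E v < +oo ->
    {ae mu, forall x, maxop2 a b u v x \is a fin_num}.
  move=> muv buv uoo voo; apply: (Lnorm_ae_fin_num p0) => //; first exact: maxop2_ge0.
  apply: le_lt_trans buv _; rewrite -ge0_fin_numE ?mule_ge0 ?lee_fin ?CLnorm_ge0//.
  by rewrite !fin_numM// ge0_fin_numE ?CLnorm_ge0.
have F1 := fin _ _ m1 b1 ff'oo goo; have F2 := fin _ _ m2 b2 f'oo gg'oo.
have F3 := fin _ _ m3 b3 f'oo g'oo.
pose B1 := maxop2 a b (fun y => f y - f' y)%R g.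
pose B2 := maxop2 a b f' (fun y => g y - g' y)%R.
have mB : measurable_fun setT (fun x => B1 x + B2 x) := emeasurable_funD m1 m2.
have B10 x : 0 <= B1 x := maxop2_ge0 _ _ _ _ _.
have B20 x : 0 <= B2 x := maxop2_ge0 _ _ _ _ _.
apply: (@le_trans _ _ ('N[mu]_p%:E[(fun x => K%:E * (B1 x + B2 x))])).
  rewrite !LnormE; apply: le_poweR; first by rewrite invr_ge0 ltW.
    by apply: integral_ge0 => x _; exact: poweR_ge0.
  apply: ae_ge0_le_integral => //.
  - by move=> x _; exact: poweR_ge0.
  - apply: measurable_poweR_fun; apply: measurableT_comp => //.
    by apply: measurable_EFin_fun; apply: measurable_funB;
      apply: measurable_fine_fun; exact: measurable_Smax.
  - by move=> x _; exact: poweR_ge0.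
  - apply: measurable_poweR_fun; apply: measurableT_comp => //.
    exact: measurable_funeM.
  apply: (ae_mp2 F1 (ae_mp2 F2 F3 (fun x h2 h3 => conj h2 h3))) => x h1 [h2 h3] _.
  apply: le_poweR; [exact: ltW|exact: abse_ge0|].
  have BK : 0 <= K%:E * (B1 x + B2 x).
    by apply: mule_ge0; [rewrite lee_fin|exact: adde_ge0 (B10 x) (B20 x)].
  rewrite (gee0_abs BK) abse_EFin.
  exact: (H f f' g g' x mf mf' mg mg' h1 h2 h3).
rewrite LnormZ_EFin// EFinM -muleA; apply: lee_wpmul2l; first by rewrite lee_fin.
apply: le_trans (Lnorm_add exponent_ge1 m1 m2 B10 B20) _.
by rewrite ge0_muleDr ?mule_ge0 ?CLnorm_ge0//; exact: leeD.
Qed.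

Lemma Smax_Lnorm_bound : exists2 C : R, (0 <= C)%R &
  forall f g, cmeasurable f -> cmeasurable g ->
    CLnorm p1%:E f < +oo -> CLnorm p2%:E g < +oo ->
    'N[mu]_p%:E[Smax f g] <= C%:E * (CLnorm p1%:E f * CLnorm p2%:E g).
Proof.
have [a [b [a2 b0 ab [ap1 ap2 bp1 bp2]]]] := intermediate_exponents p12 p22.
have a0 : (0 < a)%R by lra.
have p0 : (0 < p)%R by exact: lt_le_trans exponent_ge1.
have [K K0 H] := circle_avg_maxop2 a2 ab.
have [C C0 HC] := Lnorm_maxop2 a0 b0 ap1 ap2 bp1 bp2 exponentE exponent_ge1.
exists (K * C)%R; first by rewrite mulr_ge0.
move=> f g mf mg foo goo; have [m bd] := HC _ _ mf mg foo goo.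
apply: (@le_trans _ _ ('N[mu]_p%:E[(fun x => K%:E * maxop2 a b f g x)])).
  apply: Lnorm_le => // x; rewrite !gee0_abs ?Smax_ge0 ?mule_ge0 ?maxop2_ge0//.
  by apply: Smax_le => n; apply: H => //; exact: pos_rat_gt0.
by rewrite LnormZ_EFin// EFinM -muleA; apply: lee_wpmul2l; rewrite ?lee_fin.
Qed.

End fixed_exponents.
End extension.

(** * Schwartz functions: integrability and continuity in the radius *)

Section schwartz_functions.
Context {R : realType}.
Notation mu := (@lebesgue_measure R).
Notation Re := (@complex.Re R).
Notation Im := (@complex.Im R).
Notation normc := (@Normc.normc R).
Local Open Scope ereal_scope.
Implicit Types f g : R -> R[i].

Lemma derivable_continuous_fun (h : R -> R) : (forall x, derivable h x 1) -> continuous h.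
Proof. by move=> dh x; apply/differentiable_continuous/derivable1_diffP. Qed.

Lemma schwartz_continuous f : schwartz f -> continuous (Re \o f) /\ continuous (Im \o f).
Proof.
move=> [df _]; split; apply: derivable_continuous_fun => x.
  by have [] := df 0%N x.
by have [] := df 0%N x.
Qed.

Lemma schwartz_cmeasurable f : schwartz f -> cmeasurable f.
Proof.
by move=> /schwartz_continuous[c1 c2]; split; exact: continuous_measurable_fun.
Qed.

Lemma schwartz_bound f (m : nat) : schwartz f ->
  exists2 M : R, (0 <= M)%R & forall x, (`|x| ^+ m * normc (f x) <= M)%R.
Proof.
move=> [_ /(_ m 0%N)[M HM]].
have H x : (`|x| ^+ m * normc (f x) <= M)%R.
  by have := HM x; rewrite (_ : cderive1n 0 f x = f x)// /cderive1n /=; case: (f x).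
exists M => //; apply: le_trans (H 0%R).
by rewrite mulr_ge0 ?normc_ge0// exprn_ge0.
Qed.

(** The integrand is even and its integral over the half-line is [pi / 2]. *)
Lemma integral_oneDsqrV_lty : \int[mu]_x ((1 + x ^+ 2)^-1)%:E < +oo.
Proof.
pose k (x : R) : \bar R := ((1 + x ^+ 2)^-1)%:E.
have k0 x : 0 <= k x by rewrite lee_fin invr_ge0 addr_ge0// sqr_ge0.
have mk : measurable_fun setT k.
  apply: measurable_EFin_fun; apply: continuous_measurable_fun.
  exact: (@continuous_oneDsqrV R).
have I0 : \int[mu]_(x in `[0%R, +oo[) k x = (pi / 2)%:E.
  exact: (@integral0y_oneDsqr R).
apply: (@le_lt_trans _ _ (\int[mu]_(x in `]-oo, 0%R]) k x + \int[mu]_(x in `[0%R, +oo[) k x)).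
  apply: ge0_integral_setU_le => //.
  by move=> x _ /=; rewrite !in_itv/= andbT; have [|/ltW] := leP x 0%R; [left|right].
rewrite (_ : \int[mu]_(x in `]-oo, 0%R]) k x = \int[mu]_(x in `[0%R, +oo[) k x).
  by rewrite I0 -EFinD ltry.
rewrite (ge0_integration_by_substitution0 mk k0).
by apply: eq_integral => x _; rewrite /k sqrrN.
Qed.

(** Since [1 / (1 + x^2) <= 1] and [p >= 1], the [p]-th power of the decay is still dominated by
    [1 / (1 + x^2)]. *)
Lemma CLnorm_lty_of_decay (p M : R) f : (1 <= p)%R -> (0 <= M)%R ->
  (forall x, normc (f x) <= M / (1 + x ^+ 2))%R -> CLnorm p%:E f < +oo.
Proof.
move=> p1 M0 fM; have p0 : (0 < p)%R by exact: lt_le_trans p1.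
rewrite /CLnorm LnormE; apply: poweR_lty.
apply: (@le_lt_trans _ _ (\int[mu]_x ((M `^ p)%:E * ((1 + x ^+ 2)^-1)%:E))).
  apply: le_ge0_integral => x _; first exact: poweR_ge0.
  have d0 : (0 < (1 + x ^+ 2)^-1)%R by rewrite invr_gt0 ltr_wpDr// sqr_ge0.
  have d1 : ((1 + x ^+ 2)^-1 <= 1)%R by rewrite invf_le1 ?lerDl ?sqr_ge0// ltr_wpDr// sqr_ge0.
  rewrite abse_EFin poweR_EFin -EFinM lee_fin ger0_norm ?normc_ge0//.
  apply: (@le_trans _ _ ((M / (1 + x ^+ 2)) `^ p)%R).
    by apply: ge0_ler_powR; rewrite ?nnegrE ?normc_ge0 ?(ltW p0)// divr_ge0// -invr_ge0 ltW.
  rewrite powRM ?(ltW d0)//; apply: ler_wpM2l; first exact: powR_ge0.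
  by apply: ge1r_powR; rewrite ?d0.
rewrite ge0_integralZl//.
- by rewrite lte_mul_pinfty ?lee_fin ?powR_ge0//; exact: integral_oneDsqrV_lty.
- apply: measurable_EFin_fun; apply: continuous_measurable_fun.
  exact: (@continuous_oneDsqrV R).
- by move=> x _; rewrite lee_fin invr_ge0 addr_ge0// sqr_ge0.
- by rewrite lee_fin powR_ge0.
Qed.

Lemma schwartz_CLnorm_lty (p : R) f : (1 <= p)%R -> schwartz f -> CLnorm p%:E f < +oo.
Proof.
move=> p1 sf; have [M0 M00 H0] := schwartz_bound 0 sf; have [M2 M20 H2] := schwartz_bound 2 sf.
apply: (@CLnorm_lty_of_decay p (M0 + M2)) => //; first by rewrite addr_ge0.
move=> x; rewrite ler_pdivlMr ?ltr_wpDr ?sqr_ge0//.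
have := H0 x; have := H2 x; rewrite expr0 mul1r real_normK ?num_real// => h2 h0.
by rewrite mulrDr mulr1 lerD// mulrC.
Qed.

Lemma arclength_integral_cst_lty (c : R) : (0 <= c)%R ->
  \int[@arclength R]_(y in @unit_circle R) c%:E < +oo.
Proof.
move=> c0; rewrite (ge0_integral_arclength (H := fun=> c%:E))//.
have muI : mu `[0%R, (2 * pi)%R]%classic = (2 * pi)%:E.
  by rewrite lebesgue_measure_itv/= lte_fin two_pi_gt0 -EFinB subr0.
have -> : \int[mu]_(_ in `[0%R, (2 * pi)%R]) c%:E = c%:E * mu `[0%R, (2 * pi)%R]%classic.
  exact: integral_cst.
by rewrite muI -!EFinM ltry.
Qed.

Lemma arclength_integrable_bounded (h : R * R -> R) (M : R) :
  measurable_fun setT h -> (forall y, `|h y| <= M)%R ->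
  (@arclength R).-integrable (@unit_circle R) (EFin \o h).
Proof.
move=> mh hM; apply/integrableP; split.
  by apply: measurable_funTS; exact: measurable_EFin_fun.
have M0 : (0 <= M)%R by apply: le_trans (hM (0, 0)%R).
apply: (@le_lt_trans _ _ (\int[@arclength R]_(y in @unit_circle R) M%:E)).
  by apply: le_ge0_integral => // y _; rewrite lee_fin.
exact: arclength_integral_cst_lty.
Qed.

(** Dominated convergence with a constant majorant on a finite measure. Continuity in the radius is
    what lets rational radii suffice. *)
Lemma continuous_circle_avg f g (x : R) :
  continuous (Re \o f) -> continuous (Im \o f) -> continuous (Re \o g) -> continuous (Im \o g) ->
  (exists M, forall y, normc (f y) <= M)%R -> (exists M, forall y, normc (g y) <= M)%R ->
  continuous (fun t : R => normc (circle_avg f g t x)).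
Proof.
move=> cf1 cf2 cg1 cg2 [M1 fM1] [M2 gM2] t0.
have mf : cmeasurable f by split; exact: continuous_measurable_fun.
have mg : cmeasurable g by split; exact: continuous_measurable_fun.
have mint t := @cmeasurable_circle_integrand R f g t x mf mg.
have bnd t (y : R * R) : (normc (f (x - t * y.1) * g (x - t * y.2)) <= M1 * M2)%R.
  by rewrite Normc.normcM ler_pM ?normc_ge0.
have cline (y : R) : continuous (fun t : R => x - t * y)%R.
  by move=> t; apply: cvgB; [exact: cvg_cst|apply: cvgMl; exact: cvg_id].
have comp (h : R -> R) (y : R) : continuous h -> continuous (fun t : R => h (x - t * y)%R).
  by move=> ch t; apply: continuous_comp; [exact: cline|exact: ch].
have cRe : continuous (fun t : R => \int[@arclength R]_(y in @unit_circle R)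
    Re (f (x - t * y.1) * g (x - t * y.2)))%R.
  move=> t.
  apply: (@continuity_under_integral R _ _ (@arclength R)
    (fun t (y : R * R) => Re (f (x - t * y.1) * g (x - t * y.2)))%R
    (@unit_circle R) measurable_unit_circle (t - 1) (t + 1) _ _ (fun=> M1 * M2)%R).
  - move=> s _; apply: (@arclength_integrable_bounded _ (M1 * M2)); first exact: (mint s).1.
    by move=> y; apply: le_trans (Re_le_normc _) (bnd s y).
  - apply: aeW => y _ s _.
    rewrite (_ : (fun s => _) = (fun s => Re (f (x - s * y.1)) * Re (g (x - s * y.2)) -
       Im (f (x - s * y.1)) * Im (g (x - s * y.2))))%R.
      apply: cvgB; apply: cvgM.
      - exact: (comp (Re \o f) y.1 cf1 s).
      - exact: (comp (Re \o g) y.2 cg1 s).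
      - exact: (comp (Im \o f) y.1 cf2 s).
      - exact: (comp (Im \o g) y.2 cg2 s).
    by apply/funext => u; case: (f _) => ? ?; case: (g _).
  - apply: (@arclength_integrable_bounded _ (M1 * M2)); first exact: measurable_cst.
    move=> y; rewrite ger0_norm//; apply: le_trans (bnd 0%R y); exact: normc_ge0.
  - by move=> s _; apply: aeW => y _; apply: le_trans (Re_le_normc _) (bnd s y).
  - by rewrite inE/= in_itv/=; apply/andP; split; lra.
have cIm : continuous (fun t : R => \int[@arclength R]_(y in @unit_circle R)
    Im (f (x - t * y.1) * g (x - t * y.2)))%R.
  move=> t.
  apply: (@continuity_under_integral R _ _ (@arclength R)
    (fun t (y : R * R) => Im (f (x - t * y.1) * g (x - t * y.2)))%R
    (@unit_circle R) measurable_unit_circle (t - 1) (t + 1) _ _ (fun=> M1 * M2)%R).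
  - move=> s _; apply: (@arclength_integrable_bounded _ (M1 * M2)); first exact: (mint s).2.
    by move=> y; apply: le_trans (Im_le_normc _) (bnd s y).
  - apply: aeW => y _ s _.
    rewrite (_ : (fun s => _) = (fun s => Re (f (x - s * y.1)) * Im (g (x - s * y.2)) +
       Im (f (x - s * y.1)) * Re (g (x - s * y.2))))%R.
      apply: cvgD; apply: cvgM.
      - exact: (comp (Re \o f) y.1 cf1 s).
      - exact: (comp (Im \o g) y.2 cg2 s).
      - exact: (comp (Im \o f) y.1 cf2 s).
      - exact: (comp (Re \o g) y.2 cg1 s).
    by apply/funext => u; case: (f _) => ? ?; case: (g _).
  - apply: (@arclength_integrable_bounded _ (M1 * M2)); first exact: measurable_cst.
    move=> y; rewrite ger0_norm//; apply: le_trans (bnd 0%R y); exact: normc_ge0.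
  - by move=> s _; apply: aeW => y _; apply: le_trans (Im_le_normc _) (bnd s y).
  - by rewrite inE/= in_itv/=; apply/andP; split; lra.
have cS : continuous (fun t : R => ((\int[@arclength R]_(y in @unit_circle R)
    Re (f (x - t * y.1) * g (x - t * y.2))) ^+ 2 + (\int[@arclength R]_(y in @unit_circle R)
    Im (f (x - t * y.1) * g (x - t * y.2))) ^+ 2)%R).
  move=> t; apply: cvgD; apply: cvgM;
    [exact: cRe|exact: cRe|exact: cIm|exact: cIm].
exact: (@cvg_comp _ _ _ _ Num.sqrt _ _ _ (cS t0) (@sqrt_continuous R _)).
Qed.

(** If the average at some radius [t] strictly exceeded the rational supremum, continuity would
    preserve this at nearby radii, one of which is a positive rational. *)
Lemma schwartz_S2_Smax f g : schwartz f -> schwartz g -> S2 f g = Smax f g.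
Proof.
move=> sf sg; apply/funext => x; apply/eqP; rewrite eq_le; apply/andP; split; last first.
  by apply: Smax_le => n; apply: ereal_sup_ubound; exists (pos_rat n) => //=; exact: pos_rat_gt0.
have [cf1 cf2] := schwartz_continuous sf; have [cg1 cg2] := schwartz_continuous sg.
have bd h : schwartz h -> exists M, (forall y, normc (h y) <= M)%R.
  by move=> /(schwartz_bound 0)[M _ H]; exists M => y; have := H y; rewrite expr0 mul1r.
apply: ge_ereal_sup => _ [t /= t0 <-].
have ct := @continuous_circle_avg f g x cf1 cf2 cg1 cg2 (bd _ sf) (bd _ sg) t.
rewrite leNgt; apply/negP => lt.
have Sfin : Smax f g x \is a fin_num.
  by rewrite ge0_fin_numE ?Smax_ge0//; apply: lt_trans lt _; rewrite ltry.
move: lt; rewrite -(fineK Sfin) lte_fin => lt.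
have /nbhs_ballP[e /= e0 eP] : \forall s \near t, (fine (Smax f g x) < normc (circle_avg f g s x))%R.
  exact: (@cvgr_gt _ _ _ _ (fun t : R => normc (circle_avg f g t x)) _ ct _ lt).
(* The left end [max 0 (t - e)] keeps the rational both positive and within [e] of [t]. *)
have [|q] := @rat_in_itvoo R (Num.max 0%R (t - e)%R) t.
  by rewrite gt_max t0 ltrBlDr ltrDl.
rewrite in_itv/= gt_max => /andP[/andP[q0 qe] qt].
have [n nq] := pos_ratP q0.
have : (fine (Smax f g x) < normc (circle_avg f g (ratr q) x))%R.
  by apply: eP; rewrite /ball/= ger0_norm; lra.
apply/negP; rewrite -leNgt -lee_fin (fineK Sfin) -nq; exact: Smax_ge.
Qed.

Lemma schwartz_Smax_fin_num f g x : schwartz f -> schwartz g -> Smax f g x \is a fin_num.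
Proof.
move=> sf sg; have mf := schwartz_cmeasurable sf; have mg := schwartz_cmeasurable sg.
have [M1 M10 H1] := schwartz_bound 0 sf; have [M2 M20 H2] := schwartz_bound 0 sg.
rewrite ge0_fin_numE ?Smax_ge0//.
apply: (@le_lt_trans _ _ (2%:E * \int[@arclength R]_(y in @unit_circle R) (M1 * M2)%:E)).
  apply: Smax_le => n; apply: le_trans (normc_circle_avg_le _ _ mf mg) _.
  apply: lee_wpmul2l => //; apply: le_ge0_integral => y _.
    by rewrite lee_fin mulr_ge0 ?normc_ge0.
  have := H1 (x - pos_rat n * y.1)%R; have := H2 (x - pos_rat n * y.2)%R.
  by rewrite !expr0 !mul1r => h2 h1; rewrite lee_fin ler_pM ?normc_ge0.
by rewrite lte_mul_pinfty// arclength_integral_cst_lty// mulr_ge0.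
Qed.

End schwartz_functions.

(** * The bounded extension and its uniqueness *)

Section bounded_extension.
Context {R : realType}.
Notation mu := (@lebesgue_measure R).
Notation Re := (@complex.Re R).
Notation Im := (@complex.Im R).
Notation normc := (@Normc.normc R).
Local Open Scope ereal_scope.
Variables p1 p2 p : R.
Hypotheses (p12 : (2 < p1)%R) (p22 : (2 < p2)%R).
Hypothesis pE : (p^-1 = p1^-1 + p2^-1)%R.

Let p_ge1 : (1 <= p)%R := exponent_ge1 p12 p22 pE.
Let p_gt0 : (0 < p)%R. Proof. exact: lt_le_trans p_ge1. Qed.
Let p1_ge1 : (1 <= p1)%R. Proof. by move: p12; lra. Qed.
Let p2_ge1 : (1 <= p2)%R. Proof. by move: p22; lra. Qed.

(** Elements of the quotient are complex-valued functions, so the extended-valued supremum passes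
    through [fine], which alters it only where it is infinite. *)
Definition Smax_complex (f g : R -> R[i]) (x : R) : R[i] :=
  Complex (fine (Smax f g x)) 0%R.

Lemma cmeasurable_Smax_complex f g : cmeasurable f -> cmeasurable g ->
  cmeasurable (Smax_complex f g).
Proof.
move=> mf mg; split; last exact: measurable_cst.
by apply: measurable_fine_fun; exact: measurable_Smax.
Qed.

Lemma normc_Smax_complex f g x : normc (Smax_complex f g x) = fine (Smax f g x).
Proof.
by rewrite normcE /= expr0n/= addr0 sqrtr_sqr ger0_norm// fine_ge0// Smax_ge0.
Qed.

Lemma normc_Smax_complexB f g f' g' x :
  normc (Smax_complex f g x - Smax_complex f' g' x)%R =
  `|fine (Smax f g x) - fine (Smax f' g' x)|%R.
Proof.
rewrite normcE (_ : Re _ = fine (Smax f g x) - fine (Smax f' g' x))%R//.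
rewrite (_ : Im _ = 0%R); last by rewrite /= subr0.
by rewrite expr0n/= addr0 sqrtr_sqr.
Qed.

Lemma Smax_complex_finite (f : CLfun p1%:E) (g : CLfun p2%:E) :
  CLnorm p%:E (Smax_complex f g) < +oo.
Proof.
have mf := CLfun_cmeasurable f; have mg := CLfun_cmeasurable g.
have [C C0 H] := Smax_Lnorm_bound p12 p22 pE.
have := H f g mf mg (CLfun_finite f) (CLfun_finite g) => bd.
apply: le_lt_trans (le_trans _ bd) _.
  rewrite /CLnorm; apply: Lnorm_le => // x; rewrite normc_Smax_complex abse_EFin.
  by rewrite ger0_norm ?fine_ge0 ?Smax_ge0// gee0_abs ?Smax_ge0// fine_le_ge0// Smax_ge0.
rewrite -ge0_fin_numE; last by rewrite mule_ge0 ?lee_fin// mule_ge0// CLnorm_ge0.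
by rewrite fin_numM// fin_numM// ge0_fin_numE ?CLnorm_ge0//; exact: CLfun_finite.
Qed.

Definition Smax_CLfun (f : CLfun p1%:E) (g : CLfun p2%:E) : CLfun p%:E :=
  let m := cmeasurable_Smax_complex (CLfun_cmeasurable f) (CLfun_cmeasurable g) in
  MkCLfun m.1 m.2 (Smax_complex_finite f g).

(** Defined through chosen representatives; the difference estimate is what shows that the choice
    does not affect the class. *)
Definition S2_extension (uv : CLspace p1%:E * CLspace p2%:E) : CLspace p%:E :=
  CLclass (Smax_CLfun (CLrepr uv.1) (CLrepr uv.2)).

Lemma S2_extensionE u v : {ae mu, forall x,
  CLrepr (S2_extension (u, v)) x = Smax_complex (CLrepr u) (CLrepr v) x}.
Proof. exact: CLrepr_class. Qed.

Lemma CLspace_norm_lty (q : \bar R) (u : CLspace q) : CLspace_norm u < +oo.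
Proof. exact: CLfun_finite. Qed.

Lemma S2_extension_difference : exists2 C : R, (0 <= C)%R &
  forall u u' v v',
    CLspace_dist (S2_extension (u', v')) (S2_extension (u, v)) <=
    C%:E * (CLspace_dist u' u * CLspace_norm v' + CLspace_norm u * CLspace_dist v' v).
Proof.
have [C C0 H] := Smax_Lnorm_difference p12 p22 pE; exists C => // u u' v v'.
have m (q : \bar R) (w : CLspace q) := CLfun_cmeasurable (CLrepr w).
have := H _ _ _ _ (m _ u') (m _ u) (m _ v') (m _ v) (CLfun_finite _) (CLfun_finite _)
  (CLfun_finite _) (CLfun_finite _).
apply: le_trans.
rewrite /CLspace_dist (@CLnorm_ae_eq _ p _ (fun x => Smax_complex (CLrepr u') (CLrepr v') x -
   Smax_complex (CLrepr u) (CLrepr v) x)%R); last 3 first.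
- by apply: cmeasurableB; exact: m.
- by apply: cmeasurableB; apply: cmeasurable_Smax_complex; exact: m.
- by apply: (ae_mp2 (S2_extensionE u' v') (S2_extensionE u v)) => x -> ->.
by apply: Lnorm_le => // x; rewrite normc_Smax_complexB !abse_EFin normr_id.
Qed.

Lemma S2_extension_bounded : exists C : R, forall u v,
  CLspace_norm (S2_extension (u, v)) <= C%:E * (CLspace_norm u * CLspace_norm v).
Proof.
have [C C0 H] := Smax_Lnorm_bound p12 p22 pE; exists C => u v.
have m (q : \bar R) (w : CLspace q) := CLfun_cmeasurable (CLrepr w).
have := H _ _ (m _ u) (m _ v) (CLfun_finite _) (CLfun_finite _).
apply: le_trans.
rewrite /CLspace_norm (@CLnorm_ae_eq _ p _ (Smax_complex (CLrepr u) (CLrepr v))); last 3 first.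
- exact: m.
- by apply: cmeasurable_Smax_complex; exact: m.
- exact: S2_extensionE.
rewrite /CLnorm; apply: Lnorm_le => // x; rewrite normc_Smax_complex abse_EFin.
by rewrite ger0_norm ?fine_ge0 ?Smax_ge0// gee0_abs ?Smax_ge0// fine_le_ge0// Smax_ge0.
Qed.

Lemma CLspace_dist_ge0 (q : \bar R) (u v : CLspace q) : 0 <= CLspace_dist u v.
Proof. exact: CLnorm_ge0. Qed.

Lemma CLspace_norm_dist (q : R) (u v : CLspace q%:E) : (1 <= q)%R ->
  CLspace_norm u <= CLspace_dist u v + CLspace_norm v.
Proof.
move=> q1; have m (w : CLspace q%:E) := CLfun_cmeasurable (CLrepr w).
have := CLnorm_add q1 (cmeasurableB (m u) (m v)) (m v).
have -> : CLnorm q%:E (fun x => CLrepr u x - CLrepr v x + CLrepr v x)%R = CLnorm q%:E (CLrepr u).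
  by apply: eq_Lnorm => x; rewrite subrK.
by [].
Qed.

Lemma S2_extension_continuous : CLspace_continuous S2_extension.
Proof.
have [C C0 H] := S2_extension_difference => u v e e0.
pose nu := fine (CLspace_norm u); pose nv := fine (CLspace_norm v).
have nuE : nu%:E = CLspace_norm u by rewrite fineK// ge0_fin_numE ?CLspace_norm_lty ?CLnorm_ge0.
have nvE : nv%:E = CLspace_norm v by rewrite fineK// ge0_fin_numE ?CLspace_norm_lty ?CLnorm_ge0.
have nu0 : (0 <= nu)%R by rewrite -lee_fin nuE CLnorm_ge0.
have nv0 : (0 <= nv)%R by rewrite -lee_fin nvE CLnorm_ge0.
(* Taking [d <= 1] bounds the norm of [v'] by [nv + 1], so the difference is at most
   [d * C * (nu + nv + 1)]. The final [+ 1] keeps [D] positive when [C = 0] and makes the last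
   inequality strict. *)
pose D := (C * (nu + nv + 1) + 1)%R.
have D0 : (0 < D)%R by rewrite ltr_wpDl// mulr_ge0// addr_ge0// addr_ge0.
pose d : R := Num.min 1%R (e / D)%R.
have d0 : (0 < d)%R by rewrite lt_min ltr01 divr_gt0.
exists d => // u' v' du dv.
have d1 : (d <= 1)%R by rewrite ge_min lexx.
have dD : (d * D <= e)%R by rewrite -ler_pdivlMr// ge_min lexx orbT.
have nv' : CLspace_norm v' <= (1 + nv)%:E.
  apply: le_trans (CLspace_norm_dist v' v p2_ge1) _; rewrite -nvE EFinD.
  by apply: leeD => //; apply: ltW; apply: lt_le_trans dv _; rewrite lee_fin.
apply: le_lt_trans (H u u' v v') _.
apply: (@le_lt_trans _ _ (C%:E * (d%:E * (1 + nv)%:E + nu%:E * d%:E))).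
  apply: lee_wpmul2l; first by rewrite lee_fin.
  apply: leeD; apply: lee_pmul; rewrite ?CLspace_dist_ge0 ?CLnorm_ge0//.
  - exact: ltW.
  - by rewrite nuE.
  - exact: ltW.
rewrite -(EFinM d) -(EFinM nu) -EFinD -EFinM lte_fin; apply: lt_le_trans dD.
by rewrite /D; nra.
Qed.

(** The class of [f] determines its chosen representative only up to a null set. The difference
    estimate with both distances equal to 0 shows that the maximal functions agree almost everywhere
    nonetheless. *)
Lemma S2_extension_schwartz (f : CLfun p1%:E) (g : CLfun p2%:E) :
  schwartz f -> schwartz g -> {ae mu, forall x,
    Im (CLrepr (S2_extension (CLclass f, CLclass g)) x) = 0%R /\
    (Re (CLrepr (S2_extension (CLclass f, CLclass g)) x))%:E = S2 f g x}.
Proof.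
move=> sf sg.
have [C C0 H] := Smax_Lnorm_difference p12 p22 pE.
have m (q : \bar R) (w : CLfun q) := CLfun_cmeasurable w.
pose f' := CLrepr (CLclass f); pose g' := CLrepr (CLclass g).
have zero (q : R) (w : CLfun q%:E) : (1 <= q)%R ->
    CLnorm q%:E (fun x => CLrepr (CLclass w) x - w x)%R = 0.
  move=> q1; rewrite (@CLnorm_ae_eq _ q _ (fun=> 0%R)).
  - rewrite (_ : CLnorm _ _ = 'N[mu]_q%:E[cst 0]); last first.
      by apply: eq_Lnorm => x; rewrite Normc.normc0.
    by rewrite Lnorm0// eqe gt_eqF//; lra.
  - by apply: cmeasurableB; exact: m.
  - by split; exact: measurable_cst.
  - by apply: (ae_mp (CLrepr_class w)) => x ->; rewrite subrr.
have := H f' f g' g (m _ f') (m _ f) (m _ g') (m _ g) (CLfun_finite _) (CLfun_finite _)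
  (CLfun_finite _) (CLfun_finite _).
rewrite (zero _ _ p1_ge1) (zero _ _ p2_ge1) mul0e mule0 adde0 mule0 => N0.
have {}N0 : CLnorm p%:E (fun x => Smax_complex f' g' x - Smax_complex f g x)%R = 0.
  apply/eqP; rewrite eq_le CLnorm_ge0 andbT; apply: le_trans N0.
  by apply: Lnorm_le => // x; rewrite normc_Smax_complexB !abse_EFin normr_id.
have mS (w : CLfun p1%:E) (z : CLfun p2%:E) := cmeasurable_Smax_complex (m _ w) (m _ z).
have N1 := CLnorm_eq0 p_gt0 (cmeasurableB (mS f' g') (mS f g)) N0.
apply: (ae_mp2 (S2_extensionE (CLclass f) (CLclass g)) N1) => x -> /eqP.
rewrite subr_eq0 => /eqP ->; split => //=.
by rewrite schwartz_S2_Smax// fineK// schwartz_Smax_fin_num.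
Qed.

Lemma S2_extension_bounded_extension : S2_bounded_extension S2_extension.
Proof.
split; [exact: S2_extension_continuous|exact: S2_extension_schwartz|].
exact: S2_extension_bounded.
Qed.

Lemma CLspace_dist_sym (q : R) (u v : CLspace q%:E) : CLspace_dist u v = CLspace_dist v u.
Proof. exact: CLnorm_distC. Qed.

Lemma CLspace_dist_triangle (q : R) (u v w : CLspace q%:E) : (1 <= q)%R ->
  CLspace_dist u w <= CLspace_dist u v + CLspace_dist v w.
Proof. by move=> q1; apply: CLnorm_triangle => //; exact: CLfun_cmeasurable. Qed.

Lemma CLspace_dist_eq0 (q : R) (u v : CLspace q%:E) : (1 <= q)%R ->
  (forall e : R, (0 < e)%R -> CLspace_dist u v <= e%:E) -> u = v.
Proof.
move=> q1 H; apply: CLspace_ae_eq.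
have m (w : CLspace q%:E) := CLfun_cmeasurable (CLrepr w).
have z : CLspace_dist u v = 0.
  apply/eqP; rewrite eq_le CLspace_dist_ge0 andbT; apply/lee_addgt0Pr => e e0.
  by rewrite add0e; exact: H.
have := CLnorm_eq0 (lt_le_trans ltr01 q1) (cmeasurableB (m u) (m v)) z.
by move=> /ae_mp; apply => x /eqP; rewrite subr_eq0 => /eqP.
Qed.

Lemma CLspace_dist_class (q : R) (u : CLspace q%:E) (s : CLfun q%:E) :
  CLspace_dist (CLclass s) u = CLnorm q%:E (fun x => s x - CLrepr u x)%R.
Proof.
have m (w : CLfun q%:E) := CLfun_cmeasurable w.
apply: CLnorm_ae_eq; try by apply: cmeasurableB; exact: m.
by apply: (ae_mp (CLrepr_class s)) => x ->.
Qed.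

(** Two continuous maps that agree on a dense set of pairs coincide. Density enters as a hypothesis,
    discharged later by [schwartz_dense]. *)
Lemma bounded_extension_unique (T T' : CLspace p1%:E * CLspace p2%:E -> CLspace p%:E) :
  (forall (q : R) (u : CLspace q%:E) (e : R), (1 <= q)%R -> (0 < e)%R ->
     exists2 s : CLfun q%:E, schwartz s & CLspace_dist (CLclass s) u < e%:E) ->
  S2_bounded_extension T -> S2_bounded_extension T' -> T = T'.
Proof.
move=> dense [cT sT _] [cT' sT' _]; apply/funext => -[u v].
apply: (CLspace_dist_eq0 p_ge1) => e e0.
have e20 : (0 < e / 2)%R by rewrite divr_gt0.
have [d d0 Hd] := cT u v _ e20; have [d' d'0 Hd'] := cT' u v _ e20.
have dd0 : (0 < Num.min d d')%R by rewrite lt_min d0.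
have [s ss su] := dense p1 u _ p1_ge1 dd0.
have [t st tv] := dense p2 v _ p2_ge1 dd0.
have le1 : (Num.min d d')%:E <= d%:E by rewrite lee_fin ge_min lexx.
have le2 : (Num.min d d')%:E <= d'%:E by rewrite lee_fin ge_min lexx orbT.
have E : T (CLclass s, CLclass t) = T' (CLclass s, CLclass t).
  apply: CLspace_ae_eq; apply: (ae_mp2 (sT s t ss st) (sT' s t ss st)) => x.
  move=> [i1 r1] [i2 r2].
  have : (Re (CLrepr (T (CLclass s, CLclass t)) x))%:E =
    (Re (CLrepr (T' (CLclass s, CLclass t)) x))%:E by rewrite r1 r2.
  move: i1 i2; case: (CLrepr _ x) => a b; case: (CLrepr _ x) => a' b' /= -> ->.
  by case=> ->.
apply: le_trans (CLspace_dist_triangle _ (T (CLclass s, CLclass t)) _ p_ge1) _.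
rewrite (splitr e) EFinD; apply: leeD; apply: ltW.
  by rewrite CLspace_dist_sym; apply: Hd; [exact: lt_le_trans su le1|exact: lt_le_trans tv le1].
by rewrite E; apply: Hd'; [exact: lt_le_trans su le2|exact: lt_le_trans tv le2].
Qed.

End bounded_extension.

(** * Concrete Schwartz functions of the form polynomial times exponential *)

Section rapidly_decreasing.
Context {R : realType}.
Implicit Types (h k : R -> R) (p q : {poly R}).

Definition rschwartz h : Prop :=
  (forall n (x : R), derivable (derive1n n h) x 1) /\
  (forall m n, exists M : R, forall x : R, `|x| ^+ m * `|derive1n n h x| <= M).

Lemma schwartz_Complex h k : rschwartz h -> rschwartz k ->
  schwartz (fun x => Complex (h x) (k x)).
Proof.
move=> [dh bh] [dk bk]; split=> [n x|m n]; first by split; [exact: dh|exact: dk].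
have [M HM] := bh m n; have [M' HM'] := bk m n; exists (M + M') => x.
apply: le_trans (lerD (HM x) (HM' x)); rewrite -mulrDr ler_wpM2l ?exprn_ge0//.
exact: normc_le_ReIm.
Qed.

Lemma rschwartzD h k : rschwartz h -> rschwartz k -> rschwartz (fun x => h x + k x).
Proof.
move=> [dh bh] [dk bk].
have E n : derive1n n (fun x => h x + k x) = (fun x => derive1n n h x + derive1n n k x).
  elim: n => [|n IH]; first by rewrite !derive1n0.
  rewrite derive1nS IH; apply/funext => x; rewrite !derive1nS !derive1E.
  by rewrite (@deriveD _ _ _ (derive1n n h) (derive1n n k)).
split=> [n x|m n]; first by rewrite E; apply: derivableD; [exact: dh|exact: dk].
have [M HM] := bh m n; have [M' HM'] := bk m n; exists (M + M') => x.
rewrite E; apply: le_trans (lerD (HM x) (HM' x)); rewrite -mulrDr ler_wpM2l ?exprn_ge0//.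
exact: ler_normD.
Qed.

Lemma rschwartzZ (c : R) h : rschwartz h -> rschwartz (fun x => c * h x).
Proof.
move=> [dh bh].
have E n : derive1n n (fun x => c * h x) = (fun x => c * derive1n n h x).
  elim: n => [|n IH]; first by rewrite !derive1n0.
  rewrite derive1nS IH; apply/funext => x; rewrite !derive1nS !derive1E.
  by rewrite (@deriveZ _ _ _ (derive1n n h) c).
split=> [n x|m n]; first by rewrite E; apply: (@derivableZ _ _ _ (derive1n n h) c); exact: dh.
have [M HM] := bh m n; exists (`|c| * M) => x.
by rewrite E normrM mulrCA ler_wpM2l.
Qed.

(** For fixed [p] this family is stable under differentiation and under multiplication by powers of
    [x], so one boundedness statement yields all the Schwartz seminorms. *)
Definition poly_exp p q (x : R) : R := q.[x] * expR (- p.[x]).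

Lemma is_derive_poly_exp p q (x : R) :
  is_derive x 1 (poly_exp p q) (poly_exp p (q^`() - q * p^`()) x).
Proof.
have dp : is_derive x 1 (horner (- p)) ((- p)^`().[x]) by exact: is_derive_poly.
have de : is_derive x 1 (fun y => expR ((- p).[y])) (expR ((- p).[x]) * (- p)^`().[x]).
  exact: is_derive1_comp.
have dq : is_derive x 1 (horner q) (q^`().[x]) by exact: is_derive_poly.
have -> : poly_exp p q = (horner q * (fun y => expR ((- p).[y])))%R.
  by apply/funext => y; rewrite /poly_exp -hornerN.
apply: is_derive_eq; rewrite /poly_exp -!hornerN derivN !hornerE /GRing.scale/=.
by ring.
Qed.

Lemma derive1n_poly_exp p q n : exists q', derive1n n (poly_exp p q) = poly_exp p q'.
Proof.
elim: n => [|n [q' IH]]; first by exists q.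
exists (q'^`() - q' * p^`()); rewrite derive1nS IH; apply/funext => x.
by rewrite derive1E (@derive_val _ _ _ _ _ _ _ (is_derive_poly_exp p q' x)).
Qed.

(** The exponential factor is at most [e^d * e^(-c x^2)], and a single Taylor term of [e^(c x^2)]
    absorbs each monomial through [|x|^i <= 1 + (x^2)^(i+1)]. *)
Lemma bounded_poly_exp p q (c d : R) : 0 < c -> (forall x, c * x ^+ 2 - d <= p.[x]) ->
  exists M : R, forall x : R, `|poly_exp p q x| <= M.
Proof.
move=> c0 pcd.
have mono i x : `|x| ^+ i * expR (- p.[x]) <= expR d * (1 + i.+1`!%:R / c ^+ i.+1).
  have z0 : 0 <= c * x ^+ 2 by rewrite mulr_ge0 ?sqr_ge0// ltW.
  have h1 : expR (- p.[x]) <= expR d * expR (- (c * x ^+ 2)).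
    by rewrite -expRD ler_expR; move: (pcd x); lra.
  have h2 : `|x| ^+ i <= 1 + (x ^+ 2) ^+ i.+1.
    have [x1|x1] := lerP `|x| 1.
      by apply: le_trans (exprn_ile1 _ (normr_ge0 x) x1) _; rewrite lerDl exprn_ge0// sqr_ge0.
    rewrite -real_normK ?num_real// -exprM; apply: ler_wpDl => //.
    by rewrite ler_weXn2l ?(ltW x1)// mul2n -addnn addSn ltnW// ltnS leq_addr.
  have h3 : (x ^+ 2) ^+ i.+1 <= i.+1`!%:R / c ^+ i.+1 * expR (c * x ^+ 2).
    have f0 : 0 < i.+1`!%:R :> R by rewrite ltr0n fact_gt0.
    have := expR_ge1Dxn i z0; rewrite exprMn => H.
    rewrite mulrAC ler_pdivlMr ?exprn_gt0// mulrC.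
    rewrite -ler_pdivrMl// mulrC; apply: le_trans H; lra.
  apply: le_trans (ler_pM _ _ h2 h1) _; rewrite ?exprn_ge0 ?expR_ge0//.
  rewrite mulrCA ler_wpM2l ?expR_ge0// mulrDl mul1r lerD//.
    by rewrite -expR0 ler_expR oppr_le0.
  apply: le_trans (ler_wpM2r (expR_ge0 _) h3) _.
  by rewrite -[leLHS]mulrA -expRD subrr expR0 mulr1.
exists (\sum_(i < size q) `|q`_i| * (expR d * (1 + i.+1`!%:R / c ^+ i.+1))) => x.
rewrite /poly_exp normrM (ger0_norm (expR_ge0 _)) horner_coef.
apply: le_trans (ler_wpM2r (expR_ge0 _) (ler_norm_sum _ _ _)) _.
rewrite mulr_suml; apply: ler_sum => i _; rewrite normrM normrX -mulrA.
by rewrite ler_wpM2l.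
Qed.

Lemma rschwartz_poly_exp p q (c d : R) : 0 < c -> (forall x, c * x ^+ 2 - d <= p.[x]) ->
  rschwartz (poly_exp p q).
Proof.
move=> c0 pcd; split=> [n x|m n].
  have [q' ->] := derive1n_poly_exp p q n.
  exact: (@ex_derive _ _ _ _ _ _ _ (is_derive_poly_exp p q' x)).
have [q' ->] := derive1n_poly_exp p q n.
have [M HM] := bounded_poly_exp ('X^m * q') c0 pcd; exists M => x.
apply: le_trans (HM x).
have -> : poly_exp p ('X^m * q') x = x ^+ m * poly_exp p q' x.
  by rewrite /poly_exp hornerM hornerXn mulrA.
by rewrite [leRHS]normrM normrX.
Qed.

Lemma rschwartz_gauss (a : R) : 0 < a -> rschwartz (fun x => expR (- (a * x ^+ 2))).
Proof.
move=> a0; have := @rschwartz_poly_exp (a%:P * 'X^2) 1 a 0 a0.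
rewrite (_ : poly_exp _ _ = fun x => expR (- (a * x ^+ 2))); last first.
  by apply/funext => x; rewrite /poly_exp !hornerE ?mul1r.
by apply => x; rewrite !hornerE subr0.
Qed.

Lemma rschwartz0 : rschwartz (fun=> 0).
Proof.
have := rschwartzZ 0 (rschwartz_gauss ltr01).
by rewrite (_ : (fun x => _) = fun=> 0)//; apply/funext => x; rewrite mul0r.
Qed.

(* [exp (- ((x - c) / r) ^ 2n)] tends to the indicator of the interval of centre [c]
   and radius [r], away from its endpoints. *)
Lemma rschwartz_bump (c r : R) (n : nat) : 0 < r ->
  rschwartz (fun x => expR (- ((x - c) / r) ^+ (2 * n.+1))).
Proof.
move=> r0; pose p : {poly R} := (r^-1 *: ('X - c%:P)) ^+ (2 * n.+1).
have pE x : p.[x] = ((x - c) / r) ^+ (2 * n.+1) by rewrite /p horner_exp !hornerE mulrC.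
rewrite (_ : (fun x => _) = poly_exp p 1); last first.
  by apply/funext => x; rewrite /poly_exp pE hornerC mul1r.
have d0 : 0 < 2 * r ^+ 2 by rewrite mulr_gt0// exprn_gt0.
(* The constants come from [y^2 - 1 <= y^(2n+2)] together with [x^2 / 2 <= (x - c)^2 + c^2]. *)
apply: (@rschwartz_poly_exp _ _ ((2 * r ^+ 2)^-1) (c ^+ 2 / r ^+ 2 + 1)).
  by rewrite invr_gt0.
move=> x; rewrite pE exprM; set y := (x - c) / r.
have y2 : y ^+ 2 - 1 <= (y ^+ 2) ^+ n.+1.
  have [y1|y1] := lerP (y ^+ 2) 1.
    by apply: (@le_trans _ _ 0); [rewrite subr_le0|rewrite exprn_ge0// sqr_ge0].
  by apply: (@le_trans _ _ (y ^+ 2)); rewrite ?gerBl// ler_eXnr// ltW.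
apply: le_trans y2; rewrite opprD addrA lerD2r lerBlDr.
rewrite mulrC ler_pdivrMr// /y.
have -> : ((x - c) / r) ^+ 2 + c ^+ 2 / r ^+ 2 = ((x - c) ^+ 2 + c ^+ 2) / r ^+ 2.
  by rewrite expr_div_n mulrDl.
rewrite mulrCA -mulrA mulVf ?gt_eqF ?exprn_gt0// mulr1.
have := sqr_ge0 (x - c - c); rewrite !expr2; nra.
Qed.

End rapidly_decreasing.

Import HBNNSimple.

(** * Density of Schwartz functions in [L^q] *)

Section density.
Context {R : realType}.
Notation mu := (@lebesgue_measure R).
Notation Re := (@complex.Re R).
Notation Im := (@complex.Im R).
Notation normc := (@Normc.normc R).
Variable q : R.
Hypothesis q1 : 1 <= q.
Implicit Types (u v w : R -> R).

Let q0 : 0 < q. Proof. exact: lt_le_trans q1. Qed.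

Lemma rschwartz_measurable u : rschwartz u -> measurable_fun setT u.
Proof.
move=> [du _]; apply: continuous_measurable_fun; apply: derivable_continuous_fun => x.
exact: (du 0%N x).
Qed.

Definition approximable u : Prop := forall e : R, 0 < e ->
  exists2 s, rschwartz s & ('N[mu]_q%:E[(fun x => (u x - s x)%:E)] <= e%:E)%E.

Lemma Lnorm_EFin_le_add u v w : measurable_fun setT v -> measurable_fun setT w ->
  (forall x, `|u x| <= `|v x| + `|w x|) ->
  ('N[mu]_q%:E[(fun x => (u x)%:E)] <= 'N[mu]_q%:E[(fun x => (v x)%:E)] + 'N[mu]_q%:E[(fun x => (w x)%:E)])%E.
Proof.
move=> mv mw H.
have N (z : R -> R) : 'N[mu]_q%:E[(fun x => (z x)%:E)]%E = 'N[mu]_q%:E[(fun x => `|z x|%:E)]%E.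
  by apply/eqP; rewrite eq_le; apply/andP; split; apply: Lnorm_le => // x; rewrite !abse_EFin normr_id.
rewrite (N v) (N w).
have mn (z : R -> R) : measurable_fun setT z -> measurable_fun setT (fun x => `|z x|%:E).
  by move=> mz; apply: measurable_EFin_fun; apply: measurableT_comp.
have pos (z : R -> R) x : (0 <= `|z x|%:E)%E by rewrite lee_fin.
apply: le_trans (Lnorm_add q1 (mn _ mv) (mn _ mw) (pos _) (pos _)).
by apply: Lnorm_le => // x; rewrite /= lee_fin [leRHS]ger0_norm ?addr_ge0.
Qed.

Lemma rschwartz_approximable u : rschwartz u -> approximable u.
Proof.
move=> su e e0; exists u => //.
rewrite LnormE integral0_eq ?poweR0r ?invr_eq0 ?gt_eqF ?lee_fin ?(ltW e0)//.
by move=> x _; rewrite subrr abse0 poweR0r// gt_eqF.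
Qed.

Lemma approximable0 : approximable (fun=> 0).
Proof. exact: rschwartz_approximable rschwartz0. Qed.

Lemma approximableD u v : measurable_fun setT u -> measurable_fun setT v ->
  approximable u -> approximable v -> approximable (fun x => u x + v x).
Proof.
move=> mu_ mv au av e e0; have e20 : 0 < e / 2 by rewrite divr_gt0.
have [s ss Hs] := au _ e20; have [t st Ht] := av _ e20.
exists (fun x => s x + t x); first exact: rschwartzD.
rewrite (splitr e) EFinD; apply: le_trans (leeD Hs Ht).
apply: Lnorm_EFin_le_add.
- by apply: measurable_funB => //; exact: rschwartz_measurable.
- by apply: measurable_funB => //; exact: rschwartz_measurable.
- by move=> x; rewrite opprD addrACA ler_normD.
Qed.

Lemma approximableZ (c : R) u : measurable_fun setT u -> approximable u ->
  approximable (fun x => c * u x).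
Proof.
move=> mu_ au e e0; have d0 : 0 < e / (`|c| + 1) by rewrite divr_gt0// ltr_wpDl.
have [s ss Hs] := au _ d0; exists (fun x => c * s x); first exact: rschwartzZ.
have c0 : 0 <= `|c| + 1 by rewrite addr_ge0.
apply: (@le_trans _ _ ((`|c| + 1)%:E * 'N[mu]_q%:E[(fun x => (u x - s x)%:E)])%E); last first.
  have := lee_wpmul2l (_ : 0 <= (`|c| + 1)%:E)%E Hs; rewrite lee_fin => /(_ c0).
  by rewrite -EFinM mulrCA divff ?mulr1// gt_eqF// ltr_wpDl.
rewrite -LnormZ_EFin//; last first.
  by apply: measurable_EFin_fun; apply: measurable_funB => //; exact: rschwartz_measurable.
apply: Lnorm_le => // x; rewrite -EFinM !abse_EFin lee_fin -mulrBr !normrM.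
by rewrite ler_wpM2r// [leRHS]ger0_norm// lerDl.
Qed.

Lemma cvg_exprS (z : R) : `|z| < 1 -> (fun n => z ^+ n.+1) @ \oo --> (0 : R).
Proof.
move=> z1; have := @cvg_geometric R z z z1.
by rewrite (_ : geometric z z = fun n => z ^+ n.+1)//; apply/funext => n; rewrite exprS.
Qed.

Lemma Lnorm_dominated_cvg (w : nat -> R -> R) (G : R -> \bar R) (e : R) :
  (forall n, measurable_fun setT (w n)) -> {ae mu, forall x, w ^~ x @ \oo --> (0 : R)} ->
  measurable_fun setT G -> (\int[mu]_x G x < +oo)%E ->
  (forall n x, (`|w n x| `^ q)%:E <= G x)%E -> 0 < e ->
  exists n, ('N[mu]_q%:E[(fun x => (w n x)%:E)] <= e%:E)%E.
Proof.
move=> mw w0 mG IG wG e0.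
have G0 x : (0 <= G x)%E by apply: le_trans (wG 0%N x); rewrite lee_fin powR_ge0.
have mf n : measurable_fun setT (fun x => (`|w n x| `^ q)%:E).
  have -> : (fun x => (`|w n x| `^ q)%:E) = (fun x => (`|w n x|%:E `^ q)%E) :> (R -> \bar R).
    by apply/funext => x; rewrite poweR_EFin.
  apply: measurable_poweR_fun; apply: measurable_EFin_fun; exact: measurableT_comp.
have f0 : {ae mu, forall x, setT x -> (`|w n x| `^ q)%:E @[n --> \oo] --> (cst 0%E : R -> \bar R) x}.
  apply: (ae_mp w0) => x wx _; apply: cvg_EFin; first exact: nearW.
  rewrite /=; apply: (@squeeze_cvgr _ _ _ _ (cst 0) (fun n => `|w n x|)).
  (* As soon as [|w n x| < 1], the hypothesis [q >= 1] gives [|w n x|^q <= |w n x|]. *)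
  - have : \forall n \near \oo, `|w n x| < 1.
      by apply: (cvgr_lt `|0 : R|); [exact: cvg_norm|rewrite normr0].
    apply: filterS => n lt1; rewrite powR_ge0/=.
    have [->|w'0] := eqVneq (w n x) 0; first by rewrite normr0 powR0// gt_eqF.
    by apply: ge1r_powR => //; rewrite normr_gt0 w'0 ltW.
  - exact: cvg_cst.
  - by apply/norm_cvg0P.
have iG : mu.-integrable setT G.
  apply/integrableP; split => //; apply: le_lt_trans IG.
  by apply: le_ge0_integral => x _ //; rewrite gee0_abs.
have aG : {ae mu, forall x n, setT x -> (`|(`|w n x| `^ q)%:E| <= G x)%E}.
  by apply: aeW => x n _; rewrite abse_EFin ger0_norm ?powR_ge0.
have [_ _] := @dominated_convergence _ _ _ mu setT measurableT
  (fun n x => (`|w n x| `^ q)%:E) (cst 0%E) G mf (measurable_cst _) f0 iG aG.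
have eq0 : (0 < (e `^ q)%:E)%E by rewrite lte_fin powR_gt0.
rewrite integral0 => /(_ _ (open_ereal_lt' eq0))[N _ /(_ N (leqnn N))/= lt]; exists N.
rewrite LnormE -[e in leRHS](@powRr1 _ e) ?(ltW e0)// -[X in (e `^ X)](@mulfV _ q) ?gt_eqF// powRrM.
rewrite -poweR_EFin; apply: le_poweR; first by rewrite invr_ge0 ltW.
  by apply: integral_ge0 => x _; exact: poweR_ge0.
apply: le_trans (ltW lt); apply: le_ge0_integral => x _; first exact: poweR_ge0.
by rewrite abse_EFin poweR_EFin.
Qed.

(** Closure under dominated almost-everywhere limits, the tool behind each passage: from bumps to
    intervals, then to measurable sets, then to nonnegative functions. *)
Lemma approximable_lim u (v : nat -> R -> R) (G : R -> \bar R) :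
  measurable_fun setT u -> (forall n, measurable_fun setT (v n)) ->
  {ae mu, forall x, v ^~ x @ \oo --> u x} ->
  measurable_fun setT G -> (\int[mu]_x G x < +oo)%E ->
  (forall n x, (`|u x - v n x| `^ q)%:E <= G x)%E ->
  (forall n, approximable (v n)) -> approximable u.
Proof.
move=> mu_ mv vu mG IG uG av e e0; have e20 : 0 < e / 2 by rewrite divr_gt0.
have [n Hn] : exists n, ('N[mu]_q%:E[(fun x => (u x - v n x)%:E)] <= (e / 2)%:E)%E.
  apply: (@Lnorm_dominated_cvg (fun n x => u x - v n x) G) => //.
    by move=> n; exact: measurable_funB.
  apply: (ae_mp vu) => x vx; rewrite -(subrr (u x)).
  by apply: cvgB => //; exact: cvg_cst.
have [s ss Hs] := av n _ e20; exists s => //.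
rewrite (splitr e) EFinD; apply: le_trans (leeD Hn Hs); apply: Lnorm_EFin_le_add.
- exact: measurable_funB.
- by apply: measurable_funB => //; exact: rschwartz_measurable.
- by move=> x; rewrite (le_trans _ (ler_normD _ _))// addrA subrK.
Qed.

Lemma approximable_itv (a b : R) : approximable (\1_`]a, b]).
Proof.
have [ba|ab] := leP b a.
  have -> : \1_`]a, b] = (fun=> 0) :> (R -> R); last exact: approximable0.
  by apply/funext => x; rewrite indicE memNset//= in_itv/= => /andP[h1 h2]; move: ba h1 h2; lra.
pose c := (a + b) / 2; pose r := (b - a) / 2.
have r0 : 0 < r by rewrite divr_gt0// subr_gt0.
pose g (n : nat) (x : R) := expR (- ((x - c) / r) ^+ (2 * n.+1)).
have sg n : rschwartz (g n) by exact: rschwartz_bump.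
(* With [x = c + r * y] one has [1 + x^2 <= (1 + 2 c^2 + 2 r^2) * (1 + y^2)], so the decay in [y]
   becomes the integrable majorant [K / (1 + x^2)]. *)
pose K : R := 2 * (1 + 2 * c ^+ 2 + 2 * r ^+ 2).
have mI : measurable_fun setT (\1_`]a, b] : R -> R) by exact: measurable_indic.
have out x : (x \in `]a, b]%classic) = (a < x <= b) by apply/idP/idP; rewrite inE /= in_itv.
have near0 x : `|(x - c) / r| < 1 -> x \in `]a, b]%classic.
  rewrite normrM normfV (gtr0_norm r0) ltr_pdivrMr// mul1r ltr_norml => /andP[h1 h2].
  by rewrite out; apply/andP; move: h1 h2; rewrite /c /r; split; lra.
have far x : 1 < `|(x - c) / r| -> (x \in `]a, b]%classic) = false.
  rewrite normrM normfV (gtr0_norm r0) ltr_pdivlMr// mul1r lter_normr => /orP h.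
  apply/negP; rewrite out => /andP[]; case: h; rewrite /c /r; lra.
have g01 n x : 0 <= g n x <= 1.
  by rewrite expR_ge0/= -expR0 ler_expR oppr_le0 exprM exprn_ge0// sqr_ge0.
have gfar n x : 1 < `|(x - c) / r| -> g n x <= (1 + (((x - c) / r) ^+ 2) ^+ n.+1)^-1.
  move=> h; rewrite /g expRN exprM lef_pV2 ?posrE ?expR_gt0//; first exact: expR_ge1Dx.
  by rewrite ltr_pwDl// exprn_ge0// sqr_ge0.
have le1 n x : `|\1_`]a, b] x - g n x| <= 1.
  have /andP[g0 g1] := g01 n x; rewrite indicE ler_norml.
  by case: (_ \in _); rewrite /= ?mulr1n ?mulr0n; apply/andP; move: g0 g1; split; lra.
have ends : [set x : R | `|(x - c) / r| = 1] = [set c + r; c - r].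
  apply/seteqP; split => x /=; rewrite normrM normfV (gtr0_norm r0).
    move=> h; have : `|x - c| = r by rewrite -[r in RHS]mul1r -h divfK// gt_eqF.
    by have [_ <-|_ <-] := ger0P (x - c); [left|right]; lra.
  by case=> ->; rewrite addrC addKr ?normrN gtr0_norm// divff// gt_eqF.
apply: (@approximable_lim _ g (fun x => (K / (1 + x ^+ 2))%:E)) => //.
- by move=> n; exact: rschwartz_measurable.
(* The exceptional set consists of the two endpoints, where every bump equals [e^-1]. *)
- exists [set x | `|(x - c) / r| = 1]; split.
  + by rewrite ends; apply: measurableU.
  + by rewrite ends; apply: countable_lebesgue_measure0; exact: finite_set_countable.
  + move=> x /= ncvg; apply: contrapT => /eqP neq; apply: ncvg.
    set y := (x - c) / r in neq.
    have [y1|y1|y1] := ltgtP `|y| 1; last by rewrite y1 eqxx in neq.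
      rewrite indicE near0//= /g -/y -expR0 -oppr0.
      apply: continuous_cvg; first exact: continuous_expR.
      apply: cvgN; under eq_fun do rewrite exprM.
      apply: cvg_exprS.
      by rewrite ger0_norm ?sqr_ge0// -real_normK ?num_real// expr_lt1.
    rewrite indicE far//=.
    apply: (@squeeze_cvgr _ _ _ _ (cst 0) (fun n => ((y ^+ 2)^-1) ^+ n.+1)).
    + apply: nearW => n; have /andP[-> _] /= := g01 n x.
      apply: le_trans (gfar n x y1) _; rewrite -/y exprVn lef_pV2 ?posrE.
      * by rewrite lerDr.
      * by rewrite ltr_pwDl// exprn_ge0// sqr_ge0.
      * by rewrite exprn_gt0// -real_normK ?num_real// exprn_gt0// (lt_trans ltr01).
    + exact: cvg_cst.
    + apply: cvg_exprS.
      rewrite ger0_norm ?invr_ge0 ?sqr_ge0// invf_lt1 -real_normK ?num_real//.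
        by rewrite expr_gt1.
      by rewrite exprn_gt0// (lt_trans ltr01).
- apply: measurable_EFin_fun; apply: continuous_measurable_fun => x.
  by apply: cvgM; [exact: cvg_cst|exact: (@continuous_oneDsqrV R)].
- under eq_integral do rewrite EFinM.
  rewrite ge0_integralZl//.
  + rewrite lte_mul_pinfty// ?integral_oneDsqrV_lty// lee_fin /K.
    by have := sqr_ge0 c; have := sqr_ge0 r; lra.
  + by apply: measurable_EFin_fun; apply: continuous_measurable_fun; exact: (@continuous_oneDsqrV R).
  + by move=> x _; rewrite lee_fin invr_ge0 addr_ge0// sqr_ge0.
  + by rewrite lee_fin /K; have := sqr_ge0 c; have := sqr_ge0 r; lra.
- move=> n x; rewrite lee_fin.
  set y := (x - c) / r; have xE : x = c + r * y by rewrite /y mulrC divfK ?gt_eqF// addrC subrK.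
  have y20 : 0 <= y ^+ 2 by exact: sqr_ge0.
  have KK : 2 / (1 + y ^+ 2) <= K / (1 + x ^+ 2).
    rewrite ler_pdivrMr ?ltr_pwDl// mulrAC ler_pdivlMr ?ltr_pwDl ?sqr_ge0//.
    rewrite /K -mulrA ler_pM2l// xE; have := sqr_ge0 (c - r * y).
    have := sqr_ge0 c; have := sqr_ge0 r; move: y20; rewrite !expr2; nra.
  apply: le_trans KK; apply: (@le_trans _ _ `|\1_`]a, b] x - g n x|).
    have [->|w0] := eqVneq (\1_`]a, b] x - g n x) 0; first by rewrite normr0 powR0 ?gt_eqF.
    by apply: ge1r_powR => //; rewrite normr_gt0 w0 le1.
  have [y1|y1] := lerP `|y| 1.
    apply: le_trans (le1 n x) _; rewrite ler_pdivlMr ?ltr_pwDl// mul1r.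
    have : `|y| ^+ 2 <= 1 by rewrite expr_le1.
    by rewrite real_normK ?num_real//; lra.
  rewrite indicE far// sub0r normrN ger0_norm; last by have /andP[] := g01 n x.
  apply: le_trans (gfar n x y1) _; rewrite -/y.
  have y21 : 1 <= y ^+ 2.
    by rewrite -real_normK ?num_real// expr_ge1// ltW.
  have p1 : 0 < 1 + y ^+ 2 by lra.
  have p2 : 0 < 1 + (y ^+ 2) ^+ n.+1 by rewrite ltr_pwDl// exprn_ge0.
  apply: (@le_trans _ _ (1 + y ^+ 2)^-1); first by rewrite lef_pV2 ?posrE// lerD2l ler_eXnr.
  by rewrite ler_peMl ?ler1n// invr_ge0 ltW.
- by move=> n; exact: rschwartz_approximable.
Qed.

(** Dynkin's argument: the sets whose part inside the bounded interval is approximable form a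
    lambda-system that contains the half-open intervals, which are stable under intersection. The
    bounded interval supplies an integrable majorant for increasing unions. *)
Lemma approximable_indic (A : set (measurableTypeR R)) (N : nat) : measurable A ->
  approximable (\1_(A `&` `]- N%:R, N%:R])).
Proof.
pose I : set R := `](- N%:R : R), N%:R]%classic.
pose H : set (set R) := [set B | measurable (B : set (measurableTypeR R)) /\ approximable (\1_(B `&` I))].
have mI : measurable (I : set (measurableTypeR R)) by exact: measurable_itv.
have muI : (mu (I : set R) < +oo)%E.
  by rewrite lebesgue_measure_itv/=; case: ifP => // _; rewrite -EFinB ltry.
have mind (B : set R) : measurable (B : set (measurableTypeR R)) -> measurable_fun setT (\1_(B `&` I) : R -> R).
  by move=> mB; apply: measurable_indic; exact: measurableI.
have DH : lambda_system setT H.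
  split=> //.
  - split; first exact: measurableT.
    by rewrite setTI; exact: approximable_itv.
  - move=> B C CB [mB aB] [mC aC]; split; first exact: measurableD.
    have -> : \1_((B `\` C) `&` I) = (fun x => \1_(B `&` I) x + -1 * \1_(C `&` I) x) :> (R -> R).
      apply/funext => x; rewrite !indicE mulN1r.
      have [/set_mem Cx|/negP nCx] := boolP (x \in C).
        have Bx := CB _ Cx; have [/set_mem Ix|/negP nIx] := boolP (x \in I).
          by rewrite memNset ?mem_set ?subrr//= => -[[]].
        by rewrite !memNset ?subr0// => -[_ Ix]; apply: nIx; rewrite inE.
      rewrite [x \in C `&` I]memNset ?subr0; last by move=> [Cx _]; apply: nCx; rewrite inE.
      congr (nat_of_bool _)%:R; apply/idP/idP; rewrite !inE => -[]; first by case.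
      by move=> Bx Ix; split => //; split => // Cx; apply: nCx; rewrite inE.
    apply: approximableD => //; [exact: mind| |exact: approximableZ (mind _ mC) aC].
    by apply: measurable_funM => //; exact: mind.
  - move=> F ndF HF; have mF n := (HF n).1.
    have mU : measurable (\bigcup_n F n : set (measurableTypeR R)) by exact: bigcup_measurable.
    split=> //.
    apply: (@approximable_lim _ (fun n => \1_(F n `&` I)) (fun x => (\1_I x)%:E)).
    + exact: mind.
    + by move=> n; exact: mind.
    + apply: aeW => x.
      have [/set_mem Ix|/negP nIx] := boolP (x \in I); last first.
        rewrite indicE memNset; last by move=> [_ Ix]; apply: nIx; rewrite inE.
        apply: cvg_near_cst; apply: nearW => m; rewrite indicE memNset//.
        by move=> [_ Ix]; apply: nIx; rewrite inE.
      have [[n _ Fnx]|nFx] := pselect ((\bigcup_n F n) x).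
        rewrite indicE mem_set; last by split => //; exists n.
        apply: cvg_near_cst; exists n => // m /= nm; rewrite indicE mem_set//; split => //.
        by have /subsetPset := ndF _ _ nm; exact.
      rewrite indicE memNset; last by case.
      apply: cvg_near_cst; exists 0%N => // m _ /=; rewrite indicE memNset// => -[Fx _].
      by apply: nFx; exists m.
    + by apply: measurable_EFin_fun; exact: measurable_indic.
    + by rewrite integral_indic// setIT.
    + move=> n x; rewrite lee_fin !indicE.
      have [/set_mem Ix|/negP nIx] := boolP (x \in I).
        have H01 (b c : bool) : `|b%:R - c%:R : R| `^ q <= 1.
          apply: (@le_trans _ _ (1 `^ q)); last by rewrite powR1.
          apply: ge0_ler_powR; rewrite ?nnegrE ?(ltW q0)//.
          by case: b; case: c; rewrite /= ?subrr ?subr0 ?sub0r ?normrN ?normr0 ?normr1.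
        exact: H01.
      have nI (B : set R) : (x \in B `&` I) = false.
        by apply: memNset => -[_ Ix]; apply: nIx; rewrite inE.
      by rewrite !nI subrr normr0 powR0 ?gt_eqF.
    + by move=> n; exact: (HF n).2.
have GH : @ocitv R `<=` H.
  move=> _ [[a b] _ <-]; split; first exact: measurable_itv.
  have -> : `]a, b]%classic `&` I = `]Num.max a (- N%:R), Num.min b N%:R]%classic.
    apply/seteqP; split => x; rewrite /I /= !in_itv/= gt_max le_min.
      by move=> [/andP[-> ->] /andP[-> ->]].
    by move=> /andP[/andP[-> ->] /andP[-> ->]].
  exact: approximable_itv.
move=> mA; apply: (lambda_system_subset (@ocitvI R) DH GH _ mA).2 => //.
Qed.

Lemma approximable_sum (I : Type) (r : seq I) (F : I -> R -> R) :
  (forall i, measurable_fun setT (F i)) -> (forall i, approximable (F i)) ->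
  approximable (fun x => \sum_(i <- r) F i x).
Proof.
move=> mF aF; elim: r => [|i r IH].
  by under eq_fun do rewrite big_nil; exact: approximable0.
under eq_fun do rewrite big_cons; apply: approximableD => //.
exact: measurable_sum.
Qed.

(** Increasing simple functions, cut off to [(-n, n]], converge to [u] and are dominated by it. The
    cut-off reduces each level set to the bounded case of [approximable_indic]. *)
Lemma approximable_ge0 u : measurable_fun setT u -> (forall x, 0 <= u x) ->
  ('N[mu]_q%:E[(fun x => (u x)%:E)] < +oo)%E -> approximable u.
Proof.
move=> mu_ u0 Nu.
pose mE := measurable_EFin_fun mu_.
pose phi n := nnsfun_approx (@measurableT _ (measurableTypeR R)) mE n.
pose I (n : nat) : set R := `](- n%:R : R), n%:R]%classic.
have mI n : measurable (I n : set (measurableTypeR R)) by exact: measurable_itv.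
have mv n : measurable_fun setT (fun x => phi n x * \1_(I n) x).
  by apply: measurable_funM => //; exact: measurable_indic.
have phi_le n x : phi n x <= u x.
  by rewrite -lee_fin /phi nnsfun_approxE; apply: le_approx => // y _; rewrite lee_fin.
apply: (@approximable_lim _ (fun n x => phi n x * \1_(I n) x) (fun x => (`|u x|%:E `^ q)%E)) => //.
- apply: aeW => x.
  have cphi : phi n x @[n --> \oo] --> u x.
    have := @cvg_nnsfun_approx _ _ _ _ (@measurableT _ (measurableTypeR R)) _ mE
      (fun x _ => u0 x) x Logic.I.
    by move=> /fine_cvgP[].
  rewrite -[X in _ --> X]mulr1; apply: cvgM => //; apply: cvg_near_cst.
  near=> n; rewrite indicE mem_set// /I /= in_itv/=.
  have : `|x| < n%:R by near: n; exact: nbhs_infty_gtr.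
  by rewrite ltr_norml => /andP[-> /ltW ->].
- by apply: measurable_poweR_fun; apply: measurable_EFin_fun; exact: measurableT_comp.
- move: Nu; rewrite LnormE => Nu; rewrite ltNge; apply/negP; rewrite leye_eq => /eqP E.
  have {}E : (\int[mu]_x `|(u x)%:E| `^ q = +oo)%E by exact: E.
  by move: Nu; rewrite E poweRyr ?invr_eq0 ?gt_eqF// ltxx.
- move=> n x; rewrite poweR_EFin lee_fin; apply: ge0_ler_powR; rewrite ?nnegrE ?(ltW q0)//.
  have p0 : 0 <= phi n x by exact: fun_ge0.
  have := phi_le n x; rewrite (ger0_norm (u0 x)) indicE.
  by case: (_ \in _); rewrite /= ?mulr1n ?mulr0n ?mulr0 ?mulr1 ?subr0 => h;
    rewrite ger0_norm ?subr_ge0//; lra.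
- move=> n.
  have -> : (fun x => phi n x * \1_(I n) x) = (fun x =>
      \sum_(r <- finmap.enum_fset (fset_set (range (phi n)))) r * \1_((phi n @^-1` [set r]) `&` I n) x).
    apply/funext => x; rewrite fimfunE fsbig_finite//= mulr_suml; apply: eq_bigr => r _.
    by rewrite indicI -mulrA.
  have mA r : measurable (phi n @^-1` [set r] : set (measurableTypeR R)).
    rewrite -[X in measurable X]setTI.
    exact: (@measurable_funPT _ _ _ _ (phi n) measurableT _ (measurable_set1 r)).
  have m r : measurable_fun setT (\1_((phi n @^-1` [set r]) `&` I n) : R -> R).
    by apply: measurable_indic; exact: (measurableI _ _ (mA r) (mI n)).
  apply: approximable_sum => r; first by apply: measurable_funM => //.
  by apply: approximableZ => //; apply: approximable_indic; exact: mA.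
Unshelve. all: by end_near.
Qed.

Lemma approximable_Lnorm_lty u : measurable_fun setT u ->
  ('N[mu]_q%:E[(fun x => (u x)%:E)] < +oo)%E -> approximable u.
Proof.
move=> mu_ Nu.
have -> : u = (fun x => Num.max (u x) 0 + -1 * Num.max (- u x) 0).
  by apply/funext => x; rewrite mulN1r; have [h|h] := ltP (u x) 0;
    rewrite ?oppr_lt0 ?oppr_gt0; case: (ltgtP (- u x) 0) => h'; lra.
have m1 : measurable_fun setT (fun x => Num.max (u x) 0) by exact: measurable_maxr.
have m2 : measurable_fun setT (fun x => Num.max (- u x) 0).
  by apply: measurable_maxr => //; exact: measurableT_comp.
have bd (v : R -> R) : (forall x, `|v x| <= `|u x|) ->
    ('N[mu]_q%:E[(fun x => (v x)%:E)] < +oo)%E.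
  by move=> h; apply: le_lt_trans Nu; apply: Lnorm_le => // x; rewrite !abse_EFin lee_fin.
apply: approximableD => //.
- by apply: measurable_funM.
- apply: approximable_ge0 => //; first by move=> x; rewrite le_max lexx orbT.
  by apply: bd => x; have [h|h] := ltP (u x) 0; rewrite ?normr0.
- apply: approximableZ => //; apply: approximable_ge0 => //.
    by move=> x; rewrite le_max lexx orbT.
  by apply: bd => x; have [h|h] := ltP (- u x) 0; rewrite ?normr0 ?normrN.
Qed.

Lemma schwartz_dense (u : CLspace q%:E) (e : R) : 0 < e ->
  exists2 s : CLfun q%:E, schwartz s & (CLspace_dist (CLclass s) u < e%:E)%E.
Proof.
(* A quarter for each of the real and imaginary parts leaves the room needed for the strict
   inequality. *)
move=> e0; have e40 : 0 < e / 4 by rewrite divr_gt0.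
pose f := CLrepr u; have [m1 m2] := CLfun_cmeasurable f.
have Nf : (CLnorm q%:E f < +oo)%E := CLfun_finite f.
have [s1 ss1 H1] : exists2 s, rschwartz s &
    ('N[mu]_q%:E[(fun x => (Re (f x) - s x)%:E)] <= (e / 4)%:E)%E.
  apply: (@approximable_Lnorm_lty (Re \o f)) => //; apply: le_lt_trans Nf.
  by apply: Lnorm_le => // x; rewrite !abse_EFin lee_fin [leRHS]ger0_norm ?normc_ge0// Re_le_normc.
have [s2 ss2 H2] : exists2 s, rschwartz s &
    ('N[mu]_q%:E[(fun x => (Im (f x) - s x)%:E)] <= (e / 4)%:E)%E.
  apply: (@approximable_Lnorm_lty (Im \o f)) => //; apply: le_lt_trans Nf.
  by apply: Lnorm_le => // x; rewrite !abse_EFin lee_fin [leRHS]ger0_norm ?normc_ge0// Im_le_normc.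
have ss := schwartz_Complex ss1 ss2; have ms := schwartz_cmeasurable ss.
exists (MkCLfun ms.1 ms.2 (schwartz_CLnorm_lty q1 ss)) => //.
rewrite CLspace_dist_class /=.
apply: (@le_lt_trans _ _ (e / 4 + e / 4)%:E); last by rewrite lte_fin; lra.
rewrite EFinD; apply: le_trans (leeD H1 H2); apply: Lnorm_EFin_le_add.
- by apply: measurable_funB => //; exact: rschwartz_measurable.
- by apply: measurable_funB => //; exact: rschwartz_measurable.
- move=> x; rewrite ger0_norm ?normc_ge0//; apply: le_trans (normc_le_ReIm _) _.
  rewrite -/f; case: (f x) => a b /=; rewrite [in leRHS]distrC [X in _ <= _ + X]distrC.
  by [].
Qed.

End density.

(** * Unboundedness when an exponent is at most 2 *)

Section counterexample.
Context {R : realType}.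
Notation mu := (@lebesgue_measure R).
Notation Re := (@complex.Re R).
Notation Im := (@complex.Im R).
Notation normc := (@Normc.normc R).
Implicit Types (b : bool) (f g : R -> R).

(* [b] tells which of the two slots of [S2] carries the function that defeats boundedness. *)
Definition coord b (y : R * R) : R := if b then y.1 else y.2.

(** For nonnegative real functions the average is this integral itself; keeping it extended-valued
    allows lower bounds by monotonicity. *)
Definition arc_avg b f g (t x : R) : \bar R :=
  (\int[@arclength R]_(y in @unit_circle R)
     (f (x - t * coord b y) * g (x - t * coord (~~ b) y))%:E)%E.

Definition real_fun f (x : R) : R[i] := Complex (f x) 0.

Lemma schwartz_real_fun f : rschwartz f -> schwartz (real_fun f).
Proof. by move=> sf; apply: schwartz_Complex => //; exact: rschwartz0. Qed.

Lemma normc_real_fun f x : 0 <= f x -> normc (real_fun f x) = f x.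
Proof. by move=> f0; rewrite normcE /= expr0n/= addr0 sqrtr_sqr ger0_norm. Qed.

Lemma measurable_coord b : measurable_fun setT (coord b).
Proof. by case: b; [exact: measurable_fst|exact: measurable_snd]. Qed.

Lemma measurable_arc b f g (t x : R) : measurable_fun setT f -> measurable_fun setT g ->
  measurable_fun setT (fun y : R * R => f (x - t * coord b y) * g (x - t * coord (~~ b) y)).
Proof.
move=> mf mg.
have ml c : measurable_fun setT (fun y : R * R => x - t * coord c y).
  apply: measurable_funB => //; apply: measurable_funM => //; exact: measurable_coord.
apply: measurable_funM.
  exact: (measurableT_comp mf (ml b)).
exact: (measurableT_comp mg (ml (~~ b))).
Qed.

(** The integrand is bounded, so its integral over the circle is finite and [fine] in the
    real-valued integral loses nothing. *)
Lemma arc_avg_le_S2 b f g (t x : R) : rschwartz f -> rschwartz g ->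
  (forall y, 0 <= f y) -> (forall y, 0 <= g y) -> 0 < t ->
  (arc_avg b f g t x <= S2 (if b then real_fun f else real_fun g)
                           (if b then real_fun g else real_fun f) x)%E.
Proof.
move=> sf sg f0 g0 t0.
have mf := rschwartz_measurable sf; have mg := rschwartz_measurable sg.
set F := if b then _ else _; set G := if b then _ else _.
pose h (y : R * R) := f (x - t * coord b y) * g (x - t * coord (~~ b) y).
have hE y : Re (F (x - t * y.1) * G (x - t * y.2)) = h y.
  by rewrite /F /G /h; case: (b) => /=; rewrite mulr0 subr0// mulrC.
have [M1 _ H1] := schwartz_bound 0 (schwartz_real_fun sf).
have [M2 _ H2] := schwartz_bound 0 (schwartz_real_fun sg).
have bnd y : `|h y| <= M1 * M2.
  rewrite normrM ler_pM//.
    by have := H1 (x - t * coord b y); rewrite expr0 mul1r; apply: le_trans; exact: (Re_le_normc (real_fun f _)).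
  by have := H2 (x - t * coord (~~ b) y); rewrite expr0 mul1r; apply: le_trans; exact: (Re_le_normc (real_fun g _)).
have ih := arclength_integrable_bounded (measurable_arc b t x mf mg) bnd.
apply: (@le_trans _ _ (normc (circle_avg F G t x))%:E); last first.
  by apply: ereal_sup_ubound; exists t.
have -> : arc_avg b f g t x = (Re (circle_avg F G t x))%:E.
  rewrite /circle_avg /Cintegral /= /Rintegral fineK.
    by apply: eq_integral => y _; rewrite hE.
  under eq_integral do rewrite hE.
  exact: (integrable_fin_num measurable_unit_circle ih).
by rewrite lee_fin; apply: le_trans (Re_le_normc _); rewrite ler_norm.
Qed.

Lemma arc_avg_ge b f g (t x k a c : R) : measurable_fun setT f -> measurable_fun setT g ->
  (forall y, 0 <= f y) -> (forall y, 0 <= g y) -> 0 <= k -> 0 <= a -> a <= c -> c <= 2 * pi ->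
  (forall s, a <= s <= c ->
    k <= f (x - t * coord b (cos s, sin s)) * g (x - t * coord (~~ b) (cos s, sin s))) ->
  (((2 * pi)^-1 * (k * (c - a)))%:E <= arc_avg b f g t x)%E.
Proof.
move=> mf mg f0 g0 k0 a0 ac c2 H.
pose h (y : R * R) := (f (x - t * coord b y) * g (x - t * coord (~~ b) y))%:E.
have mh : measurable_fun setT h by apply: measurable_EFin_fun; exact: measurable_arc.
have h0 y : (0 <= h y)%E by rewrite lee_fin mulr_ge0.
rewrite /arc_avg (ge0_integral_arclength mh h0) EFinM.
apply: lee_wpmul2l; first by rewrite lee_fin invr_ge0 mulr_ge0// pi_ge0.
have muI : mu `[a, c]%classic = (c - a)%:E.
  rewrite lebesgue_measure_itv/= lte_fin; case: ltP => // ca.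
  have cE : c = a by apply/eqP; rewrite eq_le ca.
  by rewrite cE subrr.
have <- : (\int[mu]_(s in `[a, c]) k%:E = (k * (c - a))%:E)%E.
  by rewrite EFinM -muI; exact: integral_cst.
have mcs : measurable_fun setT (fun s : R => h (cos s, sin s)).
  by apply: measurableT_comp mh _; exact: measurable_circle_map.
apply: (@le_trans _ _ (\int[mu]_(s in `[a, c]) h (cos s, sin s))%E).
  apply: le_ge0_integral => s /=; rewrite in_itv/= => sI; first by rewrite lee_fin.
  by rewrite lee_fin; exact: H.
apply: ge0_subset_integral => //.
- exact: measurable_funTS.
- move=> s; rewrite /= !in_itv/= => /andP[h1 h2].
  by rewrite (le_trans a0 h1) (le_trans h2 c2).
Qed.

Lemma one_sub_cos (s : R) : 0 <= s -> 0 <= 1 - cos s <= s ^+ 2 / 2.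
Proof.
move=> s0; have -> : cos s = 1 - 2 * sin (s / 2) ^+ 2.
  by rewrite [in LHS](splitr s) cosD -!expr2 cos2sin2; ring.
have h := sin_le_id (_ : 0 <= s / 2).
have {}h : sin (s / 2) ^+ 2 <= (s / 2) ^+ 2.
  by rewrite -real_normK ?num_real// lerXn2r ?nnegrE ?divr_ge0// h ?divr_ge0.
have := sqr_ge0 (sin (s / 2)); move: h; rewrite expr_div_n; set z := sin _ ^+ 2.
by set w := s ^+ 2 => h1 h2; apply/andP; split; lra.
Qed.

Definition gauss1 (y : R) : R := expR (- (1 * y ^+ 2)).

Definition bump (k : nat) (y : R) : R := 2 ^+ k * expR (- (16 ^+ k * y ^+ 2)).

Definition bump_sum (N : nat) (y : R) : R := \sum_(k < N) bump k y.

Lemma bump_ge0 k y : 0 <= bump k y.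
Proof. by rewrite mulr_ge0 ?expR_ge0// exprn_ge0. Qed.

Lemma bump_sum_ge0 N y : 0 <= bump_sum N y.
Proof. by apply: sumr_ge0 => k _; exact: bump_ge0. Qed.

Lemma rschwartz_bump_scaled k : rschwartz (bump k).
Proof. by apply: rschwartzZ; apply: rschwartz_gauss; rewrite exprn_gt0. Qed.

Lemma rschwartz_bump_sum N : rschwartz (bump_sum N).
Proof.
elim: N => [|N IH].
  rewrite (_ : bump_sum 0 = fun=> 0); first exact: rschwartz0.
  by apply/funext => y; rewrite /bump_sum big_ord0.
rewrite (_ : bump_sum N.+1 = fun y => bump_sum N y + bump N y); last first.
  by apply/funext => y; rewrite /bump_sum big_ord_recr.
by apply: rschwartzD => //; exact: rschwartz_bump_scaled.
Qed.

(* On the arc of length [2 ^- k] around the direction in which [x - x * coord b y] vanishes,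
   that quantity is at most [4 ^- k]. *)
Lemma arc_avg_bump b k (x : R) : 1 <= x <= 2 ->
  ((expR (- 17) / (2 * pi))%:E <= arc_avg b (bump k) gauss1 x x)%E.
Proof.
move=> /andP[x1 x2]; pose d : R := (2 ^+ k)^-1.
have d0 : 0 < d by rewrite invr_gt0 exprn_gt0.
have d1 : d <= 1 by rewrite invf_le1 ?exprn_gt0// exprn_ege1// ler1n.
have pi2 := pi_ge2 R.
have mb := rschwartz_measurable (rschwartz_bump_scaled k).
have mg : measurable_fun setT gauss1 by apply: rschwartz_measurable; exact: rschwartz_gauss.
have g0 y : 0 <= gauss1 y by exact: expR_ge0.
have key s t : 0 <= s <= d -> `|t| <= 1 ->
    2 ^+ k * expR (- 17) <= bump k (x - x * cos s) * gauss1 (x - x * t).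
  move=> /andP[s0 sd] t1; rewrite /bump -mulrA ler_wpM2l ?exprn_ge0//.
  rewrite /gauss1 mul1r -expRD ler_expR -opprD lerN2.
  (* The bump contributes at most 1 to the exponent, because [16^k * (4^-k)^2 = 1]; the Gaussian
     contributes at most [4^2], because [|x - x * t| <= 4]. *)
  have -> : (17 : R) = 1 + 16 by ring.
  apply: lerD.
    have /andP[c0 c1] := one_sub_cos s0.
    have h : 0 <= x * (1 - cos s) <= s ^+ 2.
      rewrite mulr_ge0//=; last by lra.
      apply: (@le_trans _ _ (2 * (s ^+ 2 / 2))); last by rewrite mulrCA divff ?mulr1.
      by rewrite ler_pM//; lra.
    have -> : x - x * cos s = x * (1 - cos s) by ring.
    have -> : (16 : R) = 2 ^+ 4 by ring.
    rewrite exprAC -exprM.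
    apply: (@le_trans _ _ ((2 ^+ k) ^+ 4 * (d ^+ 2) ^+ 2)); last first.
      have -> : (2 ^+ k) ^+ 4 * (d ^+ 2) ^+ 2 = (2 ^+ k * d) ^+ 4 by ring.
      by rewrite divff ?expr1n// expf_neq0.
    rewrite -exprM mulnC exprM -/d ler_wpM2l ?exprn_ge0//.
    have /andP[h0 h1] := h; rewrite lerXn2r ?nnegrE ?exprn_ge0 ?(ltW d0)//.
    by apply: le_trans h1 _; rewrite lerXn2r ?nnegrE ?(ltW d0).
  have : `|x - x * t| <= 4.
    have -> : (4 : R) = 2 + 2 * 1 by ring.
    apply: le_trans (ler_normB _ _) _; rewrite normrM (ger0_norm (_ : 0 <= x)); last by lra.
    by apply: lerD => //; apply: ler_pM => //; lra.
  rewrite -[(x - _) ^+ 2]real_normK ?num_real// => h.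
  by rewrite expr2; have := normr_ge0 (x - x * t); move: h; nra.
have sc (s : R) : `|sin s| <= 1 by rewrite ler_norml sin_geN1 sin_le1.
have cc (s : R) : `|cos s| <= 1 by rewrite ler_norml cos_geN1 cos_le1.
(* Height [2^k] times arc length [d = 2^-k] is 1, so the contribution does not depend on [k]. *)
have -> : expR (- 17) / (2 * pi) = (2 * pi)^-1 * (2 ^+ k * expR (- 17) * d).
  by rewrite mulrAC -mulrA mulVKf ?expf_neq0// mulrC.
have k0 : 0 <= 2 ^+ k * expR (- 17) :> R by rewrite mulr_ge0 ?expR_ge0 ?exprn_ge0.
have arc a c : c - a = d -> 0 <= a -> c <= 2 * pi -> (forall s, a <= s <= c ->
    2 ^+ k * expR (- 17) <= bump k (x - x * coord b (cos s, sin s)) *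
      gauss1 (x - x * coord (~~ b) (cos s, sin s))) ->
    (((2 * pi)^-1 * (2 ^+ k * expR (- 17) * d))%:E <= arc_avg b (bump k) gauss1 x x)%E.
  move=> acd a0 c2 H; rewrite -acd; apply: arc_avg_ge => //; first exact: bump_ge0.
  by rewrite -subr_ge0 acd ltW.
clearbody d; case: b arc => arc.
  apply: (arc 0 d) => //; [by rewrite subr0|by lra|].
  by move=> s sd /=; exact: key.
(* For the second coordinate the relevant pole is [pi / 2], and [sin s = cos (pi / 2 - s)] reduces
   to the first case. *)
apply: (arc (pi / 2 - d) (pi / 2)); [by ring|by lra|by lra|].
move=> s /andP[s1 s2] /=; have -> : sin s = cos (pi / 2 - s) by rewrite -cosBpihalf -cosN opprB.
apply: key => //.
by apply/andP; split; lra.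
Qed.

Lemma arc_avg_bump_sum b N (x : R) : 1 <= x <= 2 ->
  ((N%:R * (expR (- 17) / (2 * pi)))%:E <= arc_avg b (bump_sum N) gauss1 x x)%E.
Proof.
move=> x12.
have mg : measurable_fun setT gauss1 by apply: rschwartz_measurable; exact: rschwartz_gauss.
have g0 y : 0 <= gauss1 y by exact: expR_ge0.
elim: N => [|N IH].
  by rewrite mul0r; apply: integral_ge0 => y _; rewrite lee_fin mulr_ge0// bump_sum_ge0.
rewrite -natr1 mulrDl mul1r EFinD; apply: le_trans (leeD IH (arc_avg_bump b N x12)) _.
rewrite /arc_avg -ge0_integralD//.
- apply: le_ge0_integral => y _.
    by rewrite -EFinD lee_fin addr_ge0// mulr_ge0// ?bump_ge0// bump_sum_ge0.
  by rewrite -EFinD lee_fin -mulrDl /bump_sum big_ord_recr.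
- exact: measurable_unit_circle.
- by move=> y _; rewrite lee_fin mulr_ge0// bump_sum_ge0.
- apply: measurable_funTS; apply: measurable_EFin_fun; apply: measurable_arc => //.
  exact: rschwartz_measurable (rschwartz_bump_sum N).
- by move=> y _; rewrite lee_fin mulr_ge0// bump_ge0.
- apply: measurable_funTS; apply: measurable_EFin_fun; apply: measurable_arc => //.
  exact: rschwartz_measurable (rschwartz_bump_scaled N).
Qed.

Lemma bump_sum_lt N y : bump_sum N y <= 2 ^+ N.
Proof.
elim: N => [|N IH]; first by rewrite /bump_sum big_ord0.
rewrite /bump_sum big_ord_recr/= exprS mulr_natl mulr2n; apply: lerD => //.
rewrite /bump -[leRHS]mulr1 ler_wpM2l ?exprn_ge0// -expR0 ler_expR oppr_le0.
by rewrite mulr_ge0 ?sqr_ge0// exprn_ge0.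
Qed.

(* The cross terms of [bump_sum N ^+ 2] are dominated because [bump_sum k <= 2 ^+ k]. *)
Lemma bump_sum_sqr N y :
  bump_sum N y ^+ 2 <= \sum_(k < N) 3 * (4 ^+ k * expR (- (4 ^+ k * y) ^+ 2)).
Proof.
elim: N => [|N IH]; first by rewrite /bump_sum !big_ord0 expr0n.
have E : 2 ^+ N * bump N y = 4 ^+ N * expR (- (4 ^+ N * y) ^+ 2).
  have E4 : (4 : R) ^+ N = 2 ^+ N * 2 ^+ N by rewrite -exprMn; congr (_ ^+ _); ring.
  have E16 : (16 : R) ^+ N = 4 ^+ N * 4 ^+ N by rewrite -exprMn; congr (_ ^+ _); ring.
  by rewrite /bump mulrA -E4 E16 exprMn [(4 ^+ N) ^+ 2]expr2.
have hs := bump_sum_lt N y; have hs0 := bump_sum_ge0 N y; have hb0 := bump_ge0 N y.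
have hb : bump N y <= 2 ^+ N.
  rewrite /bump -[leRHS]mulr1 ler_wpM2l ?exprn_ge0// -expR0 ler_expR oppr_le0.
  by rewrite mulr_ge0 ?sqr_ge0// exprn_ge0.
rewrite big_ord_recr/= -E.
have -> : bump_sum N.+1 y = bump_sum N y + bump N y by rewrite /bump_sum big_ord_recr.
(* With [u, v <= c] one has [(u + v)^2 <= u^2 + 2 c v + c v], which is the origin of the factor
   3. *)
move: IH hs hs0 hb0 hb; set u := bump_sum N y; set v := bump N y; set c := 2 ^+ N.
rewrite !expr2 => IH; nra.
Qed.

(** The majorant of [bump_sum_sqr], up to its factor 3, also dominates the first power, so that all
    powers between 1 and 2 are covered by one sum of [L^1]-normalised Gaussians. *)
Lemma bump_sum_le N y :
  bump_sum N y <= \sum_(k < N) 4 ^+ k * expR (- (4 ^+ k * y) ^+ 2).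
Proof.
apply: ler_sum => k _; rewrite /bump exprMn -exprM mulnC exprM.
have -> : ((4 : R) ^+ 2) = 16 by ring.
by rewrite ler_wpM2r ?expR_ge0// lerXn2r ?nnegrE// ler_nat.
Qed.

Lemma integral_gauss_lty : (\int[mu]_y (expR (- y ^+ 2))%:E < +oo)%E.
Proof. by rewrite integralT_gauss ltry. Qed.

Lemma measurable_gauss : measurable_fun setT (fun y : R => (expR (- y ^+ 2))%:E).
Proof.
apply: measurable_EFin_fun.
have -> : (fun y : R => expR (- y ^+ 2)) = gauss1.
  by apply/funext => y; rewrite /gauss1 mul1r.
by apply: rschwartz_measurable; exact: rschwartz_gauss.
Qed.

Lemma integral_scaled_gauss (c : R) : 0 < c ->
  (\int[mu]_y (c * expR (- (c * y) ^+ 2))%:E <= \int[mu]_y (expR (- y ^+ 2))%:E)%E.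
Proof.
move=> c0; under eq_integral do rewrite EFinM.
have mcx : measurable_fun setT (fun y : R => c * y) by apply: measurable_funM.
have mc : measurable_fun setT (fun y : R => (expR (- (c * y) ^+ 2))%:E).
  exact: (measurableT_comp measurable_gauss mcx).
rewrite ge0_integralZl ?lee_fin ?(ltW c0)//.
have H : (\int[mu]_y (expR (- (c * y) ^+ 2))%:E <=
    c^-1%:E * \int[mu]_y (expR (- y ^+ 2))%:E)%E.
  apply: (@le_integral_expanding R setT setT (fun y => c * y) c
    (fun y => (expR (- y ^+ 2))%:E) c0 measurableT measurableT mcx) => //.
  - by move=> s s' _ _; rewrite -mulrBr normrM gtr0_norm.
  - exact: measurable_gauss.
apply: (@le_trans _ _ (c%:E * (c^-1%:E * \int[mu]_y (expR (- y ^+ 2))%:E))%E).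
  by apply: lee_wpmul2l; rewrite ?lee_fin ?(ltW c0).
by rewrite muleA -EFinM divff ?gt_eqF// mul1e.
Qed.

Lemma CLnorm_bump_sum (p : R) : 1 <= p -> p <= 2 -> exists2 K : R, 0 <= K &
  forall N, (CLnorm p%:E (real_fun (bump_sum N)) <= ((N%:R * K) `^ p^-1)%:E)%E.
Proof.
move=> p1 p2; have p0 : 0 < p by exact: lt_le_trans p1.
pose I := (\int[mu]_y (expR (- y ^+ 2))%:E)%E; pose K := 4 * fine I.
have I0 : (0 <= I)%E by apply: integral_ge0 => y _; rewrite lee_fin expR_ge0.
have IE : I = (fine I)%:E by rewrite fineK// ge0_fin_numE// integral_gauss_lty.
have K0 : 0 <= K by rewrite mulr_ge0// fine_ge0.
exists K => // N; rewrite /CLnorm LnormE -poweR_EFin; apply: le_poweR.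
- by rewrite invr_ge0 ltW.
- by apply: integral_ge0 => y _; exact: poweR_ge0.
pose h (k : 'I_N) (y : R) := (4 ^+ k * expR (- (4 ^+ k * y) ^+ 2))%:E.
have h0 k y : (0 <= h k y)%E by rewrite lee_fin mulr_ge0 ?exprn_ge0 ?expR_ge0.
have mh k : measurable_fun setT (h k).
  have mcx : measurable_fun setT (fun y : R => 4 ^+ k * y) by apply: measurable_funM.
  have mc := measurableT_comp (@measurable_gauss) mcx.
  by rewrite /h; under eq_fun do rewrite EFinM; exact: emeasurable_funM.
apply: (@le_trans _ _ (\int[mu]_y (4%:E * \sum_(k < N) h k y))%E).
  apply: le_ge0_integral => y _; first exact: poweR_ge0.
  rewrite abse_EFin ger0_norm ?normc_ge0// poweR_EFin.
  rewrite normc_real_fun ?bump_sum_ge0// sumEFin -EFinM lee_fin.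
  have s1 := bump_sum_sqr N y; have s2 := bump_sum_le N y; have s0 := bump_sum_ge0 N y.
  move: s1; rewrite -mulr_sumr => s1.
  have pos : 0 <= \sum_(k < N) 4 ^+ k * expR (- (4 ^+ k * y) ^+ 2) by apply: le_trans s2.
  (* Where the sum is at most 1, its [p]-th power is at most the sum itself; elsewhere it is at most
     the square. *)
  have [le1|gt1] := lerP (bump_sum N y) 1.
    have [->|n0] := eqVneq (bump_sum N y) 0.
      by rewrite powR0 ?gt_eqF// mulr_ge0.
    apply: (@le_trans _ _ (bump_sum N y)).
      by apply: ge1r_powR => //; rewrite le1 lt_neqAle eq_sym n0 s0.
    by apply: le_trans s2 _; lra.
  apply: (@le_trans _ _ (bump_sum N y ^+ 2)).
    by rewrite -powR_mulrn//; apply: ler_powR => //; exact: ltW.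
  by apply: le_trans s1 _; lra.
rewrite ge0_integralZl ?lee_fin//; last first.
- by move=> y _; apply: sume_ge0.
- exact: emeasurable_sum.
rewrite ge0_integral_sum// /K mulrCA EFinM; apply: lee_wpmul2l => //.
apply: (@le_trans _ _ (\sum_(k < N) I)%E).
  by apply: lee_sum => k _; apply: integral_scaled_gauss; rewrite exprn_gt0.
by rewrite IE sumEFin sumr_const card_ord mulr_natl.
Qed.

Lemma CLnorm_gauss1_lty (P : \bar R) : (1 <= P)%E -> (CLnorm P (real_fun gauss1) < +oo)%E.
Proof.
have sg : schwartz (real_fun gauss1) by apply: schwartz_real_fun; exact: rschwartz_gauss.
case: P => [r||//].
  by rewrite lee_fin => r1; exact: schwartz_CLnorm_lty.
move=> _; rewrite /CLnorm unlock; case: ifP => // _.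
apply: (@le_lt_trans _ _ 1%E); last by rewrite ltry.
have le1 y : normc (real_fun gauss1 y) <= 1.
  by rewrite normc_real_fun ?expR_ge0// -expR0 ler_expR oppr_le0 mul1r sqr_ge0.
apply/ess_sup_inf.ess_supP; apply: aeW => y.
by rewrite /= lee_fin ger0_norm ?normc_ge0//; exact: le1.
Qed.

(** Level sets are defined by a strict inequality, so the level is [m / 2]; its set contains
    [[1, 2]], whose measure 1 is unaffected by the power [1 / p]. *)
Lemma weak_Lnorm_ge (p m : R) (h : R -> \bar R) : 0 < p -> 0 < m -> measurable_fun setT h ->
  (forall x, 1 <= x <= 2 -> (m%:E <= h x)%E) -> ((m / 2)%:E <= weak_Lnorm p h)%E.
Proof.
move=> p0 m0 mh H; have m20 : 0 < m / 2 by rewrite divr_gt0.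
have muI : mu `[1, 2]%classic = 1%E.
  by rewrite lebesgue_measure_itv/= lte_fin ltr1n -EFinB; congr (_%:E); lra.
pose A := [set x | ((m / 2)%:E < `|h x|)%E].
have mA : measurable (A : set (measurableTypeR R)).
  rewrite (_ : A = setT `&` (abse \o h) @^-1` `](m / 2)%:E, +oo[); last first.
    by rewrite setTI; apply/seteqP; split => x /=; rewrite in_itv/= andbT.
  have mah : measurable_fun setT (abse \o h) by exact: measurableT_comp.
  by apply: mah => //; exact: emeasurable_itv.
apply: (@le_trans _ _ ((m / 2)%:E * mu A `^ p^-1)%E); last first.
  by apply: ereal_sup_ubound; exists (m / 2).
rewrite -[leLHS]mule1; apply: lee_wpmul2l; first by rewrite lee_fin ltW.
rewrite -(poweR1r p^-1); apply: le_poweR => //; first by rewrite invr_ge0 ltW.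
rewrite -muI; apply: le_measure; rewrite ?inE//.
move=> x /=; rewrite in_itv/= => /H le; rewrite /A /= gee0_abs.
  by apply: lt_le_trans le; rewrite lte_fin ltr_pdivrMr// ltr_pMr// ltr1n.
by apply: le_trans le; rewrite lee_fin ltW.
Qed.

Lemma Lnorm_ge (p m : R) (h : R -> \bar R) : 0 < p -> 0 < m ->
  (forall x, 1 <= x <= 2 -> (m%:E <= h x)%E) -> (m%:E <= 'N[mu]_p%:E[h])%E.
Proof.
move=> p0 m0 H.
have muI : mu `[1, 2]%classic = 1%E.
  by rewrite lebesgue_measure_itv/= lte_fin ltr1n -EFinB; congr (_%:E); lra.
rewrite LnormE.
have -> : (m%:E = ((m `^ p)%:E) `^ p^-1)%E.
  by rewrite poweR_EFin -powRrM mulfV ?gt_eqF// powRr1// ltW.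
apply: le_poweR; rewrite ?lee_fin ?powR_ge0 ?invr_ge0 ?(ltW p0)//.
have -> : ((m `^ p)%:E = \int[mu]_(x in `[1%R, 2%R]) (m `^ p)%:E)%E.
  by rewrite -[LHS]mule1 -muI; apply/esym; exact: integral_cst.
rewrite integral_mkcond; apply: le_ge0_integral => x _; rewrite patchE; case: ifP => //.
- by rewrite lee_fin powR_ge0.
- rewrite inE/= in_itv/= => /H le; rewrite -poweR_EFin; apply: le_poweR; rewrite ?(ltW p0) ?lee_fin ?(ltW m0)//.
  by rewrite gee0_abs// (le_trans _ le)// lee_fin ltW.
- by move=> _; exact: poweR_ge0.
Qed.

Lemma sublinear_contradiction (q c D : R) : 1 < q -> 0 < c ->
  (forall N : nat, N.+1%:R * c <= D * N.+1%:R `^ q^-1) -> False.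
Proof.
move=> q1 c0 H; have q0 : 0 < q by exact: lt_trans q1.
have s0 : 0 < 1 - q^-1 by rewrite subr_gt0 invf_lt1.
(* [L] solves [L^s = |D| / c + 1], so [n > L] gives [n^s * c > |D|], and multiplying by [n^(1/q)]
   contradicts the hypothesis. *)
pose s := 1 - q^-1; pose L := (`|D| / c + 1) `^ s^-1.
have L0 : 0 <= L by exact: powR_ge0.
have base0 : 0 < `|D| / c + 1 by rewrite ltr_wpDl// divr_ge0// ltW.
pose N := Num.truncn L.
have LN : L < N.+1%:R by exact: truncnS_gt.
have := H N; set n : R := N.+1%:R; have n0 : 0 < n by rewrite ltr0n.
apply/negP; rewrite -ltNge.
have E : n = n `^ s * n `^ q^-1.
  by rewrite -powRD ?(gt_eqF n0) ?implybT// /s subrK powRr1// ltW.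
rewrite [in ltRHS]E mulrAC ltr_pM2r ?powR_gt0//.
have : `|D| / c + 1 < n `^ s.
  have -> : `|D| / c + 1 = L `^ s by rewrite /L -powRrM mulVf ?gt_eqF// powRr1// ltW.
  by apply: gt0_ltr_powR; rewrite ?nnegrE// ltW.
move=> lt0; have : (`|D| / c + 1) * c < n `^ s * c by rewrite ltr_pM2r.
rewrite mulrDl divfK ?gt_eqF// mul1r => lt.
by apply: le_lt_trans (ler_norm D) (lt_trans _ lt); rewrite ltrDl.
Qed.

(* [X] stands for either the weak or the strong [L^p] norm. *)
Lemma S2_unbounded b (p1 : R) (P2 : \bar R) (X : (R -> \bar R) -> \bar R) :
  1 < p1 -> p1 <= 2 -> (1 <= P2)%E ->
  (forall (m : R) (h : R -> \bar R), 0 < m -> measurable_fun setT h ->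
     (forall x, 1 <= x <= 2 -> (m%:E <= h x)%E) -> ((m / 2)%:E <= X h)%E) ->
  ~ exists C : R, forall u v : R -> R[i], schwartz u -> schwartz v ->
     (X (S2 (if b then u else v) (if b then v else u)) <= C%:E * (CLnorm p1%:E u * CLnorm P2 v))%E.
Proof.
move=> p11 p12 P21 XP [C H].
have sg : schwartz (real_fun gauss1) by apply: schwartz_real_fun; exact: rschwartz_gauss.
have sf N : schwartz (real_fun (bump_sum N)).
  by apply: schwartz_real_fun; exact: rschwartz_bump_sum.
have [K K0 HK] := CLnorm_bump_sum (ltW p11) p12.
pose G := fine (CLnorm P2 (real_fun gauss1)).
have GE : CLnorm P2 (real_fun gauss1) = G%:E.
  by rewrite fineK// ge0_fin_numE ?CLnorm_ge0// CLnorm_gauss1_lty.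
have G0 : 0 <= G by rewrite fine_ge0// CLnorm_ge0.
pose c : R := expR (- 17) / (2 * pi).
have c0 : 0 < c by rewrite divr_gt0 ?expR_gt0// mulr_gt0// pi_gt0.
have c20 : 0 < c / 2 by rewrite divr_gt0.
apply: (@sublinear_contradiction p1 (c / 2) (`|C| * (K `^ p1^-1 * G)) p11 c20) => N.
have n0 : 0 < N.+1%:R :> R by rewrite ltr0n.
rewrite -lee_fin mulrA.
set F1 := if b then real_fun (bump_sum N.+1) else real_fun gauss1.
set F2 := if b then real_fun gauss1 else real_fun (bump_sum N.+1).
have sF1 : schwartz F1 by rewrite /F1; case: (b).
have sF2 : schwartz F2 by rewrite /F2; case: (b).
apply: (@le_trans _ _ (X (S2 F1 F2))).
  apply: XP; first by rewrite mulr_gt0.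
    by rewrite schwartz_S2_Smax//; apply: measurable_Smax; exact: schwartz_cmeasurable.
  move=> x x12; apply: le_trans (arc_avg_bump_sum b N.+1 x12) _.
  have /andP[x1 _] := x12.
  apply: arc_avg_le_S2; [exact: rschwartz_bump_sum|exact: rschwartz_gauss|exact: bump_sum_ge0| |].
    by move=> y; exact: expR_ge0.
  exact: lt_le_trans x1.
apply: le_trans (H _ _ (sf N.+1) sg) _; rewrite GE.
(* The constant [C] comes without a sign, so it is replaced by its absolute value before the norm
   bounds are inserted. *)
apply: (@le_trans _ _ (`|C|%:E * (CLnorm p1%:E (real_fun (bump_sum N.+1)) * G%:E))%E).
  by apply: lee_wpmul2r; rewrite ?mule_ge0 ?CLnorm_ge0 ?lee_fin// ler_norm.
apply: (@le_trans _ _ (`|C|%:E * (((N.+1%:R * K) `^ p1^-1)%:E * G%:E))%E).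
  by apply: lee_wpmul2l; rewrite ?lee_fin//; apply: lee_wpmul2r; rewrite ?lee_fin.
rewrite -!EFinM lee_fin powRM// ?ler0n// le_eqVlt; apply/orP; left; apply/eqP; ring.
Qed.

Lemma S2_weak_unbounded (p : R) (P2 : \bar R) : (1 <= P2)%E -> 0 < p ->
  ~ S2_weak_bounded 2%:E P2 p /\ ~ S2_weak_bounded P2 2%:E p.
Proof.
move=> P21 p0.
have XP (m : R) (h : R -> \bar R) : 0 < m -> measurable_fun setT h ->
    (forall x, 1 <= x <= 2 -> (m%:E <= h x)%E) -> ((m / 2)%:E <= weak_Lnorm p h)%E.
  by move=> m0; exact: weak_Lnorm_ge.
split=> -[C H].
  by apply: (@S2_unbounded true 2 P2 (weak_Lnorm p)) => //; rewrite ?ltr1n//; exists C.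
apply: (@S2_unbounded false 2 P2 (weak_Lnorm p)) => //; first by rewrite ltr1n.
by exists C => f g sf sg; rewrite [(CLnorm _ f * _)%E]muleC; exact: H.
Qed.

Lemma S2_strong_bounded_gt2 (p1 p2 p : R) : 1 < p1 -> 1 < p2 -> 0 < p ->
  S2_strong_bounded p1 p2 p -> 2 < p1 /\ 2 < p2.
Proof.
move=> p11 p21 p0 [C H].
have XP (m : R) (h : R -> \bar R) : 0 < m -> measurable_fun setT h ->
    (forall x, 1 <= x <= 2 -> (m%:E <= h x)%E) -> ((m / 2)%:E <= 'N[mu]_p%:E[h])%E.
  move=> m0 _ mh; apply: le_trans (Lnorm_ge p0 m0 mh).
  by rewrite lee_fin ler_pdivrMr// ler_peMr ?ler1n// ltW.
split; rewrite ltNge; apply/negP => le2.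
  apply: (@S2_unbounded true p1 p2%:E (fun h => 'N[mu]_p%:E[h])%E) => //.
    by rewrite lee_fin ltW.
  by exists C.
apply: (@S2_unbounded false p2 p1%:E (fun h => 'N[mu]_p%:E[h])%E) => //.
  by rewrite lee_fin ltW.
by exists C => f g sf sg; rewrite [(CLnorm _ f * _)%E]muleC; exact: H.
Qed.

End counterexample.

Theorem theorem1 (R : realType) :
  (forall p1 p2 : R, 1 < p1 -> 1 < p2 ->
     let p := p1 * p2 / (p1 + p2) in
     (S2_strong_bounded p1 p2 p <-> 2 < p1 /\ 2 < p2) /\
     (2 < p1 /\ 2 < p2 ->
        exists! T : CLspace p1%:E * CLspace p2%:E -> CLspace p%:E,
          S2_bounded_extension T)) /\
  (forall (p2 : \bar R) (p : R), (1 <= p2)%E ->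
     (p^-1)%:E = ((2^-1)%R%:E + p2^-1)%E -> ~ S2_weak_bounded 2%:E p2 p) /\
  (forall (p1 : \bar R) (p : R), (1 <= p1)%E ->
     (p^-1)%:E = (p1^-1 + (2^-1)%R%:E)%E -> ~ S2_weak_bounded p1 2%:E p).
Proof.
split; first last.
  (* Positivity of [p] has to be read off the exponent relation: its right-hand side is at least
     [1/2], which also excludes [p = 0], where [p^-1] is 0 by convention. *)
  have p_gt0 (q : \bar R) (p : R) : (1 <= q)%E -> (p^-1)%:E = ((2^-1)%R%:E + q^-1)%E -> 0 < p.
    move=> q1 E; rewrite -invr_gt0 -lte_fin E.
    have q0 : (0 <= q^-1)%E by rewrite inve_ge0 (le_trans _ q1).
    by apply: (@lt_le_trans _ _ (2^-1)%:E); rewrite ?lte_fin ?invr_gt0// leeDl.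
  split=> [q p q1 E|q p q1 E].
    exact: (S2_weak_unbounded q1 (p_gt0 _ _ q1 E)).1.
  rewrite addeC in E; exact: (S2_weak_unbounded q1 (p_gt0 _ _ q1 E)).2.
move=> p1 p2 p11 p21 p.
have p10 : 0 < p1 by exact: lt_trans p11.
have p20 : 0 < p2 by exact: lt_trans p21.
have pE : p^-1 = p1^-1 + p2^-1.
  rewrite /p invf_div; field; by rewrite !gt_eqF.
have p0 : 0 < p by rewrite divr_gt0 ?mulr_gt0 ?addr_gt0.
split.
  split; first exact: S2_strong_bounded_gt2.
  move=> [p12 p22]; have [C C0 HC] := Smax_Lnorm_bound p12 p22 pE; exists C => f g sf sg.
  rewrite schwartz_S2_Smax//; apply: HC.
  - exact: schwartz_cmeasurable.
  - exact: schwartz_cmeasurable.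
  - by apply: schwartz_CLnorm_lty => //; exact: ltW.
  - by apply: schwartz_CLnorm_lty => //; exact: ltW.
move=> [p12 p22]; exists (S2_extension p12 p22 pE); split.
  exact: S2_extension_bounded_extension.
move=> T HT; apply: (bounded_extension_unique p12 p22 pE _ _ HT).
  by move=> q u e q1 e0; exact: schwartz_dense.
exact: S2_extension_bounded_extension.
Qed.
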